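(* Let $0<\alpha\le 1$. Suppose that $\Theta$ is a growth function satisfying the doubling condition with doubling constant $1\le D(\Theta)<2^n$. Then there is a constant $C>0$ such that for every sequence $\vec f=(f_1,f_2,\ldots)$ of locally integrable functions on $\mathbb R^n$, $$\bigg\|\bigg(\sum_{j}\big|\mathcal S_\alpha(f_j)\big|^2\bigg)^{1/2}\bigg\|_{WL^{1,\Theta}}\leq C \bigg\|\bigg(\sum_{j}|f_j|^2\bigg)^{1/2}\bigg\|_{L^{1,\Theta}}.$$
   Context: Intrinsic square function: for $0<\alpha\le1$ let $\mathcal C_\alpha$ be the family of functions $\varphi:\mathbb R^n\to\mathbb R$ supported in $\{|x|\le1\}$ with $\int_{\mathbb R^n}\varphi\,dx=0$ and $|\varphi(x)-\varphi(x')|\le|x-x'|^\alpha$ for all $x,x'\in\mathbb R^n$. Put $\varphi_t(y)=t^{-n}\varphi(y/t)$, $\Gamma(x)=\{(y,t)\in\mathbb R^n\times(0,\infty):|x-y|<t\}$, and for $f\in L^1_{loc}(\mathbb R^n)$ $$\mathcal S_\alpha(f)(x)=\left(\iint_{\Gamma(x)}\Big(\sup_{\varphi\in\mathcal C_\alpha}\Big|\int_{\mathbb R^n}\varphi_t(y-z)f(z)\,dz\Big|\Big)^2\frac{dy\,dt}{t^{n+1}}\right)^{1/2}.$$ Growth function: a positive increasing function $\Theta$ on $(0,+\infty)$ (increasing in the weak sense) satisfying the doubling condition $\Theta(2r)\le D\,\Theta(r)$ for all $r>0$, where $D=D(\Theta)\ge1$ is a constant independent of $r$. Norms (suprema over all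 $x_0\in\mathbb R^n$, $r>0$; $B(x_0,r)$ the open ball; $|\cdot|$ Lebesgue measure of sets): $\|f\|_{L^{1,\Theta}}=\sup_{B(x_0,r)}\frac1{\Theta(r)}\int_{B(x_0,r)}|f(x)|\,dx$ and $\|f\|_{WL^{1,\Theta}}=\sup_{B(x_0,r)}\sup_{\lambda>0}\frac1{\Theta(r)}\,\lambda\cdot|\{x\in B(x_0,r):|f(x)|>\lambda\}|$. *)

(* Defs.v *)
From HB Require Import structures.
From mathcomp Require Import all_boot all_order all_algebra.
From mathcomp Require Import all_classical all_reals all_analysis.
Import Order.TTheory GRing.Theory Num.Theory.
Import numFieldNormedType.Exports.

Set Implicit Arguments.
Unset Strict Implicit.
Unset Printing Implicit Defensive.

Local Open Scope classical_set_scope.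
Local Open Scope ring_scope.

(* R^n is 'rV[R]_n. The library's norm `|x| on 'rV[R]_n is the sup norm, so the
   Euclidean norm and the Euclidean balls are defined here. *)

Definition enorm (R : realType) (n : nat) (x : 'rV[R]_n) : R :=
  Num.sqrt (\sum_(i < n) x ord0 i ^+ 2).

Definition eball (R : realType) (n : nat) (x0 : 'rV[R]_n) (r : R)
    : set 'rV[R]_n :=
  [set x | enorm (x - x0) < r].

Section lebesgue_measure_rV.
Context (R : realType) (n : nat).
Implicit Types (p : 'rV[R]_n * 'rV[R]_n) (C : set ('rV[R]_n * 'rV[R]_n)).

Definition box p : set 'rV[R]_n :=
  [set x | forall i, p.1 ord0 i < x ord0 i <= p.2 ord0 i].

Definition box_vol p : R :=
  \prod_(i < n) Num.max 0 (p.2 ord0 i - p.1 ord0 i).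

Definition box_cover (A : set 'rV[R]_n) C :=
  countable C /\ A `<=` \bigcup_(p in C) box p.

Definition lebesgue_outer (A : set 'rV[R]_n) : \bar R :=
  ereal_inf [set (\esum_(p in C) (box_vol p)%:E)%E | C in box_cover A].

Lemma box_vol_ge0 p : 0 <= box_vol p.
Proof. by apply: prodr_ge0 => i _; rewrite le_max lexx. Qed.

Lemma lebesgue_outer_ge0 A : (0 <= lebesgue_outer A)%E.
Proof.
apply: le_ereal_inf_tmp => _ [C _ <-]; apply: esum_ge0 => p _.
by rewrite lee_fin box_vol_ge0.
Qed.

Lemma lebesgue_outer0 : lebesgue_outer set0 = 0%E.
Proof.
apply/eqP; rewrite eq_le lebesgue_outer_ge0 andbT.
apply: ereal_inf_lbound; exists set0; last exact: esum_set0.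
by split=> //; exact: countable0.
Qed.

Lemma le_lebesgue_outer :
  {homo lebesgue_outer : A B / A `<=` B >-> (A <= B)%E}.
Proof.
move=> A B AB; apply: ereal_inf_le_tmp => _ [C [cC BC] <-].
by exists C => //; split=> //; exact: subset_trans BC.
Qed.

Lemma lebesgue_outer_sigma_subadditive : sigma_subadditive lebesgue_outer.
Proof.
move=> A; have [[i ioo]|] := pselect (exists i, lebesgue_outer (A i) = +oo%E).
  rewrite (eseries_pinfty _ _ ioo) ?leey// => k _.
  by rewrite -ltNye (lt_le_trans _ (lebesgue_outer_ge0 _)).
rewrite -forallNE => Aoo; apply/lee_addgt0Pr => e e0.
rewrite (le_trans _ (epsilon_trick _ _ (ltW e0)))//; last first.
  by move=> k; exact: lebesgue_outer_ge0.
have vol0 p : (0 <= (box_vol p)%:E)%E by rewrite lee_fin box_vol_ge0.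
pose P k C := box_cover (A k) C /\
  (\esum_(p in C) (box_vol p)%:E <=
   lebesgue_outer (A k) + (e / (2 ^ k.+1)%:R)%:E)%E.
have [G PG] : {G : nat -> set ('rV[R]_n * 'rV[R]_n) & forall k, P k (G k)}.
  apply: (@choice _ _ P) => k.
  have ek : 0 < e / (2 ^ k.+1)%:R by rewrite divr_gt0// ltr0n expn_gt0.
  have fA : lebesgue_outer (A k) \is a fin_num.
    by rewrite ge0_fin_numE ?lebesgue_outer_ge0// ltey; exact/eqP/Aoo.
  have [_ [C covC <-] ltC] := lb_ereal_inf_adherent ek fA.
  by exists C; split=> //; apply: ltW; exact: ltC.
apply: (@le_trans _ _
    (\sum_(k <oo) \esum_(p in G k) (box_vol p)%:E)%E); last first.
  apply: lee_nneseries => [k _ _|k _]; first exact: esum_ge0.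
  by have [_] := PG k.
apply: (@le_trans _ _ (\esum_(p in \bigcup_k G k) (box_vol p)%:E)%E).
  apply: ereal_inf_lbound; exists (\bigcup_k G k) => //; split.
    by apply: bigcup_countable => // k _; have [[]] := PG k.
  move=> x [k _ xk]; have [[_ /(_ _ xk)[p Gp xp]] _] := PG k.
  by exists p => //; exists k.
rewrite seqDU_bigcup_eq (esum_bigcupT _ _ (@trivIset_seqDU _ G) vol0).
rewrite nneseries_esumT; last by move=> k; exact: esum_ge0.
apply: le_esum => k _.
rewrite [leLHS]esum_mkcond [leRHS]esum_mkcond; apply: le_esum => p _.
case: ifPn => [|_]; last by case: ifP.
by move=> /set_mem[Gp _]; rewrite mem_set.
Qed.

HB.instance Definition _ := isOuterMeasure.Build R 'rV[R]_n lebesgue_outer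
  lebesgue_outer0 lebesgue_outer_ge0 le_lebesgue_outer
  lebesgue_outer_sigma_subadditive.

End lebesgue_measure_rV.

(* R^n with the sigma-algebra of Lebesgue (i.e. Caratheodory) measurable sets,
   and n-dimensional Lebesgue measure on it *)
Definition lebesgueRn (R : realType) (n : nat) :=
  caratheodory_type (@lebesgue_outer R n).

HB.instance Definition _ (R : realType) (n : nat) :=
  Measurable.on (lebesgueRn R n).

Definition lebesgue_rV (R : realType) (n : nat)
    : set (lebesgueRn R n) -> \bar R :=
  @lebesgue_outer R n.

HB.instance Definition _ (R : realType) (n : nat) :=
  isMeasure.Build _ (lebesgueRn R n) R (@lebesgue_rV R n)
    (@caratheodory_measure0 R 'rV[R]_n (@lebesgue_outer R n))
    (@caratheodory_measure_ge0 R 'rV[R]_n (@lebesgue_outer R n))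
    (@caratheodory_measure_sigma_additive R 'rV[R]_n (@lebesgue_outer R n)).

Definition loc_integrable (R : realType) (n : nat) (f : 'rV[R]_n -> R) :=
  measurable_fun (setT : set (lebesgueRn R n)) f /\
  forall K : set 'rV[R]_n, compact K ->
    (\int[@lebesgue_rV R n]_(x in K) `|f x|%:E < +oo)%E.

Definition C_alpha (R : realType) (n : nat) (alpha : R)
    : set ('rV[R]_n -> R) :=
  [set phi | [/\ forall x, 1 < enorm x -> phi x = 0,
      (\int[@lebesgue_rV R n]_x (phi x)%:E = 0)%E &
      forall x x', `|phi x - phi x'| <= enorm (x - x') `^ alpha]].

Definition dilate (R : realType) (n : nat) (phi : 'rV[R]_n -> R) (t : R)
    (y : 'rV[R]_n) : R :=
  t ^- n * phi (t^-1 *: y).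

Definition cone (R : realType) (n : nat) (x : 'rV[R]_n)
    : set ('rV[R]_n * R) :=
  [set p | 0 < p.2 /\ enorm (x - p.1) < p.2].

Definition A_alpha (R : realType) (n : nat) (alpha : R) (f : 'rV[R]_n -> R)
    (y : 'rV[R]_n) (t : R) : \bar R :=
  ereal_sup
    [set `|\int[@lebesgue_rV R n]_z (dilate phi t (y - z) * f z)%:E|%E
    | phi in @C_alpha R n alpha].

Definition S_alpha (R : realType) (n : nat) (alpha : R) (f : 'rV[R]_n -> R)
    (x : 'rV[R]_n) : \bar R :=
  ((\int[(@lebesgue_rV R n \x @lebesgue_measure R)%E]_(p in cone x)
     (A_alpha alpha f p.1 p.2 ^+ 2 * (p.2 ^- n.+1)%:E)) `^ 2^-1)%E.

Definition growth_function (R : realType) (Theta : R -> R) :=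
  (forall r, 0 < r -> 0 < Theta r) /\
  (forall r s, 0 < r -> r <= s -> Theta r <= Theta s).

Definition doubling (R : realType) (Theta : R -> R) (D : R) :=
  forall r, 0 < r -> Theta (2 * r) <= D * Theta r.

(* The functions measured by the norms may take the value +oo (a square
   function, or the l^2 norm of a sequence), hence the codomain \bar R. *)

Definition L1_norm (R : realType) (n : nat) (Theta : R -> R)
    (g : 'rV[R]_n -> \bar R) : \bar R :=
  ereal_sup [set ((Theta q.2)^-1%:E *
      \int[@lebesgue_rV R n]_(x in eball q.1 q.2) `|g x|)%E
    | q in [set q : 'rV[R]_n * R | 0 < q.2]].

Definition WL1_norm (R : realType) (n : nat) (Theta : R -> R)
    (g : 'rV[R]_n -> \bar R) : \bar R :=
  ereal_sup [set ereal_sup [set ((Theta q.2)^-1%:E * (lambda%:E *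
      lebesgue_rV (eball q.1 q.2 `&` [set x | lambda%:E < `|g x|])))%E
    | lambda in [set lambda : R | 0 < lambda]]
    | q in [set q : 'rV[R]_n * R | 0 < q.2]].

Definition l2_norm (R : realType) (u : nat -> \bar R) : \bar R :=
  ((\sum_(0 <= j <oo) `|u j| ^+ 2) `^ 2^-1)%E.

(* Main.v *)
(* The cone integral defining S_alpha f (x) is cut along the dyadic rectangles
   cell x [2^k, 2^(k+1)). On such a rectangle the supremum over C_alpha is at most
   twice |<h, f>| for one nearly extremal bump h of side s = 2^k, so S_alpha f (x)^2
   is dominated by the sum of the 4 <h, f>^2 over the bumps whose dilated cube contains
   x: the sup over phi disappears and only countably many linear functionals remain.

   Finitely many such functionals satisfy an l^2-valued weak (1,1) bound. The L^2
   bound is a T T* argument: cancellation and Hoelder continuity make the bumps almost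
   orthogonal, the inner products decaying geometrically in the difference of scales.
   The Calderon-Zygmund decomposition is run on the cells of side at least the finest
   side sigma of the family, where the bad part has zero average on each of its cells;
   no Lebesgue differentiation is needed.

   On a ball of radius r, the scales s <= r/6 only see f on the cube of half-side 2r,
   and the weak (1,1) bound with doubling gives Theta r. For s > r/6 the bumps obey the
   pointwise bound s^-n Theta (8 n s), which doubling turns into
   r^-n Theta r (D / 2^n)^i at s ~ 2^i r: a geometric series because D < 2^n. *)
Require Import Defs.
From mathcomp Require Import all_boot all_order all_algebra.
From mathcomp Require Import all_classical all_reals all_analysis.
From mathcomp Require Import measurable_realfun.
From mathcomp Require Import lra ring zify.
Import Order.TTheory GRing.Theory Num.Theory.
Import numFieldNormedType.Exports.

Set Implicit Arguments.
Unset Strict Implicit.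
Unset Printing Implicit Defensive.

Local Open Scope classical_set_scope.
Local Open Scope ring_scope.

(** The supremum in [A_alpha] leaves the measurability of [S_alpha f] unclear, and the argument is
    arranged to avoid the question: [lebesgue_rV] is an outer measure, hence monotone on all sets,
    and integrals of nonnegative functions compare without measurability. So [S_alpha] is only
    bounded from above, by finite sums that are visibly measurable. The nearly extremal bumps depend
    on [f], which seems to spoil the linearity needed to split [f] into a good and a bad part. The
    way out is to freeze them: the weak (1,1) bound holds for every choice of atoms, a different one
    for each component [f j], with a constant depending only on [n] and [theta]. Once frozen, the
    functionals are linear. Finiteness provides a finest side, so the stopping argument has a bottom
    level; the constants do not see the truncation, and the full series is reached by continuity
    from below. *)

Lemma outer_measure_countable_cover (R : realType) (X : Type) (T : choiceType)
    (mu : {outer_measure set X -> \bar R}) (C : set T) (g : T -> set X)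
    (A : set X) : countable C -> A `<=` \bigcup_(t in C) g t ->
  (mu A <= \esum_(t in C) mu (g t))%E.
Proof.
move=> /countable_injP[f finj] AC.
(* An injection [f] into [nat] codes the index set: [B k] is the set with code [k], or empty when
   [k] is no code. *)
pose B k := \bigcup_(t in C `&` [set t | f t = k]) g t.
have Bf t : C t -> B (f t) = g t.
  move=> Ct; apply/seteqP; split=> x; last by move=> gx; exists t.
  by move=> [u [Cu /= fu]]; rewrite (finj u t) ?inE.
have AB : A `<=` \bigcup_k B k.
  by move=> x /AC[t Ct gx]; exists (f t) => //; rewrite Bf.
apply: le_trans (le_outer_measure mu _ _ AB) _.
apply: le_trans (outer_measure_sigma_subadditive mu B) _.
rewrite nneseries_esumT; last by move=> k; exact: outer_measure_ge0.
rewrite (_ : (\esum_(t in C) mu (g t) = \esum_(t in C) mu (B (f t)))%E); last first.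
  by apply: eq_esum => t Ct; rewrite Bf.
rewrite -(@esum_image R T nat C f (fun k => mu (B k)) finj) [leRHS]esum_mkcond.
apply: le_esum => k _; case: ifPn => // /negP kC.
rewrite (_ : B k = set0) ?outer_measure0//.
apply/seteqP; split=> // x [t [Ct /= ft] _]; apply: kC; rewrite inE.
by exists t.
Qed.

(** * Lebesgue measure of boxes and its behaviour under homotheties *)

Section boxes.
Context (R : realType) (n : nat).
Notation mu := (@lebesgue_rV R n).
Implicit Types (p : 'rV[R]_n * 'rV[R]_n) (C : set ('rV[R]_n * 'rV[R]_n)).

Lemma lebesgue_outer_box_le p : (lebesgue_outer (box p) <= (box_vol p)%:E)%E.
Proof.
apply: ereal_inf_lbound; exists [set p].
  by split; [exact: countable1|rewrite bigcup_set1].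
by rewrite esum_set1// lee_fin box_vol_ge0.
Qed.

Definition upd (x : 'rV[R]_n) (i : 'I_n) (c : R) : 'rV[R]_n :=
  \row_j if j == i then c else x ord0 j.

Lemma updE x i c j : upd x i c ord0 j = if j == i then c else x ord0 j.
Proof. by rewrite mxE. Qed.

(** Caratheodory's criterion: the hyperplane cuts each box of a cover into two boxes whose volumes
    add up. When it misses the box, one of them has crossed endpoints and volume 0 by the
    [Num.max 0] in [box_vol]. *)
Lemma measurable_halfspace (i : 'I_n) (c : R) :
  measurable ([set x | x ord0 i <= c] : set (lebesgueRn R n)).
Proof.
apply: le_caratheodory_measurable => X /=.
apply: le_ereal_inf_tmp => _ [C [cC XC] <-].
pose lo p := (p.1, upd p.2 i (Num.min (p.2 ord0 i) c)).
pose hi p := (upd p.1 i (Num.max (p.1 ord0 i) c), p.2).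
have volD p : box_vol p = box_vol (lo p) + box_vol (hi p).
  rewrite {1}/box_vol (bigD1 i)//= /box_vol [in X in _ = X + _](bigD1 i)//=.
  rewrite [in X in _ = _ + X](bigD1 i)//= !updE eqxx.
  under [X in _ = _ * X + _]eq_bigr => j /negPf ji do rewrite updE ji.
  under [X in _ = _ + _ * X]eq_bigr => j /negPf ji do rewrite updE ji.
  rewrite -mulrDl; congr (_ * _).
  move: (p.1 _ _) (p.2 _ _) => a b.
  rewrite [Num.min b c]minEle [Num.max a c]maxEle.
  by case: (leP b c) => ?; case: (leP a c) => ?;
    do 3?case: leP => ?; lra.
have covlo : X `&` [set x | x ord0 i <= c] `<=` \bigcup_(p in C) box (lo p).
  move=> x [/XC[p Cp xp] xc]; exists p => // j; rewrite updE.
  by case: eqP => [->|_]; rewrite ?le_min ?xc ?andbT; exact: xp.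
have covhi : X `&` ~` [set x | x ord0 i <= c] `<=` \bigcup_(p in C) box (hi p).
  move=> x [/XC[p Cp xp] /negP]; rewrite -ltNge => xc; exists p => // j.
  rewrite updE; case: eqP => [->|_]; last exact: xp.
  by rewrite gt_max xc andbT; exact: xp.
under eq_esum do rewrite volD EFinD.
rewrite esumD => [||p _]; try by move=> *; rewrite lee_fin box_vol_ge0.
have cov_le Y (g : _ -> 'rV[R]_n * 'rV[R]_n) : Y `<=` \bigcup_(p in C) box (g p) ->
    (lebesgue_outer Y <= \esum_(p in C) (box_vol (g p))%:E)%E.
  move=> /(@outer_measure_countable_cover R _ _ (@lebesgue_outer R n) _ _ _ cC).
  move=> /le_trans; apply; apply: le_esum => p _; exact: lebesgue_outer_box_le.
by apply: leeD; exact: cov_le.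
Qed.

Lemma measurable_coord (i : 'I_n) :
  measurable_fun (setT : set (lebesgueRn R n)) (fun x : 'rV[R]_n => x ord0 i).
Proof.
apply: (measurability _ (measurable_realfun.RGenOInfty.measurableE R)) => //.
move=> _ [_ [c ->] <-]; rewrite setTI.
rewrite (_ : _ @^-1` _ = ~` [set x : 'rV[R]_n | x ord0 i <= c]).
  by apply: measurableC; exact: measurable_halfspace.
apply/seteqP; split=> x /=; rewrite in_itv/= andbT ltNge.
  by move/negP.
by move/negP.
Qed.

Lemma measurable_box p : measurable (box p : set (lebesgueRn R n)).
Proof.
rewrite (_ : box p = \big[setI/setT]_(i < n)
    ((fun x : 'rV[R]_n => x ord0 i) @^-1` `]p.1 ord0 i, p.2 ord0 i])).
  apply: (big_ind (fun A => measurable (A : set (lebesgueRn R n)))) => //.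
    by move=> A B; exact: measurableI.
  by move=> i _; rewrite -[X in measurable X]setTI;
    apply: (@measurable_coord i measurableT); exact: measurable_itv.
apply/seteqP; split=> x.
  move=> px; apply: (big_ind (fun A : set 'rV[R]_n => A x)) => // i _ /=.
  by rewrite in_itv/=; exact: px.
move=> + i; rewrite (bigD1 i)//= => -[/=].
by rewrite in_itv.
Qed.

(** Interpolates between the indicator of the box ([m = 0]) and its volume ([m = n]): the first [m]
    coordinates are integrated out, the others are still evaluated at [x]. *)
Let G (m : nat) (x : 'rV[R]_n) p : R :=
  \prod_(i < n) (if (i < m)%N then Num.max 0 (p.2 ord0 i - p.1 ord0 i)
                 else (p.1 ord0 i < x ord0 i <= p.2 ord0 i)%R%:R).

Let G_ge0 m x p : 0 <= G m x p.
Proof. by apply: prodr_ge0 => i _; case: ifP; rewrite ?le_max ?lexx. Qed.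

Let Gupd (i : 'I_n) x p t : G i (upd x i t) p =
  \1_(`]p.1 ord0 i, p.2 ord0 i] : set R) t *
  \prod_(j < n | j != i) (if (j < i)%N then Num.max 0 (p.2 ord0 j - p.1 ord0 j)
                 else (p.1 ord0 j < x ord0 j <= p.2 ord0 j)%R%:R).
Proof.
rewrite /G (bigD1 i)//= ltnn updE eqxx indicE mem_setE in_itv/=; congr (_ * _).
by apply: eq_bigr => j /negPf ji; rewrite updE ji.
Qed.

Let measurable_Gupd (i : 'I_n) x p : measurable_fun setT (fun t : R => G i (upd x i t) p).
Proof.
by under eq_fun do rewrite Gupd; apply: measurable_funM => //;
  exact: measurable_indic.
Qed.

Let integral_G (i : 'I_n) x p :
  (\int[@lebesgue_measure R]_t (G i (upd x i t) p)%:E = (G i.+1 x p)%:E)%E.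
Proof.
under eq_integral do rewrite Gupd mulrC EFinM.
rewrite ge0_integralZl_EFin//; last 2 first.
- by apply/measurable_EFinP; exact: measurable_indic.
- by apply: prodr_ge0 => j _; case: ifP; rewrite ?le_max ?lexx.
rewrite integral_indic//= setIT lebesgue_measure_itv/= lte_fin.
rewrite /G [in RHS](bigD1 i)//= ltnSn mulrC EFinM.
congr (_ * _)%E; last first.
  rewrite [in RHS]maxEle subr_ge0.
  by case: ltgtP => // ->; rewrite subrr.
congr EFin; apply: eq_bigr => j /negPf ji; rewrite [in RHS]ltnS [in RHS]leq_eqVlt.
by rewrite (_ : (j == i :> nat) = false).
Qed.

(** A cover gives a pointwise inequality between indicators. Integrating it in one coordinate after
    the other, with one-dimensional Lebesgue measure and monotone convergence, turns it into an
    inequality between volumes. *)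
Let le_series_G (p : 'rV[R]_n * 'rV[R]_n)
    (q : nat -> option ('rV[R]_n * 'rV[R]_n)) :
  (forall x, (G 0 x p)%:E <= \sum_(k <oo) (oapp (G 0 x) 0 (q k))%:E)%E ->
  forall m x, (m <= n)%N ->
  ((G m x p)%:E <= \sum_(k <oo) (oapp (G m x) 0 (q k))%:E)%E.
Proof.
move=> H0; elim=> // m IH x mn.
rewrite -(integral_G (Ordinal mn)).
have ge0 k t i : (0 <= (oapp (G i (upd x (Ordinal mn) t)) 0 (q k))%:E)%E.
  by rewrite lee_fin; case: (q k) => //= a; exact: G_ge0.
have mq k : measurable_fun setT
    (fun t => (oapp (G m (upd x (Ordinal mn) t)) 0 (q k))%:E).
  apply/measurable_EFinP; case: (q k) => [a|]//=.
  exact: (measurable_Gupd (Ordinal mn)).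
have -> : (\sum_(k <oo) (oapp (G m.+1 x) 0 (q k))%:E =
    \int[@lebesgue_measure R]_t
      \sum_(k <oo) (oapp (G m (upd x (Ordinal mn) t)) 0 (q k))%:E)%E.
  rewrite integral_nneseries//; apply: eq_eseriesr => k _.
  by case: (q k) => [a|]/=; rewrite ?(integral_G (Ordinal mn))// integral0.
apply: ge0_le_integral => //.
- by move=> t _; rewrite lee_fin.
- by apply/measurable_EFinP; exact: (measurable_Gupd (Ordinal mn)).
- apply: ge0_emeasurable_sum => [k t _ _|k _]; first exact: ge0.
  exact: mq.
- by move=> t _; apply: IH; exact: ltnW.
Qed.

Lemma lebesgue_rV_box p : mu (box p) = (box_vol p)%:E.
Proof.
apply/eqP; rewrite eq_le lebesgue_outer_box_le/=.
apply: le_ereal_inf_tmp => _ [C [/countable_injP[f finj] XC] <-].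
(* [q] lists the cover by its codes; a [None] contributes 0 to the series. *)
pose q k : option ('rV[R]_n * 'rV[R]_n) :=
  if pselect (exists2 p, C p & f p = k) is left h
  then Some (projT1 (cid2 h)) else None.
have qf a : C a -> q (f a) = Some a.
  move=> Ca; rewrite /q; case: pselect => [h|]; last by case; exists a.
  by case: cid2 => /= b Cb /finj ->//; rewrite inE.
have G0E x a : G 0 x a = \1_(box a) x.
  rewrite /G indicE /=; case: (boolP (x \in box a)).
    by rewrite inE => xa; apply: big1 => i _; rewrite xa.
  rewrite notin_setE => /existsNP[i /negP xi].
  by rewrite (bigD1 i)//= (negPf xi) mul0r.
have GnE x a : G n x a = box_vol a.
  by apply: eq_bigr => i _; rewrite ltn_ord.
have qge0 m x k : (0 <= (oapp (G m x) 0 (q k))%:E)%E.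
  by rewrite lee_fin; case: (q k) => //= a; exact: G_ge0.
have H0 x : ((G 0 x p)%:E <= \sum_(k <oo) (oapp (G 0 x) 0 (q k))%:E)%E.
  rewrite G0E indicE; case: (boolP (x \in box p)) => [|_]; last exact: nneseries_ge0.
  rewrite inE => /XC[a Ca xa].
  rewrite (@nneseriesD1 _ _ (f a))// qf//= G0E indicE mem_set//.
  by rewrite leeDl// nneseries_ge0.
have := @le_series_G p q H0 n 0 (leqnn n); rewrite GnE => /le_trans; apply.
rewrite nneseries_esumT//.
rewrite (eq_esum (b := fun a => (oapp (G n 0) 0 (q (f a)))%:E)); last first.
  by move=> a Ca; rewrite qf//= GnE.
rewrite -(@esum_image R _ nat C f (fun k => (oapp (G n 0) 0 (q k))%:E) finj) [leRHS]esum_mkcond.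
apply: le_esum => k _; case: ifPn => // /negP kC.
rewrite /q; case: pselect => //= -[a Ca fa]; exfalso; apply: kC.
by rewrite inE; exists a.
Qed.

End boxes.

Lemma esumZl_le (R : realType) (T : choiceType) (C : set T) (f : T -> \bar R)
    (k : R) : 0 <= k -> (forall t, 0 <= f t)%E ->
  (\esum_(t in C) (k%:E * f t) <= k%:E * \esum_(t in C) f t)%E.
Proof.
move=> k0 f0; apply: ge_ereal_sup => _ [F [finF FC] <-].
rewrite -ge0_mule_fsumr//; apply: lee_wpmul2l; first by rewrite lee_fin.
by apply: esum_ge; exists F.
Qed.

Section affine.
Context (R : realType) (n : nat).
Notation mu := (@lebesgue_rV R n).
Notation outer := (@lebesgue_outer R n).
Implicit Types (a x y : 'rV[R]_n) (b : R) (A : set 'rV[R]_n).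

Let exprn_prod (c : R) : c ^+ n = \prod_(i < n) c.
Proof. by rewrite prodr_const card_ord. Qed.

(** A homothety of negative ratio exchanges the endpoints, so the preimage of a left-open box is
    open on the right. *)
Let ico (p : 'rV[R]_n * 'rV[R]_n) : set 'rV[R]_n :=
  [set x | forall i, p.1 ord0 i <= x ord0 i < p.2 ord0 i].

Let outer_ico_le p : (outer (ico p) <= (box_vol p)%:E)%E.
Proof.
have [[i pi]|/forallNP pp] := pselect (exists i, p.2 ord0 i <= p.1 ord0 i).
  rewrite (_ : ico p = set0) ?lebesgue_outer0 ?lee_fin ?box_vol_ge0//.
  apply/seteqP; split=> // x /(_ i) /andP[p1 p2].
  by have := lt_le_trans p2 (le_trans pi p1); rewrite ltxx.
have w_gt0 i : 0 < p.2 ord0 i - p.1 ord0 i.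
  by rewrite subr_gt0 ltNge; apply/negP/pp.
(* Moving the lower endpoints by the fraction [e] of the sides gives a left-open box that contains
   [ico p]; then [e] tends to 0. *)
have le_e (e : R) : 0 < e ->
    (outer (ico p) <=
     ((1 + e) ^+ n * box_vol p)%:E)%E.
  move=> e0; pose p' := (p.1 - e *: (p.2 - p.1), p.2).
  have -> : (1 + e) ^+ n * box_vol p = box_vol p'.
    rewrite /box_vol exprn_prod -big_split/=.
    apply: eq_bigr => i _; have := w_gt0 i; rewrite !mxE.
    move: (p.1 _ _) (p.2 _ _) => u v uv.
    rewrite (_ : v - (u - e * (v - u)) = (1 + e) * (v - u)); last by ring.
    have uv0 := ltW uv; have e10 : 0 <= 1 + e by rewrite addr_ge0// ltW.
    by rewrite !max_r// mulr_ge0.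
  apply: le_trans (lebesgue_outer_box_le p'); apply: le_lebesgue_outer.
  move=> x xp i; have /andP[xp1 xp2] := xp i; rewrite (ltW xp2) andbT/= !mxE.
  by apply: lt_le_trans xp1; rewrite ltrBlDr ltrDl mulr_gt0.
have foo : outer (ico p)
    \is a fin_num.
  by rewrite ge0_fin_numE ?lebesgue_outer_ge0// (le_lt_trans (le_e _ ltr01)) ?ltry.
rewrite -(fineK foo) lee_fin.
have : (1 + e) ^+ n * box_vol p @[e --> 0^'+] --> box_vol p.
  apply: cvg_at_right_filter.
  rewrite -[X in _ --> X]mul1r -[X in X * _](expr1n _ n) -[X in X ^+ n]addr0.
  apply: cvgMl; apply: (cvg_comp (fun e : R => 1 + e) (fun u : R => u ^+ n)).
    by apply: cvgD; [exact: cvg_cst|exact: cvg_id].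
  exact: exprn_continuous.
move/cvgr_to_ge; apply; near=> e.
by rewrite -lee_fin fineK//; apply: le_e.
Unshelve. all: by end_near. Qed.

Let aff a b x : 'rV[R]_n := a + b *: x.

Lemma affE a b x i : aff a b x ord0 i = a ord0 i + b * x ord0 i.
Proof. by rewrite !mxE. Qed.

Let outer_aff_box_le a b p : b != 0 ->
  (outer (aff a b @^-1` box p) <= (`|b| ^- n * box_vol p)%:E)%E.
Proof.
move=> b0.
pose f (u : 'rV[R]_n) (i : 'I_n) := (u ord0 i - a ord0 i) / b.
have [bp|bn|b00] := ltgtP 0 b; last by rewrite -b00 eqxx in b0.
- pose p' := (\row_i f p.1 i, \row_i f p.2 i).
  have -> : `|b| ^- n * box_vol p = box_vol p'.
    rewrite /box_vol -exprVn exprn_prod -big_split/=.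
    apply: eq_bigr => i _; rewrite !mxE /f gtr0_norm//.
    rewrite -[X in Num.max X _](mulr0 b^-1) maxr_pMr ?invr_ge0 ?ltW//.
    by congr Num.max; field.
  apply: le_trans (lebesgue_outer_box_le p'); apply: le_lebesgue_outer.
  move=> x xp i; have := xp i; rewrite affE !mxE /f.
  by rewrite ltr_pdivrMr// ler_pdivlMr// ltrBlDl lerBrDl [x _ _ * _]mulrC.
- pose p' := (\row_i f p.2 i, \row_i f p.1 i).
  have -> : `|b| ^- n * box_vol p = box_vol p'.
    rewrite /box_vol -exprVn exprn_prod -big_split/=.
    apply: eq_bigr => i _; rewrite !mxE /f ltr0_norm//.
    rewrite -[X in Num.max X _](mulr0 (- b)^-1) maxr_pMr ?invr_ge0 ?oppr_ge0 ?ltW//.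
    by congr Num.max; field.
  apply: le_trans (outer_ico_le p'); apply: le_lebesgue_outer.
  move=> x xp i; have := xp i; rewrite affE !mxE /f.
  rewrite ltr_ndivlMr// ler_ndivrMr// ltrBlDl lerBrDl [x _ _ * _]mulrC.
  by rewrite andbC.
Qed.

Let outer_aff_le a b A : b != 0 ->
  (outer (aff a b @^-1` A) <= (`|b| ^- n)%:E * outer A)%E.
Proof.
move=> b0.
have k0 : 0 < `|b| ^- n by rewrite invr_gt0 exprn_gt0 ?normr_gt0.
rewrite muleC -lee_pdivrMr//.
apply: le_ereal_inf_tmp => _ [C [cC AC] <-].
rewrite lee_pdivrMr// muleC.
apply: le_trans (esumZl_le _ (ltW k0) _); last first.
  by move=> p; rewrite lee_fin box_vol_ge0.
apply: le_trans (@outer_measure_countable_cover R _ _ outer C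
   (fun p => aff a b @^-1` box p) _ cC _) _.
  by move=> x /AC[p Cp xp]; exists p.
by apply: le_esum => p _; exact: outer_aff_box_le.
Qed.

Let affK a b : b != 0 -> cancel (aff a b) (aff (- (b^-1 *: a)) b^-1).
Proof.
by move=> b0 x; rewrite /aff scalerDr scalerA mulVf// scale1r addKr.
Qed.

Let affVK a b : b != 0 -> cancel (aff (- (b^-1 *: a)) b^-1) (aff a b).
Proof.
move=> b0 x; rewrite /aff scalerDr scalerN !scalerA mulfV// !scale1r.
by rewrite addrA subrr add0r.
Qed.

(** Both inequalities are instances of the same one, applied to the map and to its inverse. *)
Lemma lebesgue_outer_affine a b A : b != 0 ->
  outer ((fun x => a + b *: x) @^-1` A) = ((`|b| ^- n)%:E * outer A)%E.
Proof.
move=> b0; apply/eqP; rewrite eq_le outer_aff_le//=.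
have k0 : 0 < `|b| ^- n by rewrite invr_gt0 exprn_gt0 ?normr_gt0.
rewrite muleC -lee_pdivlMr//.
have b10 : b^-1 != 0 by rewrite invr_eq0.
have := outer_aff_le (- (b^-1 *: a)) (aff a b @^-1` A) b10.
rewrite -comp_preimage (_ : _ \o _ = id); last by apply/funext => x; exact: affVK.
by rewrite preimage_id muleC normfV exprVn.
Qed.

(** The outer measures of all preimages are scaled by the same factor, so the Caratheodory identity
    passes from [A] to its preimage. *)
Lemma measurable_affine a b : b != 0 ->
  measurable_fun (setT : set (lebesgueRn R n))
    ((fun x => a + b *: x) : lebesgueRn R n -> lebesgueRn R n).
Proof.
move=> b0 _ A mA; rewrite setTI.
apply: le_caratheodory_measurable => X /=.
have -> : X = aff a b @^-1` (aff (- (b^-1 *: a)) b^-1 @^-1` X).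
  rewrite -comp_preimage (_ : _ \o _ = id) ?preimage_id//.
  by apply/funext => x; exact: affK.
set Y := _ @^-1` X.
change (outer (aff a b @^-1` (Y `&` A)) + outer (aff a b @^-1` (Y `&` ~` A)) <=
  outer (aff a b @^-1` Y))%E.
have e Z : (outer (aff a b @^-1` Z) = (`|b| ^- n)%:E * outer Z)%E.
  exact: lebesgue_outer_affine.
rewrite 3!e -ge0_muleDr ?lebesgue_outer_ge0//.
by rewrite [in leRHS](mA Y).
Qed.

Lemma integral_affine a b (f : 'rV[R]_n -> \bar R) : b != 0 ->
  measurable_fun (setT : set (lebesgueRn R n)) f -> (forall x, 0 <= f x)%E ->
  (\int[mu]_x f (a + b *: x)%R = (`|b| ^- n)%:E * \int[mu]_x f x)%E.
Proof.
move=> b0 mf f0.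
have mT := measurable_affine a b0.
rewrite -(@ge0_integral_pushforward _ _ _ _ _ _ mT mu setT)//.
have k0 : 0 <= `|b| ^- n by rewrite invr_ge0 exprn_ge0.
rewrite (eq_measure_integral (mscale (NngNum k0) mu)); last first.
  by move=> A mA _; rewrite /pushforward /mscale/=; exact: lebesgue_outer_affine.
by rewrite ge0_integral_mscale.
Qed.

End affine.

(** * Grid cells *)

Section euclidean.
Context (R : realType) (n : nat).
Implicit Types (x y : 'rV[R]_n).

Lemma enorm_ge0 x : 0 <= enorm x.
Proof. exact: sqrtr_ge0. Qed.

Lemma coord_le_enorm x i : `|x ord0 i| <= enorm x.
Proof.
rewrite -sqrtr_sqr ler_sqrt ?sumr_ge0//; last by move=> *; rewrite sqr_ge0.
by rewrite (bigD1 i)//= lerDl sumr_ge0// => *; rewrite sqr_ge0.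
Qed.

Lemma enorm_le x d : (forall i, `|x ord0 i| <= d) -> enorm x <= n%:R * d.
Proof.
case: n x => [|k] x xd.
  by rewrite mul0r /enorm big_ord0 sqrtr0.
have d0 : 0 <= d := le_trans (normr_ge0 _) (xd ord0).
rewrite -[leRHS]ger0_norm ?mulr_ge0// -sqrtr_sqr ler_sqrt ?sqr_ge0//.
rewrite exprMn.
apply: (@le_trans _ _ (\sum_(i < k.+1) d ^+ 2)).
  by apply: ler_sum => i _; rewrite -real_normK ?num_real// ler_pXn2r ?nnegrE.
rewrite sumr_const card_ord -[leLHS]mulr_natl.
by rewrite ler_wpM2r ?sqr_ge0// -natrX ler_nat expnS leq_pmulr ?expn1.
Qed.

Lemma measurable_enormB x0 :
  measurable_fun (setT : set (lebesgueRn R n)) (fun x => enorm (x - x0)%R).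
Proof.
apply: (@measurableT_comp _ _ _ (lebesgueRn R n) R R (@Num.sqrt R)).
  by apply: continuous_measurable_fun; exact: sqrt_continuous.
apply: measurable_sum => i; apply: measurable_funX.
under eq_fun do rewrite !mxE.
by apply: measurable_funB; [exact: measurable_coord|exact: measurable_cst].
Qed.

Lemma measurable_eball x0 r : measurable (eball x0 r : set (lebesgueRn R n)).
Proof.
rewrite (_ : eball x0 r = (fun x => enorm (x - x0)) @^-1` `]-oo, r[).
  by rewrite -[X in measurable X]setTI; apply: (@measurable_enormB x0 measurableT).
by apply/seteqP; split=> x; rewrite /= in_itv.
Qed.

End euclidean.

Section cells.
Context (R : realType) (n : nat).
Notation mu := (@lebesgue_rV R n).
Implicit Types (s : R) (x y : 'rV[R]_n) (m : 'rV[int]_n).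

(** The ceiling minus 1, rather than the floor, makes the cells open on the left, like the boxes. *)
Definition idx s x : 'rV[int]_n := \row_i (Num.ceil (x ord0 i / s) - 1).

Definition cell s m : set 'rV[R]_n := [set x | idx s x = m].

Lemma idxP s x m : 0 < s ->
  idx s x = m <->
  forall i, s * (m ord0 i)%:~R < x ord0 i <= s * ((m ord0 i)%:~R + 1).
Proof.
move=> s0; split=> [<- i|H].
  rewrite mxE -ltr_pdivlMl// -ler_pdivrMl// [s^-1 * _]mulrC.
  have /andP[-> h] := ceil_itv (x ord0 i / s).
  by rewrite rmorphB/= subrK.
apply/rowP => i; rewrite mxE; have /andP[h1 h2] := H i.
apply/eqP; rewrite subr_eq ceil_eq addrK rmorphD/=.
by rewrite ltr_pdivlMr// ler_pdivrMr// mulrC h1 mulrC.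
Qed.

Lemma cellE s m : 0 < s ->
  cell s m = box (\row_i (s * (m ord0 i)%:~R), \row_i (s * ((m ord0 i)%:~R + 1))).
Proof.
move=> s0; apply/seteqP; split=> x.
  by move/(idxP _ _ s0) => + i; rewrite !mxE; exact.
by move=> H; apply/(idxP _ _ s0) => i; have := H i; rewrite !mxE.
Qed.

Lemma measurable_cell s m : 0 < s -> measurable (cell s m : set (lebesgueRn R n)).
Proof. by move=> s0; rewrite cellE//; exact: measurable_box. Qed.

Lemma mu_cell s m : 0 < s -> mu (cell s m) = (s ^+ n)%:E.
Proof.
move=> s0; rewrite cellE// lebesgue_rV_box /box_vol; congr EFin.
rewrite -[in RHS](card_ord n) -prodr_const; apply: eq_bigr => i _.
by rewrite !mxE mulrDr mulr1 addrAC subrr add0r max_r ?ltW.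
Qed.

Lemma measurable_idx_pred s (P : set 'rV[int]_n) : 0 < s ->
  measurable ([set x | P (idx s x)] : set (lebesgueRn R n)).
Proof.
move=> s0; rewrite (_ : [set x | _] = \bigcup_(m in P) cell s m).
  rewrite bigcup_mkcond; apply: countable_bigcupT_measurable => [|m].
    exact: countableP.
  by case: ifPn => // _; exact: measurable_cell.
apply/seteqP; split=> x; first by move=> Px; exists (idx s x).
by move=> [m Pm] /= ->.
Qed.

Lemma measurable_idx s d (T : measurableType d) (g : 'rV[int]_n -> T) : 0 < s ->
  measurable_fun (setT : set (lebesgueRn R n)) (fun x => g (idx s x)).
Proof.
move=> s0 _ A _; rewrite setTI.
exact: (@measurable_idx_pred s (g @^-1` A)).
Qed.

Lemma idx_close s x y i : 0 < s -> idx s x = idx s y ->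
  `|x ord0 i - y ord0 i| <= s.
Proof.
move=> s0 xy.
have /(_ i)/andP[] := (idxP x (idx s x) s0).1 erefl.
have /(_ i)/andP[] := (idxP y (idx s x) s0).1 (esym xy).
set a := (idx s x ord0 i)%:~R; rewrite mulrDr mulr1 => *.
by rewrite ler_distl; apply/andP; split; lra.
Qed.

(** The grids of sides [s] and [2 * s] share the origin, so they are nested: the index is halved and
    rounded down. *)
Lemma idx_double s x y : 0 < s -> idx s x = idx s y ->
  idx (2 * s) x = idx (2 * s) y.
Proof.
move=> s0 xy; have s20 : 0 < 2 * s by rewrite mulr_gt0.
pose p : 'rV[int]_n := \row_i ((idx s x ord0 i) %/ 2)%Z.
suff H z : idx s z = idx s x -> idx (2 * s) z = p by rewrite !H.
move=> zx; apply/idxP => // i; rewrite mxE.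
have /(_ i)/andP[] := (idxP z (idx s x) s0).1 zx.
set a := idx s x ord0 i.
have a1 : ((a %/ 2)%Z * 2 <= a)%R by lia.
have a2 : (a + 1 <= ((a %/ 2)%Z + 1) * 2)%R by lia.
move: a1 a2; rewrite -!(ler_int R) !rmorphM !rmorphD !rmorph1/= => a1 a2 h1 h2.
have := ler_wpM2l (ltW s0) a1; have := ler_wpM2l (ltW s0) a2.
by move=> b1 b2; apply/andP; split; lra.
Qed.

Lemma idx_shift s x (e : 'rV[int]_n) : 0 < s ->
  idx s (x + \row_i (s * (e ord0 i)%:~R)) = idx s x + e.
Proof.
move=> s0; apply/idxP => // i; rewrite !mxE rmorphD/=.
have /(_ i) := (idxP x (idx s x) s0).1 erefl; rewrite mxE.
set a := _%:~R; set b := _%:~R => /andP[h1 h2].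
by apply/andP; split; nra.
Qed.

Lemma idx_dist s x y i (c : nat) : 0 < s ->
  `|x ord0 i - y ord0 i| <= c%:R * s -> `|idx s x ord0 i - idx s y ord0 i| <= c%:Z.
Proof.
move=> s0 xy.
have /(_ i)/andP[] := (idxP x (idx s x) s0).1 erefl.
have /(_ i)/andP[] := (idxP y (idx s y) s0).1 erefl.
set a := idx s x ord0 i; set b := idx s y ord0 i => h1 h2 h3 h4.
move: xy; rewrite ler_distl => /andP[k1 k2].
have : (a%:~R : R) < (b + c%:Z + 1)%:~R.
  by rewrite !rmorphD/= -pmulrn; nra.
have : (b%:~R : R) < (a + c%:Z + 1)%:~R.
  by rewrite !rmorphD/= -pmulrn; nra.
by rewrite !ltr_int; lia.
Qed.

(** Counting device for neighbouring cells and overlapping cubes. The centre [r] is real; shifting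
    by its floor minus [L] injects [S] into a discrete cube. *)
Lemma size_int_box (S : seq 'rV[int]_n) (r : 'I_n -> R) (L : nat) : uniq S ->
  (forall m i, m \in S -> `|(m ord0 i)%:~R - r i| <= L%:R) ->
  (size S <= (2 * L).+2 ^ n)%N.
Proof.
move=> uS HS.
pose k m i : int := m ord0 i - Num.floor (r i) + L%:Z.
have kP m i : m \in S -> (0 <= k m i < (2 * L).+2%:Z)%R.
  move=> /(HS _ i); rewrite ler_distl => /andP[h1 h2].
  have /andP[f1] := floor_itv (r i); rewrite rmorphD/= => f2.
  have : ((Num.floor (r i) - L%:Z)%:~R : R) <= (m ord0 i)%:~R.
    by rewrite rmorphB/= -pmulrn; lra.
  have : ((m ord0 i)%:~R : R) < (Num.floor (r i) + 1 + L%:Z)%:~R.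
    by rewrite rmorphD/= -pmulrn; lra.
  by rewrite ltr_int ler_int /k; lia.
pose h m : {ffun 'I_n -> 'I_(2 * L).+2} := [ffun i => inord (absz (k m i))].
have hinj : {in S &, injective h}.
  move=> m m' mS mS' /ffunP hm; apply/rowP => i.
  have := hm i; rewrite !ffunE => /(congr1 val) /=.
  have /andP[a1 a2] := kP m i mS; have /andP[b1 b2] := kP m' i mS'.
  rewrite !inordK; [|lia|lia] => hk.
  suff : k m i = k m' i by rewrite /k => /addIr/addIr.
  by lia.
have -> : ((2 * L).+2 ^ n = #|{: {ffun 'I_n -> 'I_(2 * L).+2}}|)%N.
  by rewrite card_ffun !card_ord.
rewrite -(size_map h) -(card_uniqP _) ?map_inj_in_uniq//.
exact: max_card.
Qed.

End cells.

(** * Vector-valued integrable functions *)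

Section l2.
Context (T : Type) (R : realType) (J : nat) (f : 'I_J -> T -> R).

Definition l2 x : R := Num.sqrt (\sum_(j < J) f j x ^+ 2).

Lemma l2_ge0 x : 0 <= l2 x. Proof. exact: sqrtr_ge0. Qed.

Lemma sum_sqr_ge0 (a : 'I_J -> R) : 0 <= \sum_(j < J) a j ^+ 2.
Proof. by apply: sumr_ge0 => j _; exact: sqr_ge0. Qed.

Lemma sqr_l2 x : l2 x ^+ 2 = \sum_(j < J) f j x ^+ 2.
Proof. by rewrite sqr_sqrtr// sum_sqr_ge0. Qed.

Lemma abs_le_l2 j x : `|f j x| <= l2 x.
Proof.
rewrite -sqrtr_sqr ler_sqrt ?sum_sqr_ge0// (bigD1 j)//= lerDl.
by apply: sumr_ge0 => i _; exact: sqr_ge0.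
Qed.

(** Weighted arithmetic-geometric mean inequality on each product, with weights given by [A / B] and
    [B / A]; the cases [A = 0] and [B = 0] are treated apart. *)
Lemma cauchy_schwarz_sum (a b : 'I_J -> R) (A B : R) : 0 <= A -> 0 <= B ->
  \sum_(j < J) a j ^+ 2 <= A ^+ 2 -> \sum_(j < J) b j ^+ 2 <= B ^+ 2 ->
  \sum_(j < J) a j * b j <= A * B.
Proof.
have zero (c e : 'I_J -> R) (C : R) : \sum_(j < J) c j ^+ 2 <= C ^+ 2 -> C = 0 ->
    \sum_(j < J) c j * e j = 0.
  move=> + C0; rewrite C0 expr0n/= => c0; apply: big1 => j _.
  have : c j ^+ 2 <= 0.
    by apply: le_trans c0; rewrite (bigD1 j)//= lerDl sumr_ge0// => *; rewrite sqr_ge0.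
  rewrite le_eqVlt ltNge sqr_ge0 orbF sqrf_eq0 => /eqP->.
  by rewrite mul0r.
move=> A0 B0 aA bB; have [A_0|An0] := eqVneq A 0.
  by rewrite (zero _ _ _ aA A_0) A_0 mul0r.
have [B_0|Bn0] := eqVneq B 0.
  under eq_bigr do rewrite mulrC.
  by rewrite (zero _ _ _ bB B_0) B_0 mulr0.
have Ap : 0 < A by rewrite lt_def An0.
have Bp : 0 < B by rewrite lt_def Bn0.
have : \sum_(j < J) a j * b j <=
    \sum_(j < J) (B / A / 2 * a j ^+ 2 + A / B / 2 * b j ^+ 2).
  apply: ler_sum => j _; rewrite -subr_ge0.
  rewrite (_ : _ - _ = (B * a j - A * b j) ^+ 2 / (2 * A * B)); last first.
    by field; rewrite ?An0 ?Bn0.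
  by rewrite divr_ge0 ?sqr_ge0// !mulr_ge0.
move/le_trans; apply; rewrite big_split/= -!mulr_sumr.
have h1 : B / A / 2 * (\sum_(j < J) a j ^+ 2) <= B / A / 2 * A ^+ 2.
  by apply: ler_wpM2l => //; rewrite !divr_ge0.
have h2 : A / B / 2 * (\sum_(j < J) b j ^+ 2) <= A / B / 2 * B ^+ 2.
  by apply: ler_wpM2l => //; rewrite !divr_ge0.
apply: (le_trans (lerD h1 h2)).
by rewrite le_eqVlt; apply/orP; left; apply/eqP; field; rewrite ?An0 ?Bn0.
Qed.

End l2.

Section L1_space.
Context d (T : measurableType d) (R : realType) (mu : {measure set T -> \bar R}).
Implicit Types (f g h : T -> R) (A : set T).

Definition L1 f := mu.-integrable setT (EFin \o f).

Definition I f : R := \int[mu]_x f x.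

Lemma L1_measurable f : L1 f -> measurable_fun setT f.
Proof. by move=> /integrableP[/measurable_EFinP]. Qed.

Lemma L1_le f g : measurable_fun setT f -> (forall x, `|f x| <= g x) ->
  L1 g -> L1 f.
Proof.
move=> mf fg; apply: le_integrable => //; first exact/measurable_EFinP.
by move=> x _ /=; rewrite lee_fin (le_trans (fg x))// ler_norm.
Qed.

Lemma L1D f g : L1 f -> L1 g -> L1 (fun x => f x + g x).
Proof. exact: integrableD. Qed.

Lemma L1B f g : L1 f -> L1 g -> L1 (fun x => f x - g x).
Proof. exact: integrableB. Qed.

Lemma L1Z k f : L1 f -> L1 (fun x => k * f x).
Proof. exact: integrableZl. Qed.

Lemma L1_norm_fun f : L1 f -> L1 (fun x => `|f x|).
Proof. exact: integrable_norm. Qed.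

Lemma L1_sum (J : Type) (s : seq J) (P : pred J) (f : J -> T -> R) :
  (forall j, P j -> L1 (f j)) -> L1 (fun x => \sum_(j <- s | P j) f j x).
Proof.
move=> fL; apply: eq_integrable (@integrable_sum _ _ _ mu setT measurableT _ s P
  (fun j => EFin \o f j) fL) => // x _ /=; by rewrite sumEFin.
Qed.

Lemma L1M_bounded (M : R) g f : measurable_fun setT g ->
  (forall x, `|g x| <= M) -> L1 f -> L1 (fun x => g x * f x).
Proof.
move=> mg gM fL; apply: (@L1_le _ (fun x => M * `|f x|)).
- exact: measurable_funM mg (L1_measurable fL).
- by move=> x; rewrite normrM ler_wpM2r.
- exact/L1Z/L1_norm_fun.
Qed.

Lemma L1_indic f A : measurable A -> L1 f -> L1 (fun x => \1_A x * f x).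
Proof.
move=> mA; apply: (@L1M_bounded 1); first exact: measurable_indic.
by move=> x; rewrite indicE; case: (_ \in _); rewrite /= ?normr1 ?normr0.
Qed.

Lemma L1_indic1 A : measurable A -> (mu A < +oo)%E -> L1 \1_A.
Proof.
move=> mA muA; apply/integrableP; split.
  by apply/measurable_EFinP; exact: measurable_indic.
under eq_integral do rewrite /= ger0_norm//.
by rewrite integral_indic// setIT.
Qed.

Lemma I_EFin f : L1 f -> ((I f)%:E = \int[mu]_x (f x)%:E)%E.
Proof. by move=> fL; rewrite /I /Rintegral fineK//; exact: integrable_fin_num. Qed.

Lemma eq_I f g : f =1 g -> I f = I g.
Proof. by move=> fg; apply: eq_Rintegral => x _; exact: fg. Qed.

Lemma ID f g : L1 f -> L1 g -> I (fun x => f x + g x) = I f + I g.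
Proof. exact: RintegralD. Qed.

Lemma IB f g : L1 f -> L1 g -> I (fun x => f x - g x) = I f - I g.
Proof. exact: RintegralB. Qed.

Lemma IZ k f : L1 f -> I (fun x => k * f x) = k * I f.
Proof. exact: RintegralZl. Qed.

Lemma I0 : I (fun _ => 0) = 0.
Proof. by rewrite /I /Rintegral integral0. Qed.

Lemma I_sum (J : Type) (s : seq J) (P : pred J) (f : J -> T -> R) :
  (forall j, P j -> L1 (f j)) ->
  I (fun x => \sum_(j <- s | P j) f j x) = \sum_(j <- s | P j) I (f j).
Proof.
move=> fL; elim: s => [|a s IH].
  by rewrite big_nil -[RHS]I0; apply: eq_I => x; rewrite big_nil.
rewrite big_cons -IH; case: ifPn => Pa; last first.
  by apply: eq_I => x; rewrite big_cons (negPf Pa).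
rewrite -ID; [|exact: fL|exact: L1_sum].
by apply: eq_I => x; rewrite big_cons Pa.
Qed.

Lemma I_le f g : L1 f -> L1 g -> (forall x, f x <= g x) -> I f <= I g.
Proof. by move=> fL gL fg; apply: le_Rintegral => // x _; exact: fg. Qed.

Lemma I_ge0 f : (forall x, 0 <= f x) -> 0 <= I f.
Proof. by move=> f0; apply: Rintegral_ge0. Qed.

Lemma I_abs f : L1 f -> `|I f| <= I (fun x => `|f x|).
Proof. by move=> fL; apply: le_normr_Rintegral. Qed.

Lemma I_abs_le f g : L1 f -> L1 g -> (forall x, `|f x| <= g x) -> `|I f| <= I g.
Proof.
by move=> fL gL fg; rewrite (le_trans (I_abs fL))// I_le//; exact: L1_norm_fun.
Qed.

Lemma I_indic A : measurable A -> I \1_A = fine (mu A).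
Proof. by move=> mA; rewrite /I /Rintegral integral_indic// setIT. Qed.

Lemma I_indicM A f : I (fun x => \1_A x * f x) = \int[mu]_(x in A) f x.
Proof.
rewrite Rintegral_mkcond; apply: eq_I => x; rewrite patchE indicE.
by case: (x \in A); rewrite ?mul1r ?mul0r.
Qed.

Lemma markov f A (c : R) : 0 <= c -> measurable A -> L1 f ->
  (forall x, 0 <= f x) -> (forall x, A x -> c <= f x) ->
  (c%:E * mu A <= (I f)%:E)%E.
Proof.
move=> c0 mA fL f0 Af; rewrite (I_EFin fL) -integral_cst//.
have mf : measurable_fun setT (EFin \o f).
  by apply/measurable_EFinP; exact: L1_measurable.
apply: (@le_trans _ _ (\int[mu]_(x in A) (f x)%:E)%E).
  apply: ge0_le_integral => //.
  exact: measurable_funTS.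
by apply: ge0_subset_integral => // x _; rewrite lee_fin.
Qed.

Section minkowski.
Variables (J : nat) (f : 'I_J -> T -> R).
Hypothesis fL : forall j, L1 (f j).

Lemma measurable_l2 : measurable_fun setT (l2 f).
Proof.
apply: (@measurableT_comp _ _ _ _ _ _ (@Num.sqrt R)).
  by apply: continuous_measurable_fun; exact: sqrt_continuous.
by apply: measurable_sum => j; apply: measurable_funX; exact: L1_measurable.
Qed.

Lemma L1_l2 : L1 (l2 f).
Proof.
apply: (@L1_le _ (fun x => \sum_(j < J) `|f j x|)).
- exact: measurable_l2.
- move=> x; rewrite ger0_norm ?l2_ge0//.
  have S0 : 0 <= \sum_(j < J) `|f j x| by apply: sumr_ge0.
  rewrite -[leRHS]ger0_norm// -sqrtr_sqr ler_sqrt ?sqr_ge0//.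
  rewrite expr2 mulr_suml; apply: ler_sum => j _.
  rewrite -real_normK ?num_real// expr2 ler_wpM2l//.
  by rewrite (bigD1 j)//= lerDl sumr_ge0.
- by apply: L1_sum => j _; exact: L1_norm_fun.
Qed.

(* With [c j = I (w f_j)] and [N] the norm of [c], [N^2 = I (w sum_j c_j f_j) <= N I (w l2)]. *)
Lemma minkowski (w : T -> R) (M : R) : measurable_fun setT w ->
  (forall x, 0 <= w x <= M) ->
  \sum_(j < J) I (fun x => w x * f j x) ^+ 2 <= I (fun x => w x * l2 f x) ^+ 2.
Proof.
move=> mw wM; pose c j := I (fun x => w x * f j x).
have wM' x : `|w x| <= M by have /andP[w0 ?] := wM x; rewrite ger0_norm.
pose N := Num.sqrt (\sum_(j < J) c j ^+ 2).
have N0 : 0 <= N := sqrtr_ge0 _.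
have N2 : N ^+ 2 = \sum_(j < J) c j ^+ 2 by rewrite sqr_sqrtr// sum_sqr_ge0.
have lL : L1 (fun x => w x * l2 f x) := L1M_bounded mw wM' L1_l2.
have I0 : 0 <= I (fun x => w x * l2 f x).
  by apply: I_ge0 => x; rewrite mulr_ge0 ?l2_ge0//; have /andP[] := wM x.
rewrite -/(c _) -N2 ler_pXn2r ?nnegrE//.
have wfL j : L1 (fun x => w x * f j x) := L1M_bounded mw wM' (fL j).
have : N ^+ 2 <= N * I (fun x => w x * l2 f x).
  rewrite N2 -IZ//.
  rewrite (_ : \sum_(j < J) _ = I (fun x => \sum_(j < J) c j * (w x * f j x))).
    2: by rewrite I_sum => [|j _]; [apply: eq_bigr => j _; rewrite IZ|exact: L1Z].
  apply: I_le; [by apply: L1_sum => j _; exact: L1Z|exact: L1Z|] => x.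
  under eq_bigr do rewrite mulrCA.
  rewrite -mulr_sumr mulrCA; apply: ler_wpM2l; first by have /andP[] := wM x.
  by apply: cauchy_schwarz_sum; rewrite ?l2_ge0 ?N2 ?sqr_l2.
have [->//|Nn0] := eqVneq N 0.
by rewrite expr2 ler_pM2l// lt_def Nn0.
Qed.

End minkowski.
End L1_space.

(** * Averages over grid cells *)

Section averages.
Context (R : realType) (n : nat).
Notation mu := (@lebesgue_rV R n).
Notation mfun := (measurable_fun [set: lebesgueRn R n]).
Implicit Types (s : R) (x y : 'rV[R]_n) (m : 'rV[int]_n) (u w : 'rV[R]_n -> R).

Lemma expVn_ge0 s : 0 < s -> 0 <= s ^- n.
Proof. by move=> s0; rewrite invr_ge0 exprn_ge0// ltW. Qed.

(** Cells indexed by [nat] through [pickle], for countable additivity of the integral; an integer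
    that codes no index gives the empty set. *)
Let cellN s k : set 'rV[R]_n := [set x | pickle (idx s x) = k].

Let measurable_cellN s k : 0 < s -> measurable (cellN s k : set (lebesgueRn R n)).
Proof. by move=> s0; exact: (@measurable_idx_pred R n s [set m | pickle m = k]). Qed.

Let trivIset_cellN s : trivIset setT (cellN s).
Proof. by move=> i j _ _ [x [/= <- <-]]. Qed.

Let bigcup_cellN s : \bigcup_k cellN s k = setT.
Proof. by apply/seteqP; split=> // x _; exists (pickle (idx s x)). Qed.

Let cellNP s k : cellN s k = set0 \/ exists m, cellN s k = cell s m.
Proof.
have [->|/set0P[x /= xk]] := eqVneq (cellN s k) set0; [by left|right].
exists (idx s x); apply/seteqP; split=> y; rewrite /cellN /cell /=.
  by move=> yk; apply: (pcan_inj pickleK); rewrite yk -xk.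
by move=> ->.
Qed.

Lemma eq_integral_cells s (f g : 'rV[R]_n -> \bar R) : 0 < s ->
  mfun f -> mfun g -> (forall x, 0 <= f x)%E -> (forall x, 0 <= g x)%E ->
  (forall m, \int[mu]_(x in cell s m) f x = \int[mu]_(x in cell s m) g x)%E ->
  (\int[mu]_x f x = \int[mu]_x g x)%E.
Proof.
move=> s0 mf mg f0 g0 fg.
have mN k := measurable_cellN k s0.
rewrite -(bigcup_cellN s) !ge0_integral_bigcup ?bigcup_cellN//.
apply: eq_eseriesr => k _.
by have [->|[m ->]] := cellNP s k; rewrite ?integral_set0.
Qed.

Lemma I_cells0 s w : 0 < s -> L1 mu w ->
  (forall m, I mu (fun x => \1_(cell s m) x * w x) = 0) -> I mu w = 0.
Proof.
move=> s0 wL w0; have mN k := measurable_cellN k s0.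
rewrite /I /Rintegral -(bigcup_cellN s) integral_bigcup ?bigcup_cellN//.
rewrite eseries0// => k _ _.
have [->|[m ->]] := cellNP s k; first by rewrite integral_set0.
have := w0 m; rewrite I_indicM /Rintegral.
have mc := @measurable_cell R n s m s0.
have wc : mu.-integrable (cell s m) (EFin \o w) by apply: integrableS wL.
move=> H; rewrite -[LHS]fineK ?H//.
exact: integrable_fin_num.
Qed.

Definition cavg s u m : R := s ^- n * I mu (fun y => \1_(cell s m) y * u y).

(** Conditional expectation with respect to the cells of side [s]. The weights [v (idx s x)] below
    stand for functions constant on these cells. *)
Definition avg s u x : R := cavg s u (idx s x).

Lemma eq_avg s u x y : idx s x = idx s y -> avg s u x = avg s u y.
Proof. by rewrite /avg => ->. Qed.

Lemma measurable_avg s u : 0 < s -> mfun (avg s u).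
Proof. exact: measurable_idx. Qed.

Lemma L1_cell s m : 0 < s -> L1 mu (\1_(cell s m)).
Proof.
move=> s0; apply: L1_indic1; first exact: measurable_cell.
by rewrite [X in (X < _)%E](mu_cell m s0) ltry.
Qed.

Lemma avg_ge0 s u x : 0 < s -> (forall y, 0 <= u y) -> 0 <= avg s u x.
Proof.
move=> s0 u0; rewrite mulr_ge0 ?expVn_ge0 ?I_ge0// => y.
by rewrite mulr_ge0.
Qed.

Lemma avg_le s u w x : 0 < s -> L1 mu u -> L1 mu w -> (forall y, u y <= w y) ->
  avg s u x <= avg s w x.
Proof.
move=> s0 uL wL uw; rewrite ler_wpM2l ?expVn_ge0//.
have mc := @measurable_cell R n s (idx s x) s0.
by apply: I_le; [exact: L1_indic|exact: L1_indic|move=> y; rewrite ler_wpM2l].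
Qed.

Lemma avg_abs_le s u x : 0 < s -> L1 mu u ->
  `|avg s u x| <= avg s (fun y => `|u y|) x.
Proof.
move=> s0 uL; have mc := @measurable_cell R n s (idx s x) s0.
rewrite normrM ger0_norm ?expVn_ge0//.
rewrite ler_wpM2l ?expVn_ge0//.
apply: I_abs_le; [exact: L1_indic|exact/L1_indic/L1_norm_fun|].
by move=> y; rewrite normrM ler_wpM2r// ger0_norm.
Qed.

(** Minkowski's integral inequality with the indicator of the cell as weight. *)
Lemma sum_sqr_avg_le s (J : nat) (f : 'I_J -> 'rV[R]_n -> R) x : 0 < s ->
  (forall j, L1 mu (f j)) ->
  \sum_(j < J) avg s (f j) x ^+ 2 <= avg s (l2 f) x ^+ 2.
Proof.
move=> s0 fL; under eq_bigr do rewrite exprMn.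
rewrite -mulr_sumr exprMn ler_wpM2l ?sqr_ge0//.
apply: (@minkowski _ _ _ _ _ _ fL _ 1).
  by apply: measurable_indic; exact: measurable_cell.
by move=> y; rewrite indicE; case: (_ \in _); rewrite /= !lexx ler01.
Qed.

Lemma avg_double s u x : 0 < s -> L1 mu u -> (forall y, 0 <= u y) ->
  avg s u x <= 2 ^+ n * avg (2 * s) u x.
Proof.
move=> s0 uL u0; have s20 : 0 < 2 * s by rewrite mulr_gt0.
rewrite /avg /cavg exprMn invfM !mulrA mulfV ?expf_neq0// mul1r.
rewrite ler_wpM2l ?expVn_ge0//.
apply: I_le => [||y].
- by apply: L1_indic => //; exact: measurable_cell.
- by apply: L1_indic => //; exact: measurable_cell.
rewrite ler_wpM2r// !indicE ler_nat.
case: (boolP (y \in cell s _)) => //; rewrite inE => /(idx_double s0) yx.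
by rewrite mem_set.
Qed.

Lemma avg_le_I s u x : 0 < s -> L1 mu u -> (forall y, 0 <= u y) ->
  avg s u x <= s ^- n * I mu u.
Proof.
move=> s0 uL u0; rewrite ler_wpM2l ?expVn_ge0//.
apply: I_le => // [|y]; first by apply: L1_indic => //; exact: measurable_cell.
by rewrite -[leRHS]mul1r ler_wpM2r// indicE; case: (_ \in _).
Qed.

(** Stated with extended integrals, before [avg s u] is known to be integrable: [L1_avg] is deduced
    from it with the constant weight 1. *)
Lemma integral_avg s u (v : 'rV[int]_n -> R) : 0 < s -> L1 mu u ->
  (forall y, 0 <= u y) -> (forall m, 0 <= v m) ->
  (\int[mu]_x (v (idx s x) * avg s u x)%:E = \int[mu]_x (v (idx s x) * u x)%:E)%E.
Proof.
move=> s0 uL u0 v0; have mc m := @measurable_cell R n s m s0.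
apply: (eq_integral_cells s0).
- apply/measurable_EFinP/measurable_funM; first exact: measurable_idx.
  exact: measurable_avg.
- apply/measurable_EFinP/measurable_funM; first exact: measurable_idx.
  exact: L1_measurable uL.
- by move=> x; rewrite lee_fin mulr_ge0// avg_ge0.
- by move=> x; rewrite lee_fin mulr_ge0.
move=> m.
rewrite (eq_integral (cst (v m * cavg s u m)%:E)); last first.
  by move=> x; rewrite inE /cell/= /avg => ->.
rewrite integral_cst// [X in (_ * X)%E](mu_cell m s0).
rewrite [RHS](eq_integral (fun x : lebesgueRn R n => (v m)%:E * (u x)%:E)%E); last first.
  by move=> x; rewrite inE /cell/= => ->.
rewrite ge0_integralZl_EFin//; last 2 first.
- by move=> x _; rewrite lee_fin.
- apply/measurable_EFinP; apply: measurable_funTS; exact: L1_measurable uL.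
rewrite -EFinM -mulrA /cavg mulrAC mulVf ?expf_neq0 ?gt_eqF// mul1r.
rewrite EFinM; congr (_ * _)%E.
rewrite I_indicM /Rintegral fineK//; apply: integrable_fin_num => //.
exact: integrableS uL.
Qed.

Lemma L1_avg s u : 0 < s -> L1 mu u -> L1 mu (avg s u).
Proof.
move=> s0 uL; apply: (@L1_le _ (lebesgueRn R n) R mu _ (avg s (fun y => `|u y|))).
- exact: measurable_avg.
- by move=> x; exact: avg_abs_le.
have nL := L1_norm_fun uL.
apply/integrableP; split; first by apply/measurable_EFinP; exact: measurable_avg.
have /integrableP[_] := nL; apply: le_lt_trans.
have E : (\int[mu]_x (avg s (fun y => `|u y|) x)%:E = \int[mu]_x (`|u x|)%:E)%E.
  transitivity (\int[mu]_x (1 * avg s (fun y => `|u y|) x)%:E)%E.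
    by apply: eq_integral => x _; rewrite mul1r.
  rewrite (@integral_avg s (fun y => `|u y|) (fun=> 1))//.
  by apply: eq_integral => x _; rewrite mul1r.
rewrite (_ : \int[mu]_x _ = \int[mu]_x (avg s (fun y => `|u y|) x)%:E)%E; last first.
  by apply: eq_integral => x _; rewrite /= ger0_norm// avg_ge0.
rewrite E le_eqVlt; apply/orP; left; apply/eqP.
by apply: eq_integral => x _; rewrite /= normr_id.
Qed.

Lemma I_avg s u (v : 'rV[int]_n -> R) M : 0 < s -> L1 mu u ->
  (forall y, 0 <= u y) -> (forall m, 0 <= v m <= M) ->
  I mu (fun x => v (idx s x) * avg s u x) = I mu (fun x => v (idx s x) * u x).
Proof.
move=> s0 uL u0 vM; rewrite /I /Rintegral integral_avg// => m.
by have /andP[] := vM m.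
Qed.

(** A function minus its conditional expectation is orthogonal to whatever is constant on the cells;
    this is the cancellation of the bad part. *)
Lemma I_sub_avg s u (v : 'rV[int]_n -> R) M : 0 < s -> L1 mu u ->
  (forall m, `|v m| <= M) ->
  I mu (fun x => v (idx s x) * (u x - avg s u x)) = 0.
Proof.
move=> s0 uL vM; have aL := L1_avg s0 uL.
have vL : L1 mu (fun x => v (idx s x) * (u x - avg s u x)).
  by apply: (@L1M_bounded _ _ _ _ M); [exact: measurable_idx|by []|exact: L1B].
apply: (I_cells0 s0) => // m.
have mc := @measurable_cell R n s m s0.
rewrite (@eq_I _ _ _ mu _ (fun x : lebesgueRn R n => v m * (\1_(cell s m) x * u x
    - cavg s u m * \1_(cell s m) x))); last first.
  move=> x; rewrite indicE; case: (boolP (x \in cell s m)) => /=.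
    by rewrite inE /cell/= /avg => ->; ring.
  by move=> _; ring.
rewrite IZ; last by apply: L1B; [exact: L1_indic|exact/L1Z/L1_cell].
rewrite IB ?IZ//; [|exact: L1_cell|exact: L1_indic|exact/L1Z/L1_cell].
rewrite I_indic// [X in fine X](mu_cell m s0) /= /cavg mulrAC mulVf ?expf_neq0 ?gt_eqF//.
by rewrite mul1r subrr mulr0.
Qed.

End averages.

(** * An abstract almost orthogonality inequality *)

Section bessel.
Context d (T : measurableType d) (R : realType) (mu : {measure set T -> \bar R}).

(* Expanding [0 <= I ((f - K^-1 sum_q w_q <f, h_q> h_q)^2)]. *)
Lemma bessel_schur (X : eqType) (s : seq X) (w : X -> R) (h : X -> T -> R)
    (K : R) (f : T -> R) : 0 < K -> (forall q, 0 <= w q) ->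
  (forall q q', L1 mu (fun x => h q x * h q' x)) ->
  (forall q, L1 mu (fun x => f x * h q x)) -> L1 mu (fun x => f x ^+ 2) ->
  (forall q, q \in s ->
    \sum_(q' <- s) w q' * `|I mu (fun x => h q x * h q' x)| <= K) ->
  \sum_(q <- s) w q * I mu (fun x => f x * h q x) ^+ 2
    <= K * I mu (fun x => f x ^+ 2).
Proof.
move=> K0 w0 hhL fhL ffL schur.
pose c q := I mu (fun x => f x * h q x).
pose G q q' := I mu (fun x => h q x * h q' x).
pose a := \sum_(q <- s) w q * c q ^+ 2.
pose D := \sum_(q <- s) \sum_(q' <- s) (w q * c q * (w q' * c q')) * G q q'.
have GC q q' : G q q' = G q' q by apply: eq_I => x; rewrite mulrC.
(* Schur's test: [c q * c q'] is at most half the sum of the squares, and the symmetry of the Gram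
   matrix [G] makes the two halves equal. *)
have DK : D <= K * a.
  have : D <= \sum_(q <- s) \sum_(q' <- s)
     (w q * w q' * `|G q q'| * c q ^+ 2 / 2 + w q * w q' * `|G q q'| * c q' ^+ 2 / 2).
    apply: ler_sum => q _; apply: ler_sum => q' _.
    have h1 : c q * c q' * G q q' <= `|G q q'| * ((c q ^+ 2 + c q' ^+ 2) / 2).
      apply: (le_trans (ler_norm _)); rewrite normrM mulrC ler_wpM2l//.
      have := sqr_ge0 (`|c q| - `|c q'|); rewrite sqrrB !real_normK ?num_real//.
      by rewrite normrM; lra.
    have ww : 0 <= w q * w q' by rewrite mulr_ge0.
    have := ler_wpM2l ww h1; lra.
  move/le_trans; apply.
  under eq_bigr do rewrite big_split/=.
  rewrite big_split/= [X in _ + X]exchange_big/=.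
  rewrite [X in _ + X](_ : _ = \sum_(q <- s) \sum_(q' <- s)
      w q * w q' * `|G q q'| * c q ^+ 2 / 2); last first.
    by apply: eq_bigr => q _; apply: eq_bigr => q' _; rewrite GC [w q * _]mulrC.
  rewrite -big_split/= /a mulr_sumr big_seq [leRHS]big_seq.
  apply: ler_sum => q qs; rewrite -big_split/=.
  rewrite (_ : \sum_(q' <- s) _ = (\sum_(q' <- s) w q' * `|G q q'|) * (w q * c q ^+ 2)).
    by apply: ler_wpM2r; [rewrite mulr_ge0 ?sqr_ge0|exact: schur].
  by rewrite mulr_suml; apply: eq_bigr => q' _; rewrite -/(G q q'); field.
pose t := K^-1.
have : 0 <= I mu (fun x => (f x - t * \sum_(q <- s) w q * c q * h q x) ^+ 2).
  by apply: I_ge0 => x; exact: sqr_ge0.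
rewrite (@eq_I _ _ _ _ _ (fun x => f x ^+ 2 +
    ((- 2 * t) * (\sum_(q <- s) (w q * c q) * (f x * h q x))
    + t ^+ 2 * \sum_(q <- s) \sum_(q' <- s)
       (w q * c q * (w q' * c q')) * (h q x * h q' x)))); last first.
  move=> x; rewrite sqrrB -addrA; congr (_ + _).
  rewrite exprMn -mulr_natl; congr (_ + t ^+ 2 * _).
    rewrite mulNr mulrA mulNr; congr (- _).
    rewrite -!mulrA; congr (_ * _); rewrite mulrCA; congr (_ * _).
    by rewrite mulr_sumr; apply: eq_bigr => q _; ring.
  rewrite expr2 mulr_suml; apply: eq_bigr => q _.
  by rewrite mulr_sumr; apply: eq_bigr => q' _; ring.
have L1a : L1 mu (fun x => \sum_(q <- s) (w q * c q) * (f x * h q x)).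
  by apply: L1_sum => q _; exact: L1Z.
have L1b q : L1 mu (fun x => \sum_(q' <- s)
       (w q * c q * (w q' * c q')) * (h q x * h q' x)).
  by apply: L1_sum => q' _; exact: L1Z.
have L1c : L1 mu (fun x => \sum_(q <- s) \sum_(q' <- s)
       (w q * c q * (w q' * c q')) * (h q x * h q' x)).
  by apply: L1_sum => q _; exact: L1b.
rewrite ID//; last by apply: L1D; exact: L1Z.
rewrite ID; [|exact: L1Z|exact: L1Z].
rewrite IZ// IZ// I_sum => [|q _]; last exact: L1Z.
rewrite I_sum//.
rewrite (_ : \sum_(j <- s) I mu (fun x => _ * (f x * h j x)) = a); last first.
  by apply: eq_bigr => q _; rewrite IZ// -/(c q) expr2 mulrA.
rewrite (_ : \sum_(j <- s) _ = D); last first.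
  apply: eq_bigr => q _; rewrite I_sum => [|q' _]; last exact: L1Z.
  by apply: eq_bigr => q' _; rewrite IZ.
rewrite -/a => H; rewrite -ler_pdivrMl// -/t.
(* With [t = K^-1] the expanded square is the integral of [f ^+ 2] minus [2 * t * a] plus
   [t ^+ 2 * D]; this bound leaves the integral minus [t * a]. *)
have : t ^+ 2 * D <= t * a.
  have := ler_wpM2l (sqr_ge0 t) DK; rewrite mulrA expr2 -[t * t * K]mulrA.
  by rewrite /t mulVf ?gt_eqF// mulr1.
by lra.
Qed.

End bessel.

Lemma sum_geometric_le (R : realType) (r : R) (N : nat) : 0 <= r < 1 ->
  \sum_(k < N) r ^+ k <= (1 - r)^-1.
Proof.
move=> /andP[r0 r1]; have r10 : 0 < 1 - r by rewrite subr_gt0.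
rewrite -[leRHS]mul1r ler_pdivlMr// mulrC -opprB mulNr -subrX1 opprB.
by rewrite lerBlDr lerDl exprn_ge0.
Qed.

(** Subtraction on [nat] is truncated, so the exponent is the distance between [i] and [k]; each
    side of [i] gives a geometric series. *)
Lemma sum_geometric_dist_le (R : realType) (r : R) (i N : nat) : 0 <= r < 1 ->
  \sum_(k < N) r ^+ ((i - k) + (k - i)) <= 2 / (1 - r).
Proof.
move=> r01; have /andP[r0 r1] := r01.
have S0 : 0 <= (1 - r)^-1 by rewrite invr_ge0 subr_ge0 ltW.
have : \sum_(k < N) r ^+ ((i - k) + (k - i)) <=
    \sum_(k < i) r ^+ k.+1 + (1 - r)^-1.
  elim: i N => [|i IH] N.
    rewrite big_ord0 add0r; under eq_bigr do rewrite sub0n subn0 add0n.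
    exact: sum_geometric_le.
  case: N => [|N]; first by rewrite big_ord0 addr_ge0// sumr_ge0// => *; rewrite exprn_ge0.
  rewrite big_ord_recl [in leRHS]big_ord_recr/= subn0 sub0n addn0.
  rewrite [leRHS]addrAC [leLHS]addrC lerD2r (le_trans _ (IH N))//.
move/le_trans; apply; rewrite mulr_natl mulr2n lerD2r.
apply: le_trans (sum_geometric_le i r01); apply: ler_sum => k _.
by rewrite exprS ler_piMl ?exprn_ge0 // ltW.
Qed.

(** * Almost orthogonality *)

Section cubes.
Context (R : realType) (n : nat).
Notation mu := (@lebesgue_rV R n).
Notation mfun := (measurable_fun [set: lebesgueRn R n]).
Implicit Types (s r : R) (c x y : 'rV[R]_n) (m : 'rV[int]_n).

Definition cube c r : set 'rV[R]_n :=
  [set x | forall j, `|x ord0 j - c ord0 j| <= r].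

Lemma measurable_cube c r : measurable (cube c r : set (lebesgueRn R n)).
Proof.
rewrite (_ : cube c r = \big[setI/setT]_(j < n)
    ((fun x : 'rV[R]_n => x ord0 j) @^-1` `[c ord0 j - r, c ord0 j + r])).
  apply: (big_ind (fun A => measurable (A : set (lebesgueRn R n)))) => //.
    by move=> A B; exact: measurableI.
  by move=> j _; rewrite -[X in measurable X]setTI;
    apply: (@measurable_coord R n j measurableT); exact: measurable_itv.
apply/seteqP; split=> x.
  move=> xc; apply: (big_ind (fun A : set 'rV[R]_n => A x)) => // j _ /=.
  by rewrite in_itv/= -ler_distl.
move=> + j; rewrite (bigD1 j)//= => -[/=].
by rewrite in_itv/= -ler_distl.
Qed.

(** The constant 3 instead of 2 leaves room for the closed cube in a left-open box. *)
Lemma mu_cube_le c r : 0 < r -> (mu (cube c r) <= ((3 * r) ^+ n)%:E)%E.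
Proof.
move=> r0; pose p : 'rV[R]_n * 'rV[R]_n :=
  (\row_j (c ord0 j - 2 * r), \row_j (c ord0 j + r)).
have -> : (3 * r) ^+ n = box_vol p.
  rewrite /box_vol -[in LHS](card_ord n) -prodr_const; apply: eq_bigr => j _.
  by rewrite !mxE max_r; lra.
apply: le_trans (lebesgue_outer_box_le p); apply: le_lebesgue_outer => x xc j.
by have := xc j; rewrite !mxE ler_distl => /andP[? ?]; apply/andP; split; lra.
Qed.

Lemma L1_cube c r : 0 < r -> L1 mu (\1_(cube c r)).
Proof.
move=> r0; apply: L1_indic1; first exact: measurable_cube.
by apply: le_lt_trans (mu_cube_le c r0) _; rewrite ltry.
Qed.

Lemma I_cube_le c r : 0 < r -> I mu \1_(cube c r) <= (3 * r) ^+ n.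
Proof.
move=> r0; rewrite -lee_fin I_EFin; last exact: L1_cube.
rewrite integral_indic ?setIT//; last exact: measurable_cube.
exact: mu_cube_le.
Qed.

Definition corner s m : 'rV[R]_n := \row_j (s * (m ord0 j)%:~R).

(** The half-side is [3 * s] because a point [y] of the cell is within [s] of the corner in each
    coordinate, and [t < 2 * s]: the support of [z -> phi_t (y - z)] and the points whose cone
    contains [(y, t)] both stay in this cube. *)
Definition star s m := cube (corner s m) (3 * s).

Lemma starE s m x :
  star s m x = forall j, `|x ord0 j - s * (m ord0 j)%:~R| <= 3 * s.
Proof.
by apply/propext; split=> H j; have := H j; rewrite mxE.
Qed.

(* A modulus of continuity of exponent log_2 theta, tested at dyadic scales only. *)
Definition atom (sigma theta : R) i m (h : 'rV[R]_n -> R) : Prop :=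
  [/\ mfun h, forall x, ~ star (sigma * 2 ^+ i) m x -> h x = 0, I mu h = 0 &
    forall i' x y, (forall j, `|x ord0 j - y ord0 j| <= sigma * 2 ^+ i') ->
      `|h x - h y| <=
        n%:R * (sigma * 2 ^+ i) ^- n * (theta ^+ i' / theta ^+ i)].

End cubes.

Section atoms.
Context (R : realType) (n : nat) (sigma theta : R).
Hypotheses (n_gt0 : (0 < n)%N) (sigma_gt0 : 0 < sigma) (theta12 : 1 < theta <= 2).
Notation mu := (@lebesgue_rV R n).
Notation side i := (sigma * 2 ^+ i).
Implicit Types (x y : 'rV[R]_n) (m : 'rV[int]_n) (h : 'rV[R]_n -> R) (i : nat).

Lemma side_gt0 i : 0 < side i.
Proof. by rewrite mulr_gt0// exprn_gt0. Qed.

Lemma theta_gt0 : 0 < theta.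
Proof. by have /andP[t1 _] := theta12; rewrite (lt_trans _ t1). Qed.

Lemma side_add i k : side (i + k) = 2 ^+ k * side i.
Proof. by rewrite exprD; ring. Qed.

(** The comparison point [y], 8 sides away in every coordinate, is outside the star, so [h] vanishes
    there. As 8 is 2 to the power 3, the modulus is used at level [i + 3], and [theta ^+ 3 <= 8]. *)
Lemma atom_bound i m h x : atom sigma theta i m h ->
  `|h x| <= (8 * n)%:R * side i ^- n.
Proof.
move=> [mh hsupp _ hmod]; have s0 := side_gt0 i; have t0 := theta_gt0.
have c0 : 0 <= (8 * n)%:R * side i ^- n by rewrite mulr_ge0// expVn_ge0.
have [xs|/hsupp->] := pselect (star (side i) m x); last by rewrite normr0.
pose j0 := Ordinal n_gt0.
pose y : 'rV[R]_n := \row_j (x ord0 j + 8 * side i).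
have ys : ~ star (side i) m y.
  rewrite starE => /(_ j0); move: xs; rewrite starE => /(_ j0); rewrite mxE.
  rewrite !ler_distl => /andP[h1 h2] /andP[h3 h4].
  by move: s0 h1 h4; lra.
have := hmod (i + 3)%N x y; rewrite (hsupp _ ys) subr0 => H.
apply: (le_trans (H _)).
  move=> j; rewrite mxE opprD addNKr normrN side_add.
  rewrite ger0_norm; last by rewrite mulr_ge0// ltW.
  by rewrite ler_wpM2r ?(ltW s0)//; lra.
have -> : theta ^+ (i + 3) / theta ^+ i = theta ^+ 3.
  by rewrite exprD mulrAC mulfV ?mul1r// expf_neq0 ?gt_eqF.
rewrite mulnC natrM mulrAC ler_wpM2r ?expVn_ge0// ler_wpM2l//.
have /andP[_ t2] := theta12.
rewrite (_ : 8%:R = 2 ^+ 3); last by rewrite -natrX.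
by rewrite ler_pXn2r// nnegrE ltW.
Qed.

Lemma atom_bound_indic i m h x : atom sigma theta i m h ->
  `|h x| <= (8 * n)%:R * side i ^- n * \1_(star (side i) m) x.
Proof.
move=> ha; rewrite indicE; case: (boolP (x \in star (side i) m)).
  by rewrite mulr1 => _; exact: atom_bound ha.
rewrite notin_setE => xs; have [_ -> //] := ha.
by rewrite normr0 mulr0.
Qed.

Lemma L1_star i m : L1 mu (\1_(star (side i) m)).
Proof. by apply: L1_cube; rewrite mulr_gt0// side_gt0. Qed.

Lemma I_star_le i m : I mu \1_(star (side i) m) <= 9 ^+ n * side i ^+ n.
Proof.
have s0 := side_gt0 i.
apply: le_trans (I_cube_le _ _) _; first by rewrite mulr_gt0.
by rewrite mulrA exprMn -natrM.
Qed.

Lemma L1_atom i m h : atom sigma theta i m h -> L1 mu h.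
Proof.
move=> ha; have [mh _ _ _] := ha.
apply: (@L1_le _ (lebesgueRn R n) R mu _
  (fun x => (8 * n)%:R * side i ^- n * \1_(star (side i) m) x)) => //.
  by move=> x; exact: atom_bound_indic.
by apply: L1Z; exact: L1_star.
Qed.

Lemma L1_mul_atom i m h f : atom sigma theta i m h -> L1 mu f ->
  L1 mu (fun x => h x * f x).
Proof.
move=> ha fL; have [mh _ _ _] := ha.
by apply: L1M_bounded => // x; exact: atom_bound ha.
Qed.

(** Locates the index of the second star, in units of its own side, around the rescaled index of the
    first; 6 is 3 + 3. The truncated difference covers both orders of [i] and [i']. *)
Lemma stars_meet i i' m m' x : star (side i) m x -> star (side i') m' x ->
  forall j, `|(m' ord0 j)%:~R - side i / side i' * (m ord0 j)%:~R|
    <= (6 * 2 ^ (i - i'))%:R :> R.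
Proof.
rewrite !starE => H H' j; have := H j; have := H' j.
have s0' := side_gt0 i'.
have p1 : (1 : R) <= 2 ^+ (i - i') by rewrite exprn_ege1// ler1n.
have sp : side i <= 2 ^+ (i - i') * side i'.
  rewrite -side_add ler_wpM2l ?(ltW sigma_gt0)//.
  by rewrite ler_weXn2l ?ler1n// -leq_subLR.
have s'p : side i' <= 2 ^+ (i - i') * side i' by rewrite ler_peMl// ltW.
rewrite natrM natrX; move: p1 sp s'p; set p := 2 ^+ (i - i').
set s := side i; set s' := side i' in s0' * => p1 sp s'p.
rewrite !ler_distl => /andP[h1 h2] /andP[h3 h4].
have -> : s / s' * (m ord0 j)%:~R = s * (m ord0 j)%:~R / s' by rewrite mulrAC.
apply/andP; split; rewrite -(ler_pM2r s0') mulrDl ?mulNr divfK ?gt_eqF//; lra.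
Qed.

(** The finer atom [h'] has mean zero, so [h] may be replaced by its oscillation around the corner
    attached to [h']. The star of [h'] has half-side 3 sides, less than 4, whence the modulus at
    level [i' + 2]; the factor 32 is 8 times the bound 4 for [theta ^+ 2]. *)
Lemma atoms_inner_le i i' m m' h h' : (i' <= i)%N ->
  atom sigma theta i m h -> atom sigma theta i' m' h' ->
  `|I mu (fun x => h x * h' x)| <=
    (32 * n ^ 2 * 9 ^ n)%:R * side i ^- n * theta^-1 ^+ (i - i').
Proof.
move=> ii' ha ha'; have [mh hs h0 hm] := ha; have [mh' hs' h0' hm'] := ha'.
have t0 := theta_gt0; have s0 := side_gt0 i; have s0' := side_gt0 i'.
pose c := corner (side i') m'.
have hL' := L1_atom ha'.
have hcL : L1 mu (fun x => h c * h' x) by exact: L1Z.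
have -> : I mu (fun x => h x * h' x) = I mu (fun x => h x * h' x - h c * h' x).
  by rewrite IB ?IZ// ?h0' ?mulr0 ?subr0//; exact: L1_mul_atom ha hL'.
pose K := n%:R * side i ^- n * (theta ^+ (i' + 2) / theta ^+ i) *
  ((8 * n)%:R * side i' ^- n).
have bnd x : `|h x * h' x - h c * h' x| <= K * \1_(star (side i') m') x.
  rewrite -mulrBl normrM indicE; case: (boolP (x \in star (side i') m')).
    rewrite inE => xs; rewrite mulr1 ler_pM ?normr_ge0//; last exact: atom_bound ha'.
    apply: hm => j; have := xs j; rewrite -/c => /le_trans; apply.
    by rewrite side_add ler_wpM2r ?(ltW s0')//; lra.
  by rewrite notin_setE => xs; rewrite (hs' _ xs) normr0 !mulr0.
apply: le_trans (@I_abs_le _ (lebesgueRn R n) R mu _ _ _ _ bnd) _.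
- by apply: L1B => //; exact: L1_mul_atom ha hL'.
- by apply: L1Z; exact: L1_star.
rewrite IZ; last exact: L1_star.
have K0 : 0 <= K.
  by rewrite !mulr_ge0 ?expVn_ge0 ?invr_ge0 ?exprn_ge0 ?(ltW t0).
apply: le_trans (ler_wpM2l K0 (I_star_le i' m')) _.
have -> : theta^-1 ^+ (i - i') = theta ^+ i' / theta ^+ i.
  by rewrite exprVn expfB_cond ?gt_eqF ?invf_div.
have -> : K * (9 ^+ n * side i' ^+ n) =
    (8 * n ^ 2 * 9 ^ n)%:R * side i ^- n * (theta ^+ i' / theta ^+ i) * theta ^+ 2.
  rewrite /K exprD !natrM !natrX; field.
  by rewrite ?expf_neq0 ?gt_eqF.
have /andP[_ t2] := theta12.
have t4 : theta ^+ 2 <= 4.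
  by rewrite (_ : 4 = 2 ^+ 2)// ?ler_pXn2r ?nnegrE ?(ltW t0)// -natrX.
apply: (@le_trans _ _ ((8 * n ^ 2 * 9 ^ n)%:R * side i ^- n * (theta ^+ i' / theta ^+ i) * 4)).
  rewrite ler_wpM2l// !mulr_ge0 ?expVn_ge0 ?invr_ge0 ?exprn_ge0 ?(ltW t0)//.
by rewrite (_ : 32 = 8 * 4)%N// !natrM le_eqVlt; apply/orP; left; apply/eqP; ring.
Qed.

Lemma atoms_inner_le_sym i i' m m' h h' :
  atom sigma theta i m h -> atom sigma theta i' m' h' ->
  `|I mu (fun x => h x * h' x)| <=
    (32 * n ^ 2 * 9 ^ n)%:R * side (maxn i i') ^- n *
    theta^-1 ^+ ((i - i') + (i' - i)).
Proof.
move=> ha ha'; have [ii'|ii'] := leqP i' i.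
  have /eqP -> : (i' - i == 0)%N by rewrite subn_eq0.
  by rewrite addn0; exact: atoms_inner_le ha ha'.
have /eqP -> : (i - i' == 0)%N by rewrite subn_eq0 ltnW.
rewrite add0n; rewrite (@eq_I _ (lebesgueRn R n) _ mu _ (fun x => h' x * h x)).
  exact: atoms_inner_le (ltnW ii') ha' ha.
by move=> x; rewrite mulrC.
Qed.

End atoms.

Section L2_bound.
Context (R : realType) (n : nat) (sigma theta : R).
Hypotheses (n_gt0 : (0 < n)%N) (sigma_gt0 : 0 < sigma) (theta12 : 1 < theta <= 2).
Notation mu := (@lebesgue_rV R n).
Notation side i := (sigma * 2 ^+ i).
Implicit Types (x y : 'rV[R]_n) (m : 'rV[int]_n) (i : nat).

Lemma cubes_overlap (s : R) (M : seq 'rV[int]_n) (k : nat) x : 0 < s -> uniq M ->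
  \sum_(m <- M) \1_(cube (corner s m) (k%:R * s)) x <= ((2 * k).+2 ^ n)%:R :> R.
Proof.
move=> s0 uM; under eq_bigr do rewrite indicE.
rewrite -natr_sum ler_nat.
rewrite (eq_bigr (fun m => if x \in cube (corner s m) (k%:R * s) then 1%N else 0%N));
  last first.
  by move=> m _; case: (x \in _).
rewrite -big_mkcond/= -big_filter sum1_size.
apply: (@size_int_box R n _ (fun j => x ord0 j / s) k); first exact: filter_uniq.
move=> m j; rewrite mem_filter => /andP[+ _]; rewrite inE => /(_ j).
rewrite mxE distrC => H; rewrite -(ler_pM2r s0) -[X in _ * X]gtr0_norm// -normrM.
by rewrite mulrBl divfK ?gt_eqF// mulrC.
Qed.

(** [14 ^ n] counts neighbours, by [2 * 6 * 2^d + 2 <= 14 * 2^d]; the next factor bounds the inner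
    products, and the last one sums over the scales. *)
Definition schur_const : R :=
  (14 ^ n * (32 * n ^ 2 * 9 ^ n))%:R * (2 / (1 - theta^-1)).

Lemma theta_inv01 : 0 <= theta^-1 < 1.
Proof.
have t0 := theta_gt0 theta12; have /andP[t1 _] := theta12.
by rewrite invr_ge0 (ltW t0) invf_lt1.
Qed.

Lemma schur_const_gt0 : 0 < schur_const.
Proof.
have /andP[t0 t1] := theta_inv01.
rewrite mulr_gt0// ?ltr0n ?muln_gt0 ?expn_gt0 ?n_gt0//.
by rewrite divr_gt0// subr_gt0.
Qed.

Variables (h : nat -> 'rV[int]_n -> 'rV[R]_n -> R).
Hypothesis h_atom : forall i m, atom sigma theta i m (h i m).
Variables (N : nat) (M : seq 'rV[int]_n).
Hypothesis M_uniq : uniq M.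

(** Only atoms whose stars meet contribute. If [i' <= i] their number grows like [2^(n (i - i'))],
    and the quotient of [side i' ^+ n] by the volume of the coarser scale compensates exactly;
    otherwise it is bounded. *)
Lemma atoms_schur_level i m i' :
  \sum_(m' <- M) side i' ^+ n * `|I mu (fun x => h i m x * h i' m' x)| <=
  (14 ^ n * (32 * n ^ 2 * 9 ^ n))%:R * theta^-1 ^+ ((i - i') + (i' - i)).
Proof.
have s0' := side_gt0 sigma_gt0 i'.
have /andP[r0 r1] := theta_inv01.
pose mt m' := `[< exists x, star (side i) m x /\ star (side i') m' x >].
rewrite (bigID mt)/= [X in _ + X]big1 ?addr0; last first.
  move=> m' /asboolPn nmt.
  rewrite (@eq_I _ (lebesgueRn R n) _ mu _ (fun=> 0)) ?I0 ?normr0 ?mulr0//.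
  move=> x; have [_ hs _ _] := h_atom i m; have [_ hs' _ _] := h_atom i' m'.
  have [xs|xs] := pselect (star (side i) m x); last by rewrite (hs _ xs) mul0r.
  have [xs'|xs'] := pselect (star (side i') m' x); last by rewrite (hs' _ xs') mulr0.
  by exfalso; apply: nmt; exists x.
set c : R := (32 * n ^ 2 * 9 ^ n)%:R * side (maxn i i') ^- n *
    theta^-1 ^+ ((i - i') + (i' - i)).
apply: (@le_trans _ _ (\sum_(m' <- M | mt m') side i' ^+ n * c)).
  apply: ler_sum => m' _; rewrite ler_wpM2l ?exprn_ge0 ?(ltW s0')//.
  exact: (atoms_inner_le_sym n_gt0 sigma_gt0 theta12 (h_atom i m) (h_atom i' m')).
rewrite -big_filter big_const_seq count_predT iter_addr_0 -[leLHS]mulr_natr.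
have sz : (size ([seq m' <- M | mt m']) <= (14 * 2 ^ (i - i')) ^ n)%N.
  apply: leq_trans (@size_int_box R n _
     (fun j => side i / side i' * (m ord0 j)%:~R) (6 * 2 ^ (i - i')) _ _) _.
  - exact: filter_uniq.
  - move=> m' j; rewrite mem_filter => /andP[/asboolP[x [xs xs']] _].
    exact: (stars_meet sigma_gt0 xs xs').
  - rewrite leq_exp2r//; have : (0 < 2 ^ (i - i'))%N by rewrite expn_gt0.
    by lia.
have c0 : 0 <= c.
  by rewrite !mulr_ge0// ?expVn_ge0 ?exprn_ge0//; exact: side_gt0.
have sc0 : 0 <= side i' ^+ n * c by rewrite mulr_ge0 ?exprn_ge0 ?(ltW s0').
move: sz; rewrite -(ler_nat R) => /(ler_wpM2l sc0) /le_trans; apply.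
rewrite le_eqVlt; apply/orP; left; apply/eqP; rewrite /c.
have -> : maxn i i' = (i' + (i - i'))%N by rewrite maxnC maxnE.
rewrite side_add; set r := theta^-1 ^+ _; set D := (32 * n ^ 2 * 9 ^ n)%N.
rewrite !natrM !natrX !natrM !natrX !exprMn; field.
by rewrite !expf_neq0 ?gt_eqF.
Qed.

Lemma atoms_schur i m :
  \sum_(i' < N) \sum_(m' <- M)
    side i' ^+ n * `|I mu (fun x => h i m x * h i' m' x)| <= schur_const.
Proof.
apply: (@le_trans _ _ (\sum_(i' < N) (14 ^ n * (32 * n ^ 2 * 9 ^ n))%:R *
    theta^-1 ^+ ((i - i') + (i' - i)))).
  by apply: ler_sum => i' _; exact: atoms_schur_level.
rewrite -mulr_sumr ler_wpM2l//.
exact: sum_geometric_dist_le theta_inv01.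
Qed.

Lemma atoms_L2_bound (f : 'rV[R]_n -> R) (B : R) : L1 mu f ->
  (forall x, `|f x| <= B) ->
  \sum_(i < N) \sum_(m <- M) side i ^+ n * I mu (fun x => h i m x * f x) ^+ 2
    <= schur_const * I mu (fun x => f x ^+ 2).
Proof.
move=> fL fB; have mf := L1_measurable fL.
pose s := [seq (i, m) | i <- index_iota 0 N, m <- M].
pose H (q : nat * 'rV[int]_n) := h q.1 q.2.
have HA q : atom sigma theta q.1 q.2 (H q) by exact: h_atom.
have HL q : L1 mu (H q) := L1_atom n_gt0 sigma_gt0 theta12 (HA q).
have mul_HL q u : L1 mu u -> L1 mu (fun x => H q x * u x).
  by move=> uL; exact (L1_mul_atom n_gt0 sigma_gt0 theta12 (HA q) uL).
have sumE (F : nat * 'rV[int]_n -> R) :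
    \sum_(q <- s) F q = \sum_(i < N) \sum_(m <- M) F (nat_of_ord i, m).
  by rewrite big_allpairs_dep big_mkord.
rewrite (_ : \sum_(i < N) _ =
    \sum_(q <- s) side q.1 ^+ n * I mu (fun x => f x * H q x) ^+ 2); last first.
  rewrite sumE; apply: eq_bigr => i _; apply: eq_bigr => m _.
  by congr (_ * _ ^+ 2); apply: eq_I => x; rewrite mulrC.
apply: (@bessel_schur _ (lebesgueRn R n) R mu _ s (fun q => side q.1 ^+ n) H).
- exact: schur_const_gt0.
- by move=> q; rewrite exprn_ge0// ltW// side_gt0.
- by move=> q q'; exact: mul_HL.
- move=> q; have := mul_HL q f fL; apply: eq_integrable => // x _.
  by rewrite /= mulrC.
- by apply: (@L1M_bounded _ _ _ _ B) => //.
- move=> [i m] _; rewrite sumE; exact: atoms_schur.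
Qed.

End L2_bound.

(** * Translation invariance of the integral *)

Section translation.
Context (R : realType) (n : nat).
Notation mu := (@lebesgue_rV R n).
Notation mfun := (measurable_fun [set: lebesgueRn R n]).

Lemma measurable_translate (a : 'rV[R]_n) (u : 'rV[R]_n -> R) :
  mfun u -> mfun (fun x : 'rV[R]_n => u (x + a)).
Proof.
move=> mu_.
rewrite (_ : (fun x => _) = u \o (fun x : 'rV[R]_n => a + 1 *: x)).
  apply: (@measurableT_comp _ _ _ (lebesgueRn R n) (lebesgueRn R n) R u); first exact: mu_.
  exact: measurable_affine (oner_neq0 R).
by apply/funext => x /=; rewrite scale1r addrC.
Qed.

Lemma integral_translate (a : 'rV[R]_n) (u : 'rV[R]_n -> R) :
  mfun u -> (forall x, 0 <= u x) ->
  (\int[mu]_x (u (x + a)%R)%:E = \int[mu]_x (u x)%:E)%E.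
Proof.
move=> mu_ u0; have := @integral_affine R n a 1 (EFin \o u) (oner_neq0 R).
rewrite normr1 expr1n invr1 mul1e => <-; last 2 first.
- exact/measurable_EFinP.
- by move=> x; rewrite /= lee_fin.
by apply: eq_integral => x _ /=; rewrite scale1r addrC.
Qed.

Lemma I_translate (a : 'rV[R]_n) (u : 'rV[R]_n -> R) :
  mfun u -> (forall x, 0 <= u x) -> I mu (fun x => u (x + a)) = I mu u.
Proof. by move=> mu_ u0; rewrite /I /Rintegral integral_translate. Qed.

Lemma L1_translate (a : 'rV[R]_n) (u : 'rV[R]_n -> R) :
  L1 mu u -> (forall x, 0 <= u x) -> L1 mu (fun x => u (x + a)).
Proof.
move=> uL u0; have mu_ := L1_measurable uL; apply/integrableP; split.
  by apply/measurable_EFinP; exact: measurable_translate.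
have /integrableP[_] := uL; rewrite -[X in (X < _)%E -> _](_ :
    (\int[mu]_x (u x)%:E = _)%E); last first.
  by apply: eq_integral => x _ /=; rewrite ger0_norm.
rewrite -(integral_translate a mu_ u0) => /(le_lt_trans _); apply.
rewrite le_eqVlt; apply/orP; left; apply/eqP.
by apply: eq_integral => x _ /=; rewrite ger0_norm.
Qed.

End translation.

(** * Calderon-Zygmund decomposition and the weak (1,1) bound *)

Section stopping.
Context (R : realType) (n : nat) (sigma : R).
Hypothesis sigma_gt0 : 0 < sigma.
Notation mu := (@lebesgue_rV R n).
Notation mfun := (measurable_fun [set: lebesgueRn R n]).
Notation side i := (sigma * 2 ^+ i).
Implicit Types (x y : 'rV[R]_n) (m : 'rV[int]_n) (i : nat).

Lemma idx_le i k x y : (i <= k)%N -> idx (side i) x = idx (side i) y ->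
  idx (side k) x = idx (side k) y.
Proof.
move=> /subnKC <-; elim: (k - i)%N => [|l IH] xy; first by rewrite addn0.
by rewrite addnS exprS mulrCA; apply: idx_double (IH xy); exact: side_gt0.
Qed.

Variables (F : 'rV[R]_n -> R) (lam : R) (K : nat).
Hypotheses (FL : L1 mu F) (F_ge0 : forall x, 0 <= F x) (lam_gt0 : 0 < lam).
Hypothesis K_top : side K ^- n * I mu F <= lam.

(* The value 0 covers both level 0 and the absence of any level with large average. *)
Definition stop x : nat := \max_(i < K | lam < avg (side i) F x) i.

Lemma stop_le x : (stop x <= K)%N.
Proof. by apply/bigmax_leqP => i _; exact: ltnW. Qed.

Lemma avg_top x : avg (side K) F x <= lam.
Proof. by apply: le_trans K_top; apply: avg_le_I => //; exact: side_gt0. Qed.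

Lemma avg_gt_stop x i : (stop x < i <= K)%N -> avg (side i) F x <= lam.
Proof.
move=> /andP[xi]; rewrite leq_eqVlt => /predU1P[->|iK]; first exact: avg_top.
rewrite leNgt; apply/negP => H; move: xi; rewrite ltnNge => /negP; apply.
exact: (@leq_bigmax_cond _ (fun i : 'I_K => lam < avg (side i) F x) val (Ordinal iK)).
Qed.

Lemma avg_stop_gt x : (0 < stop x)%N -> lam < avg (side (stop x)) F x.
Proof.
move=> H; pose P := fun i : 'I_K => lam < avg (side i) F x.
have [i Pi | noi] := pickP P; last by rewrite /stop big_pred0 in H.
have c : (0 < #|P|)%N by apply/card_gt0P; exists i.
have [j Pj E] := @eq_bigmax_cond _ P val c.
have -> : stop x = j by rewrite -[RHS]E.
exact: Pj.
Qed.

Lemma avg_stop_le x : avg (side (stop x)) F x <= 2 ^+ n * lam.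
Proof.
have p1 : (1 : R) <= 2 ^+ n by rewrite exprn_ege1// ler1n.
have := stop_le x; rewrite leq_eqVlt => /predU1P[->|xK].
  by apply: (le_trans (avg_top x)); rewrite ler_peMl// ltW.
apply: (le_trans (avg_double _ (side_gt0 sigma_gt0 _) FL F_ge0)).
by rewrite ler_wpM2l// mulrCA -exprS avg_gt_stop// ltnS leqnn.
Qed.

(** Points sharing a cell share all larger cells, hence the averages over them: no larger level
    qualifies for [y], and level [stop x], if positive, does. *)
Lemma stop_cell x y : idx (side (stop x)) x = idx (side (stop x)) y -> stop y = stop x.
Proof.
move=> xy; apply/eqP; rewrite eqn_leq; apply/andP; split.
  apply/bigmax_leqP => i; rewrite leqNgt => H; apply/negP => xi.
  move: H; rewrite ltNge => /negP; apply.
  rewrite -(eq_avg F (idx_le (ltnW xi) xy)); apply: avg_gt_stop.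
  by rewrite xi ltnW.
have [->//|x0] := posnP (stop x).
have xK : (stop x < K)%N.
  rewrite ltn_neqAle stop_le andbT; apply/eqP => xK.
  by have := avg_stop_gt x0; rewrite xK ltNge avg_top.
have := avg_stop_gt x0; rewrite (eq_avg F xy) => H.
exact: (@leq_bigmax_cond _ (fun i : 'I_K => lam < avg (side i) F y) val (Ordinal xK)).
Qed.

(** Indicator of the stopping cells of level [i], written as a function of the cell index so that
    the averaging lemmas apply. *)
Definition stop_mask i m : R := (`[< exists2 x, idx (side i) x = m & stop x = i >])%:R.

Lemma stop_maskE i x : stop_mask i (idx (side i) x) = (stop x == i)%:R.
Proof.
congr (nat_of_bool _)%:R; apply/asboolP/eqP => [[y yx yi]|xi]; last by exists x.
by rewrite -yi; apply: stop_cell; rewrite yi.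
Qed.

Lemma stop_mask01 i m : 0 <= stop_mask i m <= 1.
Proof. by rewrite /stop_mask; case: asbool; rewrite /= !lexx ler01. Qed.

Lemma sum_stop_mask (G : nat -> R) x :
  \sum_(i < K.+1) stop_mask i (idx (side i) x) * G i = G (stop x).
Proof.
have xK : (stop x < K.+1)%N by rewrite ltnS stop_le.
rewrite (bigD1 (Ordinal xK))//= stop_maskE eqxx mul1r big1 ?addr0// => i ix.
rewrite stop_maskE (_ : (stop x == i) = false) ?mul0r//.
by apply/negbTE; rewrite eq_sym; exact: ix.
Qed.

Lemma measurable_stop_mask i : mfun (fun x => stop_mask i (idx (side i) x)).
Proof. by apply: measurable_idx; exact: side_gt0. Qed.

Lemma L1_stop_maskM i u : L1 mu u ->
  L1 mu (fun x => stop_mask i (idx (side i) x) * u x).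
Proof.
apply: (@L1M_bounded _ _ _ _ 1); first exact: measurable_stop_mask.
by move=> x; have /andP[w0 w1] := stop_mask01 i (idx (side i) x); rewrite ger0_norm.
Qed.

Lemma sum_I_stop_mask u : L1 mu u ->
  \sum_(i < K.+1) I mu (fun x => stop_mask i (idx (side i) x) * u x) = I mu u.
Proof.
move=> uL; rewrite -I_sum => [|i _]; last exact: L1_stop_maskM.
by apply: eq_I => x; rewrite (sum_stop_mask (fun=> u x)).
Qed.

Lemma sum_I_stop_mask_avg u : L1 mu u -> (forall x, 0 <= u x) ->
  \sum_(i < K.+1) I mu (fun x => stop_mask i (idx (side i) x) * avg (side i) u x)
  = I mu u.
Proof.
move=> uL u0; rewrite -(sum_I_stop_mask uL); apply: eq_bigr => i _.
by apply: (@I_avg _ _ _ _ _ 1) => //; [exact: side_gt0|move=> m; exact: stop_mask01].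
Qed.

(** On a stopping cell of positive level the average exceeds [lam], so the average divided by [lam]
    dominates. Level 0 is left out since it also holds the points without large averages, a set of
    possibly infinite measure. *)
Lemma L1_stop_mask i : (0 < i)%N -> L1 mu (fun x => stop_mask i (idx (side i) x)).
Proof.
move=> i0; apply: (@L1_le _ (lebesgueRn R n) R mu _
    (fun x => lam^-1 * avg (side i) F x)).
- exact: measurable_stop_mask.
- move=> x; have /andP[w0 _] := stop_mask01 i (idx (side i) x).
  rewrite ger0_norm// stop_maskE; case: eqP => [xi|_]/=.
    rewrite mulrC ler_pdivlMr// mul1r ltW// -xi avg_stop_gt//; by rewrite xi.
  by rewrite mulr_ge0 ?invr_ge0 ?(ltW lam_gt0)// avg_ge0//; exact: side_gt0.
- by apply: L1Z; apply: L1_avg => //; exact: side_gt0.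
Qed.

Lemma I_stop_mask_le i : (0 < i)%N ->
  lam * I mu (fun x => stop_mask i (idx (side i) x)) <=
  I mu (fun x => stop_mask i (idx (side i) x) * F x).
Proof.
move=> i0; rewrite -IZ; last exact: L1_stop_mask.
rewrite -(@I_avg _ _ _ _ _ 1)//; last 2 first.
- exact: side_gt0.
- by move=> m; exact: stop_mask01.
apply: I_le => [||x].
- by apply: L1Z; exact: L1_stop_mask.
- by apply: L1_stop_maskM; apply: L1_avg => //; exact: side_gt0.
rewrite stop_maskE mulrC; case: eqP => [xi|_]; last by rewrite !mul0r.
by rewrite !mul1r -xi ltW// avg_stop_gt// xi.
Qed.

End stopping.

Section weak_type.
Context (R : realType) (n : nat) (sigma theta : R).
Hypotheses (n_gt0 : (0 < n)%N) (sigma_gt0 : 0 < sigma) (theta12 : 1 < theta <= 2).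
Notation mu := (@lebesgue_rV R n).
Notation mfun := (measurable_fun [set: lebesgueRn R n]).
Notation side i := (sigma * 2 ^+ i).
Implicit Types (x y : 'rV[R]_n) (m : 'rV[int]_n) (i : nat).
Variables (J : nat) (h : 'I_J -> nat -> 'rV[int]_n -> 'rV[R]_n -> R).
Hypothesis h_atom : forall j i m, atom sigma theta i m (h j i m).
Variables (N : nat) (M : seq 'rV[int]_n).
Hypothesis M_uniq : uniq M.

(** This is the square of a square function, whence [lam ^+ 2] in the level sets. The atoms vary
    with the component [j]. *)
Definition sqfun (u : 'I_J -> 'rV[R]_n -> R) x : R :=
  \sum_(i < N) \sum_(m <- M) \sum_(j < J)
    \1_(star (side i) m) x * I mu (fun z => h j i m z * u j z) ^+ 2.

Let side0 i : 0 < side i. Proof. exact: side_gt0. Qed.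

Lemma L1_sqfun u : L1 mu (sqfun u).
Proof.
apply: L1_sum => i _; apply: L1_sum => m _; apply: L1_sum => j _.
rewrite (_ : (fun x => _) = (fun x => I mu (fun z => h j i m z * u j z) ^+ 2 *
  \1_(star (side i) m) x)); last by apply/funext => x; rewrite mulrC.
by apply: L1Z; exact: L1_star.
Qed.

Lemma sqfun_ge0 u x : 0 <= sqfun u x.
Proof.
apply: sumr_ge0 => i _; apply: sumr_ge0 => m _; apply: sumr_ge0 => j _.
by rewrite mulr_ge0 ?sqr_ge0.
Qed.

Lemma sqfunD_le u v w x : (forall j, L1 mu (v j)) -> (forall j, L1 mu (w j)) ->
  (forall j z, u j z = v j z + w j z) ->
  sqfun u x <= 2 * sqfun v x + 2 * sqfun w x.
Proof.
move=> vL wL uvw; rewrite /sqfun !mulr_sumr -big_split/=; apply: ler_sum => i _.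
rewrite !mulr_sumr -big_split/=; apply: ler_sum => m _.
rewrite !mulr_sumr -big_split/=; apply: ler_sum => j _.
set c := \1_ _ x; have c0 : 0 <= c by [].
have -> : I mu (fun z => h j i m z * u j z) =
   I mu (fun z => h j i m z * v j z) + I mu (fun z => h j i m z * w j z).
  rewrite -ID; [|exact: (L1_mul_atom n_gt0 sigma_gt0 theta12 (h_atom j i m) (vL j))
    |exact: (L1_mul_atom n_gt0 sigma_gt0 theta12 (h_atom j i m) (wL j))].
  by apply: eq_I => z; rewrite uvw mulrDr.
move: (I mu _) (I mu _) => a b.
have : (a + b) ^+ 2 <= 2 * a ^+ 2 + 2 * b ^+ 2.
  rewrite (_ : 2 * a ^+ 2 + 2 * b ^+ 2 = (a + b) ^+ 2 + (a - b) ^+ 2); last by ring.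
  by rewrite lerDl sqr_ge0.
by move=> /(ler_wpM2l c0); lra.
Qed.

(** Integration replaces each indicator by at most [9 ^+ n * side i ^+ n], and [side i ^+ n] is
    precisely the weight in the L^2 bound for atoms. *)
Lemma I_sqfun_le u B : (forall j, L1 mu (u j)) -> (forall j x, `|u j x| <= B) ->
  I mu (sqfun u) <= 9 ^+ n * schur_const n theta * I mu (fun x => l2 u x ^+ 2).
Proof.
move=> uL uB.
have u2L j : L1 mu (fun x => u j x ^+ 2).
  by apply: (@L1M_bounded _ _ _ _ B) => //; exact: L1_measurable (uL j).
have -> : I mu (fun x => l2 u x ^+ 2) = \sum_(j < J) I mu (fun x => u j x ^+ 2).
  by rewrite -I_sum//; apply: eq_I => x; rewrite sqr_l2.
rewrite mulr_sumr.
have sL i m j : L1 mu (fun x => \1_(star (side i) m) x *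
    I mu (fun z => h j i m z * u j z) ^+ 2).
  rewrite (_ : (fun x => _) = (fun x => I mu (fun z => h j i m z * u j z) ^+ 2 *
    \1_(star (side i) m) x)); last by apply/funext => x; rewrite mulrC.
  by apply: L1Z; exact: L1_star.
have -> : I mu (sqfun u) = \sum_(j < J) \sum_(i < N) \sum_(m <- M)
    I mu (\1_(star (side i) m)) * I mu (fun z => h j i m z * u j z) ^+ 2.
  rewrite exchange_big/= /sqfun I_sum; last first.
    by move=> i _; apply: L1_sum => m _; apply: L1_sum.
  apply: eq_bigr => i _; rewrite exchange_big/= I_sum; last first.
    by move=> m _; apply: L1_sum.
  apply: eq_bigr => m _; rewrite I_sum//; apply: eq_bigr => j _.
  rewrite [RHS]mulrC.
  rewrite -(@IZ _ (lebesgueRn R n) R mu _ (\1_(star (side i) m))); last exact: L1_star.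
  by apply: eq_I => x; rewrite mulrC.
apply: ler_sum => j _; rewrite -mulrA.
have := @atoms_L2_bound R n sigma theta n_gt0 sigma_gt0 theta12 (h j)
  (h_atom j) N M M_uniq (u j) B (uL j) (uB j).
have p9 : (0 : R) <= 9 ^+ n by rewrite exprn_ge0.
move=> /(ler_wpM2l p9); apply: le_trans.
rewrite mulr_sumr; apply: ler_sum => i _; rewrite mulr_sumr; apply: ler_sum => m _.
by rewrite [leRHS]mulrA; apply: ler_wpM2r; [exact: sqr_ge0|exact: I_star_le].
Qed.

Variables (f : 'I_J -> 'rV[R]_n -> R) (lam : R) (K : nat).
Hypotheses (fL : forall j, L1 mu (f j)) (lam_gt0 : 0 < lam).
Let F := l2 f.
Hypothesis K_top : side K ^- n * I mu F <= lam.

Let FL : L1 mu F. Proof. exact: L1_l2. Qed.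
Let F0 x : 0 <= F x. Proof. exact: l2_ge0. Qed.

Notation st := (stop sigma F lam K).
Notation mask := (stop_mask sigma F lam K).
Let msk i x : R := mask i (idx (side i) x).

Let mskE i x : msk i x = (st x == i)%:R.
Proof. exact: stop_maskE. Qed.

Let msk01 i x : 0 <= msk i x <= 1.
Proof. exact: stop_mask01. Qed.

(** At level 0 the average over the finest cell is taken even if it is small, so [bad] has mean zero
    on every cell of the stopping partition and no remainder without cancellation is left. *)
Let good j x : R := avg (side (st x)) (f j) x.
Let bad j x : R := f j x - good j x.

Let goodE j x : good j x = \sum_(i < K.+1) msk i x * avg (side i) (f j) x.
Proof.
by rewrite (sum_stop_mask sigma_gt0 FL F0 K_top
  (fun i => avg (side i) (f j) x)).
Qed.

Let L1_good j : L1 mu (good j).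
Proof.
rewrite (_ : good j = fun x => \sum_(i < K.+1) msk i x * avg (side i) (f j) x).
  by apply: L1_sum => i _; apply: L1_stop_maskM => //; exact: L1_avg.
by apply/funext => x; exact: goodE.
Qed.

(** Only one of the two factors is bounded by [2 ^+ n * lam]; the other is kept, and integrates to
    [I mu F] over the stopping partition. *)
Let l2_good_le x : l2 good x ^+ 2 <= 2 ^+ n * lam * avg (side (st x)) F x.
Proof.
rewrite sqr_l2 (le_trans (sum_sqr_avg_le x (side0 _) fL))//.
rewrite expr2 ler_wpM2r//; first exact: avg_ge0.
exact: avg_stop_le.
Qed.

Let good_bound j x : `|good j x| <= 2 ^+ n * lam.
Proof.
apply: (le_trans (avg_abs_le _ (side0 _) (fL j))).
apply: le_trans (avg_stop_le sigma_gt0 FL F0 lam_gt0 K_top x).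
by apply: avg_le => //; [exact/L1_norm_fun|move=> y; exact: abs_le_l2].
Qed.

Lemma I_sqfun_good_le :
  I mu (sqfun good) <= 18 ^+ n * schur_const n theta * lam * I mu F.
Proof.
apply: le_trans (I_sqfun_le L1_good good_bound) _.
have c0 : 0 <= 9 ^+ n * schur_const n theta.
  by rewrite mulr_ge0 ?exprn_ge0//; exact/ltW/schur_const_gt0.
rewrite (_ : _ * lam * _ = 9 ^+ n * schur_const n theta * (2 ^+ n * lam * I mu F)); last first.
  by rewrite (_ : 18 = 9 * 2)//; [rewrite exprMn; ring|rewrite -natrM].
rewrite ler_wpM2l// -[I mu F](sum_I_stop_mask_avg sigma_gt0 FL F0 K_top FL F0).
rewrite -I_sum => [|i _]; last by apply: L1_stop_maskM => //; exact: L1_avg.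
rewrite -IZ; last first.
  by apply: L1_sum => i _; apply: L1_stop_maskM => //; exact: L1_avg.
apply: I_le.
- under eq_fun do rewrite sqr_l2; apply: L1_sum => j _.
  apply: (@L1M_bounded _ (lebesgueRn R n) R mu (2 ^+ n * lam)); last exact: L1_good.
    exact: L1_measurable (L1_good j).
  exact: good_bound.
- apply: L1Z; apply: L1_sum => i _; apply: L1_stop_maskM => //; exact: L1_avg.
move=> x; rewrite (sum_stop_mask sigma_gt0 FL F0 K_top
  (fun i => avg (side i) F x)).
exact: l2_good_le.
Qed.

(* [hole] dominates the indicator of the union of the cubes [3 Q], [Q] stopping. *)
Let shift i (e : {ffun 'I_n -> 'I_7}) : 'rV[R]_n :=
  \row_j (side i * ((e j : nat)%:Z - 3)%:~R).

Let hole x : R := \sum_(i < K.+1 | (0 < i)%N) \sum_(e : {ffun 'I_n -> 'I_7})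
  msk i (x + shift i e).

Let L1_hole_term (i : 'I_K.+1) e : (0 < i)%N -> L1 mu (fun x => msk i (x + shift i e)).
Proof.
move=> i0; apply: (@L1_translate R n (shift i e) (msk i)); first exact: L1_stop_mask.
by move=> x; have /andP[] := msk01 i x.
Qed.

Let L1_hole : L1 mu hole.
Proof. by apply: L1_sum => i i0; apply: L1_sum => e _; exact: L1_hole_term. Qed.

Let hole_ge0 x : 0 <= hole x.
Proof.
by apply: sumr_ge0 => i _; apply: sumr_ge0 => e _; have /andP[] := msk01 i (x + shift i e).
Qed.

(** The [7 ^ n] translates have the same integral, and on stopping cells of positive level [lam] is
    below the average of [F]. *)
Lemma I_hole_le : lam * I mu hole <= 7 ^+ n * I mu F.
Proof.
rewrite I_sum => [|i i0]; last by apply: L1_sum => e _; exact: L1_hole_term.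
rewrite mulr_sumr -[I mu F](sum_I_stop_mask sigma_gt0 FL F0 K_top FL).
rewrite mulr_sumr big_mkcond/=; apply: ler_sum => i _.
have I0 : 0 <= I mu (fun x => mask i (idx (side i) x) * F x).
  by apply: I_ge0 => x; rewrite mulr_ge0//; have /andP[] := msk01 i x.
case: ifPn => [i0|_]; last by rewrite mulr_ge0// exprn_ge0.
rewrite I_sum => [|e _]; last exact: L1_hole_term.
under eq_bigr => e _.
  rewrite (@I_translate R n (shift i e) (msk i)); last 2 first.
  - exact: measurable_stop_mask.
  - by move=> x; have /andP[] := msk01 i x.
  over.
rewrite sumr_const card_ffun !card_ord -[X in lam * X]mulr_natl natrX mulrCA.
rewrite ler_wpM2l ?exprn_ge0//.
exact: I_stop_mask_le.
Qed.

Let hole_ge1 x y i : (0 < i)%N -> (forall j, `|y ord0 j - x ord0 j| <= 3 * side i) ->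
  st y = i -> 1 <= hole x.
Proof.
move=> i0 xy yi.
have iK : (i < K.+1)%N by rewrite ltnS -yi stop_le.
(* The offset between the cells of [x] and [y] has coordinates between -3 and 3, coded by [e] as 0
   to 6. *)
pose d j := idx (side i) y ord0 j - idx (side i) x ord0 j.
have dP j : (`|d j| <= 3%:Z)%R by apply: idx_dist => //; exact: xy.
pose e : {ffun 'I_n -> 'I_7} := [ffun j => inord (absz (d j + 3))].
have eP j : (e j : nat)%:Z - 3 = d j.
  by rewrite ffunE inordK; have := dP j; lia.
have xe : idx (side i) (x + shift i e) = idx (side i) y.
  rewrite /shift (_ : \row_j _ = \row_j (side i * ((\row_k d k) ord0 j)%:~R)).
    rewrite idx_shift//; apply/rowP => j; rewrite !mxE /d !mxE.
    by rewrite addrC subrK.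
  by apply/rowP => j; rewrite !mxE eP.
rewrite /hole (bigD1 (Ordinal iK))//= (bigD1 e)//=.
have -> : msk i (x + shift i e) = 1.
  by rewrite /msk xe -/(msk i y) mskE yi eqxx.
rewrite -addrA lerDl addr_ge0//.
  by apply: sumr_ge0 => e' _; have /andP[] := msk01 i (x + shift i e').
by apply: sumr_ge0 => i' _; apply: sumr_ge0 => e' _; have /andP[] := msk01 i' (x + shift i' e').
Qed.

(** The upper corner represents the cell, which is closed there and open at the lower one. *)
Let rep i m : 'rV[R]_n := \row_j (side i * ((m ord0 j)%:~R + 1)).

Let idx_rep i m : idx (side i) (rep i m) = m.
Proof.
apply/idxP => // j; rewrite mxE lexx andbT ltr_pM2l//.
by rewrite ltrDl.
Qed.

(** Depends on the cell rather than on the point, so that it can serve as a weight against [avg]. *)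
Let meets i' m' i m : R :=
  (`[< exists2 x, idx (side i) x = m & star (side i') m' x >])%:R.

Let meets01 i' m' i m : 0 <= meets i' m' i m <= 1.
Proof. by rewrite /meets; case: asbool; rewrite /= !lexx ler01. Qed.

Let meets_le i' m' i x : (i <= i')%N ->
  meets i' m' i (idx (side i) x) <=
  \1_(cube (corner (side i') m') (4%:R * side i')) x.
Proof.
move=> ii'; rewrite /meets; case: asboolP => [[y yx ys]|_] //=.
rewrite indicE mem_set// => j.
have := idx_close j (side0 i) yx; have := ys j.
have : side i <= side i' by rewrite ler_wpM2l ?(ltW sigma_gt0)// ler_weXn2l// ler1n.
set a := side i; set b := side i'.
by rewrite !ler_distl => h0 /andP[h1 h2] /andP[h3 h4]; apply/andP; split; lra.
Qed.

(** Bound for the oscillation of an atom of level [i'] over a cell of level [i]. *)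
Let osc i' i : R := n%:R * side i' ^- n * (theta ^+ i / theta ^+ i').

Let osc_ge0 i' i : 0 <= osc i' i.
Proof.
have t0 := theta_gt0 theta12.
by rewrite !mulr_ge0 ?expVn_ge0// ?invr_ge0 exprn_ge0// ltW.
Qed.

(** Contribution of the stopping cells of level [i] to the coefficient of [bad j]. *)
Let piece j i' m i : R := I mu (fun z => h j i' m z *
  (msk i z * (f j z - avg (side i) (f j) z))).

Let L1_sub_avg j i : L1 mu (fun z => f j z - avg (side i) (f j) z).
Proof. by apply: L1B => //; exact: L1_avg. Qed.

Let L1_mskM i u : L1 mu u -> L1 mu (fun x => msk i x * u x).
Proof. exact: L1_stop_maskM. Qed.

(* Subtracting from the atom its value at one point of each cell is harmless,
   since [f - avg f] has mean zero on the cells. *)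
Lemma piece_le j i' m i : (i <= i')%N ->
  `|piece j i' m i| <= 2 * osc i' i *
    I mu (fun z => msk i z * meets i' m i (idx (side i) z) * `|f j z|).
Proof.
move=> ii'; have ha := h_atom j i' m; have [mh hs _ hm] := ha.
pose b := (8 * n)%:R * side i' ^- n.
have hb z : `|h j i' m z| <= b := atom_bound n_gt0 sigma_gt0 theta12 z ha.
pose hr k := h j i' m (rep i k).
pose w z := meets i' m i (idx (side i) z).
pose d z := f j z - avg (side i) (f j) z.
have dL : L1 mu d := L1_sub_avg j i.
have mhr : mfun (fun z => hr (idx (side i) z)) by exact: measurable_idx.
have htL : L1 mu (fun z => hr (idx (side i) z) * (msk i z * d z)).
  apply: (@L1M_bounded _ (lebesgueRn R n) R mu b) => // [z|]; first exact: hb.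
  exact: L1_mskM.
have hL : L1 mu (fun z => h j i' m z * (msk i z * d z)).
  by apply: (@L1M_bounded _ (lebesgueRn R n) R mu b) => //; exact: L1_mskM.
have ht0 : I mu (fun z => hr (idx (side i) z) * (msk i z * d z)) = 0.
  rewrite (@eq_I _ (lebesgueRn R n) _ mu _
    (fun z => (hr (idx (side i) z) * mask i (idx (side i) z)) * d z)); last first.
    by move=> z; rewrite mulrA.
  apply: (@I_sub_avg R n (side i) (f j) (fun k => hr k * mask i k) b) => // k.
  have /andP[k0 k1] := @stop_mask01 R n sigma F lam K i k.
  rewrite normrM (ger0_norm k0) -[leRHS]mulr1 ler_pM//; exact: hb.
have wL u : L1 mu u -> L1 mu (fun z => msk i z * w z * u z).
  move=> uL; apply: (@L1M_bounded _ (lebesgueRn R n) R mu 1); last exact: uL.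
    apply: measurable_funM; first exact: measurable_stop_mask.
    exact: measurable_idx.
  move=> z; have /andP[k0 k1] := msk01 i z.
  have /andP[w0 w1] := meets01 i' m i (idx (side i) z).
  by rewrite ger0_norm ?mulr_ge0// mulr_ile1.
have nL : L1 mu (fun z => `|f j z|) by exact: L1_norm_fun.
have aL : L1 mu (avg (side i) (fun z => `|f j z|)) by exact: L1_avg.
have sumL : L1 mu (fun z => msk i z * w z * (`|f j z| + avg (side i) (fun z => `|f j z|) z)).
  by apply: wL; exact: L1D.
rewrite /piece -[I mu _]subr0 -ht0 -IB//.
apply: (@le_trans _ _ (I mu (fun z => osc i' i *
    (msk i z * w z * (`|f j z| + avg (side i) (fun z => `|f j z|) z))))).
  apply: I_abs_le => [||z]; [exact: L1B|exact: L1Z|].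
  rewrite -mulrBl !normrM (ger0_norm (andP (msk01 i z)).1).
  rewrite (_ : osc i' i * _ = osc i' i * w z * (msk i z *
     (`|f j z| + avg (side i) (fun z0 : lebesgueRn R n => `|f j z0|) z))); last by ring.
  have /andP[k0 k1] := msk01 i z.
  have d_le : `|d z| <= `|f j z| + avg (side i) (fun z => `|f j z|) z.
    by apply: (le_trans (ler_normB _ _)); rewrite lerD2l avg_abs_le.
  apply: ler_pM => //; [by rewrite mulr_ge0| |by rewrite ler_wpM2l].
  (* Where the cell misses the star, the atom vanishes both at [z] and at the representative of the
     cell. *)
  rewrite /w /meets; case: asboolP => [_|nm].
    rewrite mulr1; apply: hm => k; exact: idx_close.
  rewrite mulr0 (hs z) => [|zs]; last by apply: nm; exists z.
  rewrite /hr (hs (rep _ _)) ?subrr ?normr0// => rs.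
  by apply: nm; exists (rep i (idx (side i) z)) => //; exact: idx_rep.
rewrite IZ//.
(* The weight is constant on cells, so the averaged term has the same integral as the other one:
   hence the 2. *)
have E1 : I mu (fun z => msk i z * w z * (`|f j z| + avg (side i) (fun z => `|f j z|) z))
    = 2 * I mu (fun z => msk i z * w z * `|f j z|).
  under eq_I do rewrite mulrDr.
  rewrite ID; [|exact: wL|exact: wL].
  rewrite (@I_avg R n (side i) (fun z => `|f j z|)
    (fun k => mask i k * meets i' m i k) 1)//; last first.
    move=> k; have /andP[k0 k1] := @stop_mask01 R n sigma F lam K i k.
    have /andP[w0 w1] := meets01 i' m i k.
    by rewrite mulr_ge0//= mulr_ile1.
  by rewrite -[X in X + _]mul1r -[X in _ + X]mul1r -mulrDl.
by rewrite E1 mulrCA mulrA.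
Qed.

(** The value is 0 for [i > i'], as such pieces vanish when the star contains a point off the hole.
    The half-side 4 makes room for cells that meet the star without lying in it. *)
Let coef i' m i : R := if (i <= i')%N then 2 * osc i' i *
    I mu (fun z => msk i z * (\1_(cube (corner (side i') m) (4%:R * side i')) z * F z))
  else 0.

Let L1_coef i' m i :
  L1 mu (fun z => msk i z * (\1_(cube (corner (side i') m) (4%:R * side i')) z * F z)).
Proof. by apply: L1_mskM; apply: L1_indic => //; exact: measurable_cube. Qed.

Let coef_ge0 i' m i : 0 <= coef i' m i.
Proof.
rewrite /coef; case: ifP => // _; apply: mulr_ge0; first by rewrite mulr_ge0.
apply: I_ge0 => z; by have /andP[k0 _] := msk01 i z; rewrite !mulr_ge0.
Qed.

(** Minkowski's integral inequality carries the l^2 sum over [j] under the integral, where it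
    becomes [F]. *)
Lemma sum_sqr_piece_le i' m i : (i <= i')%N ->
  \sum_(j < J) piece j i' m i ^+ 2 <= coef i' m i ^+ 2.
Proof.
move=> ii'; pose w z := msk i z * meets i' m i (idx (side i) z).
have w01 z : 0 <= w z <= 1.
  have /andP[k0 k1] := msk01 i z.
  have /andP[w0 w1] := meets01 i' m i (idx (side i) z).
  by rewrite mulr_ge0//= mulr_ile1.
have mw : mfun w.
  by apply: measurable_funM; [exact: measurable_stop_mask|exact: measurable_idx].
have nL j : L1 mu (fun z => `|f j z|) by exact: L1_norm_fun.
apply: (@le_trans _ _ (\sum_(j < J) (2 * osc i' i) ^+ 2 *
    I mu (fun z => w z * `|f j z|) ^+ 2)).
  apply: ler_sum => j _; rewrite -exprMn -[leLHS]real_normK ?num_real//.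
  rewrite ler_pXn2r ?nnegrE ?piece_le//.
  apply: mulr_ge0; first by rewrite mulr_ge0.
  by apply: I_ge0 => z; have /andP[w0 _] := w01 z; rewrite mulr_ge0.
rewrite -mulr_sumr /coef ii' [leRHS]exprMn; apply: ler_wpM2l; first exact: sqr_ge0.
apply: le_trans (minkowski nL mw w01) _.
have lF z : l2 (fun j z => `|f j z|) z = F z.
  by rewrite /l2; under eq_bigr do rewrite real_normK ?num_real//.
have wL : L1 mu (fun z => w z * F z).
  apply: (@L1M_bounded _ (lebesgueRn R n) R mu 1) => // z.
  by have /andP[w0 w1] := w01 z; rewrite ger0_norm.
rewrite (@eq_I _ (lebesgueRn R n) _ mu _ (fun z => w z * F z)); last first.
  by move=> z; rewrite lF.
have w0F z : 0 <= w z * F z by have /andP[w0 _] := w01 z; rewrite mulr_ge0.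
have le1 : I mu (fun z => w z * F z) <=
  I mu (fun z => msk i z * (\1_(cube (corner (side i') m) (4%:R * side i')) z * F z)).
  apply: I_le => // z; rewrite [leRHS]mulrA; apply: ler_wpM2r => //.
  by apply: ler_wpM2l; [have /andP[] := msk01 i z|exact: meets_le].
have I0 := I_ge0 mu w0F.
by rewrite ler_pXn2r// nnegrE (le_trans I0).
Qed.

(** Dominates the square root of [sqfun bad] off the hole. It is estimated in L^1, the only space
    where [F] is known to be. *)
Let far x : R := \sum_(i' < N) \sum_(m <- M)
  \1_(star (side i') m) x * \sum_(i < K.+1) coef i' m i.

(** Triangle inequality in l^2 over [J]: the square is expanded and each cross term is handled by
    Cauchy-Schwarz. *)
Lemma sum_sqr_sum_le (L : nat) (c : 'I_L -> R) (p : 'I_J -> 'I_L -> R) :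
  (forall l, 0 <= c l) -> (forall l, \sum_(j < J) p j l ^+ 2 <= c l ^+ 2) ->
  \sum_(j < J) (\sum_(l < L) p j l) ^+ 2 <= (\sum_(l < L) c l) ^+ 2.
Proof.
move=> c0 pc; rewrite expr2 mulr_suml.
rewrite (_ : \sum_(j < J) _ = \sum_(l < L) \sum_(k < L) \sum_(j < J) p j l * p j k).
  apply: ler_sum => l _; rewrite mulr_sumr; apply: ler_sum => k _.
  exact: cauchy_schwarz_sum.
under [RHS]eq_bigr do rewrite exchange_big/=.
rewrite [RHS]exchange_big/=; apply: eq_bigr => j _.
by rewrite expr2 mulr_suml; apply: eq_bigr => l _; rewrite mulr_sumr.
Qed.

Lemma sum_sqr_le_sqr_sum (X : Type) (s : seq X) (a : X -> R) :
  (forall q, 0 <= a q) -> \sum_(q <- s) a q ^+ 2 <= (\sum_(q <- s) a q) ^+ 2.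
Proof.
move=> a0; elim: s => [|q s IH]; first by rewrite !big_nil expr0n.
rewrite !big_cons sqrrD -addrA lerD2l (le_trans IH)// lerDr.
by rewrite mulrn_wge0// mulr_ge0// sumr_ge0.
Qed.

Let L1_bad j : L1 mu (bad j).
Proof. exact: L1B. Qed.

(** Let [x] be in the star of the atom. A stopping cell of level [i > i'] cannot contain a point [z]
    of that star: the coordinates of [x] and [z] differ by at most [6 * side i' <= 3 * side i],
    which would put [x] in the hole. The sums over scales and positions are then bounded in l^1
    instead of l^2. *)
Lemma sqfun_bad_le x : hole x < 1 -> sqfun bad x <= far x ^+ 2.
Proof.
move=> hx.
pose C i' m := \sum_(i < K.+1) coef i' m i.
have C0 i' m : 0 <= C i' m by apply: sumr_ge0 => i _; exact: coef_ge0.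
have H i' m : \sum_(j < J) \1_(star (side i') m) x *
    I mu (fun z => h j i' m z * bad j z) ^+ 2 <=
    (\1_(star (side i') m) x * C i' m) ^+ 2.
  rewrite -mulr_sumr indicE; case: (boolP (x \in star (side i') m)); last first.
    by move=> _; rewrite !mul0r expr0n.
  rewrite inE => xs; rewrite !mul1r.
  have -> : \sum_(j < J) I mu (fun z => h j i' m z * bad j z) ^+ 2 =
      \sum_(j < J) (\sum_(i < K.+1) piece j i' m i) ^+ 2.
    apply: eq_bigr => j _; congr (_ ^+ 2).
    rewrite /piece -I_sum => [|i _]; last first.
      apply: (L1_mul_atom n_gt0 sigma_gt0 theta12 (h_atom j i' m)).
      exact/L1_mskM/L1_sub_avg.
    apply: eq_I => z; rewrite -mulr_sumr; congr (_ * _).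
    by rewrite (sum_stop_mask sigma_gt0 FL F0 K_top
      (fun i => f j z - avg (side i) (f j) z)).
  apply: sum_sqr_sum_le => i; first exact: coef_ge0.
  have [ii'|ii'] := leqP i i'; first exact: sum_sqr_piece_le.
  have i0 : (0 < i)%N by apply: leq_ltn_trans ii'.
  rewrite big1 ?sqr_ge0// => j _.
  have [_ hs _ _] := h_atom j i' m.
  rewrite /piece (@eq_I _ (lebesgueRn R n) _ mu _ (fun=> 0)) ?I0 ?expr0n//.
  move=> z; rewrite mskE; case: eqP => [zi|_]; last by rewrite mul0r mulr0.
  have [zs|/hs->] := pselect (star (side i') m z); last by rewrite mul0r.
  exfalso; move: hx; rewrite ltNge => /negP; apply.
  apply: (hole_ge1 i0 _ zi) => k.
  have := zs k; have := xs k.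
  have : 2 * side i' <= side i.
    rewrite mulrCA -exprS ler_wpM2l ?(ltW sigma_gt0)//.
    by rewrite ler_weXn2l ?ler1n.
  set a := side i; set b' := side i'.
  by rewrite !ler_distl => h0 /andP[h1 h2] /andP[h3 h4]; apply/andP; split; lra.
have a0 i' m : 0 <= \1_(star (side i') m) x * C i' m by rewrite mulr_ge0.
apply: (@le_trans _ _ (\sum_(i' < N) \sum_(m <- M)
    (\1_(star (side i') m) x * C i' m) ^+ 2)).
  by apply: ler_sum => i' _; apply: ler_sum => m _; exact: H.
apply: le_trans (sum_sqr_le_sqr_sum _ _); last first.
  by move=> i'; apply: sumr_ge0 => m _; exact: a0.
apply: ler_sum => i' _; apply: sum_sqr_le_sqr_sum => m; exact: a0.
Qed.

Let L1_far : L1 mu far.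
Proof.
apply: L1_sum => i' _; apply: L1_sum => m _.
rewrite (_ : (fun x => _) = (fun x => (\sum_(i < K.+1) coef i' m i) *
  \1_(star (side i') m) x)); last by apply/funext => x; rewrite mulrC.
by apply: L1Z; exact: L1_star.
Qed.

Let far_ge0 x : 0 <= far x.
Proof.
apply: sumr_ge0 => i' _; apply: sumr_ge0 => m _.
by rewrite mulr_ge0// sumr_ge0// => i _; exact: coef_ge0.
Qed.

(** For fixed [i] the sum over [i'] is geometric, cancellation gaining a factor [theta^-1] per
    level. The 90 is 9 * 10: the measure of a star and the overlap of the cubes of half-side 4. *)
Lemma I_far_le :
  I mu far <= (2 * n * 90 ^ n)%:R * (2 / (1 - theta^-1)) * I mu F.
Proof.
have r01 := theta_inv01 theta12; have /andP[r0 r1] := r01.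
have t0 := theta_gt0 theta12.
pose r := theta^-1.
pose Z i' i m := I mu (fun z => msk i z *
  (\1_(cube (corner (side i') m) (4%:R * side i')) z * F z)).
have Z0 i' i m : 0 <= Z i' i m.
  by apply: I_ge0 => z; have /andP[k0 _] := msk01 i z; rewrite !mulr_ge0.
have Z_sum i' i : \sum_(m <- M) Z i' i m <= (10 ^ n)%:R * I mu (fun z => msk i z * F z).
  rewrite -I_sum => [|m _]; last exact: L1_coef.
  rewrite -IZ; last exact: L1_mskM.
  apply: I_le => [||z]; [by apply: L1_sum => m _; exact: L1_coef|exact/L1Z/L1_mskM|].
  have /andP[k0 _] := msk01 i z.
  rewrite -mulr_sumr -mulr_suml [leRHS]mulrCA; apply: ler_wpM2l => //.
  apply: ler_wpM2r => //.
  exact: (@cubes_overlap R n (side i') M 4 z (side0 i') M_uniq).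
have coef_le i' i m : coef i' m i <=
    2 * n%:R * side i' ^- n * r ^+ ((i' - i) + (i - i')) * Z i' i m.
  rewrite /coef; case: ifPn => [ii'|_]; last first.
    by rewrite !mulr_ge0 ?expVn_ge0 ?exprn_ge0.
  apply: ler_wpM2r; [exact: Z0|rewrite /osc].
  have /eqP -> : (i - i' == 0)%N by rewrite subn_eq0.
  have -> : theta ^+ i / theta ^+ i' = r ^+ (i' - i).
    by rewrite exprVn expfB_cond ?gt_eqF ?invf_div.
  by rewrite addn0 !mulrA.
have step i' : I mu (fun x => \sum_(m <- M) \1_(star (side i') m) x *
      \sum_(i < K.+1) coef i' m i) <=
    \sum_(i < K.+1) (2 * n * 90 ^ n)%:R * r ^+ ((i' - i) + (i - i')) *
      I mu (fun z => msk i z * F z).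
  have starL m : L1 mu (fun x => \1_(star (side i') m) x *
      \sum_(i < K.+1) coef i' m i).
    rewrite (_ : (fun x => _) = (fun x => (\sum_(i < K.+1) coef i' m i) *
      \1_(star (side i') m) x)); last by apply/funext => x; rewrite mulrC.
    by apply: L1Z; exact: L1_star.
  rewrite I_sum//.
  apply: (@le_trans _ _ (\sum_(m <- M) \sum_(i < K.+1)
     (2 * n * 9 ^ n)%:R * r ^+ ((i' - i) + (i - i')) * Z i' i m)).
    apply: ler_sum => m _.
    rewrite (@eq_I _ (lebesgueRn R n) _ mu _ (fun x => (\sum_(i < K.+1) coef i' m i) *
      \1_(star (side i') m) x)); last by move=> x; rewrite mulrC.
    rewrite IZ; last exact: L1_star.
    rewrite mulr_suml; apply: ler_sum => i _.
    have sp := side0 i'.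
    apply: (@le_trans _ _ ((2 * n%:R * side i' ^- n * r ^+ ((i' - i) + (i - i')) * Z i' i m)
       * (9 ^+ n * side i' ^+ n))).
      by rewrite ler_pM ?coef_le ?coef_ge0 ?I_star_le// I_ge0.
    rewrite le_eqVlt; apply/orP; left; apply/eqP.
    rewrite !natrM natrX; set rr := r ^+ _; set zz := Z _ _ _; field.
    by rewrite expf_neq0// gt_eqF.
  rewrite exchange_big/=; apply: ler_sum => i _.
  rewrite -mulr_sumr.
  have p0 : 0 <= (2 * n * 9 ^ n)%:R * r ^+ ((i' - i) + (i - i')).
    by rewrite mulr_ge0// exprn_ge0.
  apply: le_trans (ler_wpM2l p0 (Z_sum i' i)) _.
  rewrite le_eqVlt; apply/orP; left; apply/eqP.
  by rewrite (_ : 90 = 9 * 10)%N// expnMn !natrM; ring.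
rewrite I_sum => [|i' _]; last first.
  apply: L1_sum => m _.
  rewrite (_ : (fun x => _) = (fun x => (\sum_(i < K.+1) coef i' m i) *
    \1_(star (side i') m) x)); last by apply/funext => x; rewrite mulrC.
  by apply: L1Z; exact: L1_star.
apply: (@le_trans _ _ (\sum_(i' < N) \sum_(i < K.+1)
    (2 * n * 90 ^ n)%:R * r ^+ ((i' - i) + (i - i')) *
      I mu (fun z => msk i z * F z))).
  by apply: ler_sum => i' _; exact: step.
rewrite exchange_big/= -[I mu F](sum_I_stop_mask sigma_gt0 FL F0 K_top FL).
rewrite mulr_sumr; apply: ler_sum => i _.
rewrite -mulr_suml ler_wpM2r//.
  by apply: I_ge0 => z; rewrite mulr_ge0//; have /andP[] := msk01 i z.
rewrite -mulr_sumr ler_wpM2l//.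
under eq_bigr do rewrite addnC.
exact: sum_geometric_dist_le.
Qed.

(** One summand each for the good part, the hole and the far part. *)
Definition weak_const : R := 4 * 18 ^+ n * schur_const n theta + 7 ^+ n +
  2 * ((2 * n * 90 ^ n)%:R * (2 / (1 - theta^-1))).

(** A single Markov inequality for [Phi], which is at least [lam] on the level set. Off the hole,
    [lam ^+ 2] is less than [2 * sqfun good x + 2 * far x ^+ 2], so either [4 * sqfun good x]
    reaches [lam ^+ 2] or [2 * far x] reaches [lam]. *)
Lemma weak_type_stop :
  (lam%:E * mu [set x | (lam ^+ 2 < sqfun f x)%R] <= (weak_const * I mu F)%R%:E)%E.
Proof.
pose Phi x := 4 / lam * sqfun good x + (lam * hole x + 2 * far x).
have PhiL : L1 mu Phi.
  by apply: L1D; [exact/L1Z/L1_sqfun|apply: L1D; exact: L1Z].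
have Phi0 x : 0 <= Phi x.
  by rewrite /Phi !addr_ge0// mulr_ge0// ?divr_ge0 ?(ltW lam_gt0)// sqfun_ge0.
have IPhi : I mu Phi <= weak_const * I mu F.
  rewrite /Phi ID; [|exact/L1Z/L1_sqfun|by apply: L1D; exact: L1Z].
  rewrite ID; [|exact: L1Z|exact: L1Z].
  rewrite !IZ//; last exact: L1_sqfun.
  rewrite (_ : weak_const * _ = 4 * 18 ^+ n * schur_const n theta * I mu F +
    (7 ^+ n * I mu F + 2 * ((2 * n * 90 ^ n)%:R * (2 / (1 - theta^-1)) * I mu F))); last first.
    rewrite /weak_const; move: (schur_const _ _) (_%:R * _) (I mu F) => c1 c2 c3.
    by ring.
  apply: lerD.
    have l0 : 0 <= 4 / lam by rewrite divr_ge0// ltW.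
    apply: (le_trans (ler_wpM2l l0 I_sqfun_good_le)).
    rewrite le_eqVlt; apply/orP; left; apply/eqP; field.
    by rewrite gt_eqF.
  apply: lerD; first exact: I_hole_le.
  by apply: ler_wpM2l => //; exact: I_far_le.
apply: (@le_trans _ _ (I mu Phi)%:E); last by rewrite lee_fin.
apply: markov => //; first exact: ltW.
- rewrite -[X in measurable X]setTI.
  rewrite (_ : [set x | _] = sqfun f @^-1` `]lam ^+ 2, +oo[); last first.
    by apply/seteqP; split=> x /=; rewrite in_itv/= andbT.
  by apply: (L1_measurable (L1_sqfun f)) => //; exact: measurable_itv.
move=> x /= xlam; rewrite /Phi.
have g0 := sqfun_ge0 good x; have fr0 := far_ge0 x; have hl0 := hole_ge0 x.
have lg0 : 0 <= 4 / lam * sqfun good x by rewrite mulr_ge0 ?divr_ge0 ?(ltW lam_gt0).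
have lh0 : 0 <= lam * hole x by rewrite mulr_ge0 ?(ltW lam_gt0).
have [hx|hx] := leP 1 (hole x).
  have : lam <= lam * hole x by rewrite ler_peMr// ltW.
  by move: lg0 fr0; set G := _ * sqfun _ _; set V := far x; lra.
have := sqfunD_le x L1_good L1_bad (fun j z => esym (subrKC (good j z) (f j z))).
have := sqfun_bad_le hx.
move: g0 fr0 lg0 lh0 xlam; set G := sqfun good x; set B := sqfun bad x.
set S := sqfun f x; set V := far x; set H := lam * hole x => G0 V0 lG0 lh0 lS BV SGB.
have [GL|GL] := leP (lam ^+ 2) (4 * G).
  have : lam <= 4 / lam * G by rewrite mulrAC ler_pdivlMr// -expr2.
  by move: lh0 V0; lra.
suff : lam <= 2 * V by move: lG0 lh0; lra.
rewrite leNgt; apply/negP => VL.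
have : (2 * V) ^+ 2 < lam ^+ 2 by rewrite ltr_pXn2r// nnegrE ?mulr_ge0// ltW.
by rewrite exprMn -natrX; move: lS BV SGB GL; lra.
Qed.

End weak_type.

Lemma weak_const_ge0 (R : realType) (n : nat) (theta : R) : (0 < n)%N ->
  1 < theta <= 2 -> 0 <= weak_const n theta.
Proof.
move=> n0 th; have /andP[_ t1] := theta_inv01 th.
have t2 : 0 <= 2 / (1 - theta^-1) by rewrite divr_ge0// subr_ge0 ltW.
rewrite /weak_const; move: t2 (ltW (schur_const_gt0 n0 th)).
move: (2 / _) (schur_const _ _) => a b a0 b0.
by rewrite !addr_ge0// !mulr_ge0// exprn_ge0.
Qed.

Theorem weak_type_sqfun (R : realType) (n : nat) (sigma theta : R)
    (J N : nat) (h : 'I_J -> nat -> 'rV[int]_n -> 'rV[R]_n -> R)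
    (M : seq 'rV[int]_n) (f : 'I_J -> 'rV[R]_n -> R) (lam : R) :
  (0 < n)%N -> 0 < sigma -> 1 < theta <= 2 ->
  (forall j i m, atom sigma theta i m (h j i m)) -> uniq M ->
  (forall j, L1 (@lebesgue_rV R n) (f j)) -> 0 < lam ->
  (lam%:E * lebesgue_rV [set x | (lam ^+ 2 < sqfun sigma h N M f x)%R] <=
   (weak_const n theta * I (@lebesgue_rV R n) (l2 f))%R%:E)%E.
Proof.
move=> n0 sigma0 th ha uM fL lam0.
set A := I _ _; have A0 : 0 <= A by apply: I_ge0 => x; exact: l2_ge0.
have sn0 : 0 < sigma ^+ n by rewrite exprn_gt0.
(* The top level is so high that the whole integral, divided by the volume of one cell, is at most
   [lam]; one uses [K <= K * n]. *)
pose K := (Num.truncn (A / (lam * sigma ^+ n))).+1.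
have KA : A / (lam * sigma ^+ n) <= 2 ^+ K.
  have := truncnS_gt (A / (lam * sigma ^+ n)).
  by move=> /ltW/le_trans; apply; rewrite -natrX ler_nat ltnW// ltn_expl.
apply: (@weak_type_stop R n sigma theta n0 sigma0 th J h ha N M uM f lam K fL lam0).
rewrite -/A ler_pdivrMl ?exprn_gt0 ?mulr_gt0 ?exprn_gt0//.
move: KA; rewrite ler_pdivrMr ?mulr_gt0// => /le_trans; apply.
rewrite mulrCA [leRHS]mulrC ler_pM2l// mulrC exprMn ler_pM2l//.
rewrite -exprM ler_weXn2l ?ler1n// leq_pmulr//.
Qed.

(** * Discretization of the square function *)

Section integration.
Local Open Scope ereal_scope.
Context d (T : measurableType d) (R : realType) (mu : {measure set T -> \bar R}).

(* No measurability is assumed: the integral is a supremum over simple functions. *)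
Lemma ge0_le_integralT (f g : T -> \bar R) : (forall x, 0 <= f x) ->
  (forall x, f x <= g x) -> \int[mu]_x f x <= \int[mu]_x g x.
Proof.
move=> f0 fg; have g0 x : 0 <= g x := le_trans (f0 x) (fg x).
rewrite !ge0_integralTE//; apply: ereal_sup_le => _ [h hf <-].
by exists h => // x; exact: le_trans (hf x) (fg x).
Qed.

End integration.

Section holder.
Context (R : realType) (n : nat).
Notation mu := (@lebesgue_rV R n).
Notation mfun := (measurable_fun [set: lebesgueRn R n]).
Implicit Types (x y : 'rV[R]_n) (phi : 'rV[R]_n -> R).

Lemma enormZ (a : R) x : enorm (a *: x) = `|a| * enorm x.
Proof.
rewrite /enorm -sqrtr_sqr -sqrtrM ?sqr_ge0// mulr_sumr; congr Num.sqrt.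
by apply: eq_bigr => i _; rewrite mxE exprMn.
Qed.

(** [phi] is the pointwise limit of its samples at the corners of dyadic cells. This supplies the
    measurability that membership in [C_alpha] does not state. *)
Lemma measurable_holder (C alpha : R) phi : 0 <= C -> 0 < alpha ->
  (forall x y, `|phi x - phi y| <= C * enorm (x - y) `^ alpha) -> mfun phi.
Proof.
move=> C0 a0 hphi.
pose s k : R := 2 ^- k.
have s0 k : 0 < s k by rewrite invr_gt0 exprn_gt0.
pose phik k x := phi (corner (s k) (idx (s k) x)).
have close k x : `|phi x - phik k x| <= C * (n%:R * s k) `^ alpha.
  apply: (le_trans (hphi _ _)); rewrite ler_wpM2l//.
  apply: ge0_ler_powR; rewrite ?nnegrE ?enorm_ge0 ?mulr_ge0 ?(ltW (s0 k)) ?(ltW a0)//.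
  apply: enorm_le => i; have /(_ i) := (idxP x (idx (s k) x) (s0 k)).1 erefl.
  rewrite !mxE => /andP[h1 h2]; rewrite ger0_norm; last by rewrite subr_ge0 ltW.
  by move: h2; rewrite mulrDr mulr1; lra.
apply: (@measurable_fun_cvg _ (lebesgueRn R n) R setT phik phi).
  move=> k; exact: (@measurable_idx R n (s k) _ _ (fun m => phi (corner (s k) m))).
move=> x _; apply/cvgrPdist_le => e e0.
have : C * (n%:R * s k) `^ alpha @[k --> \oo] --> (0 : R).
  rewrite -(mulr0 (C * n%:R `^ alpha)).
  have E k : C * (n%:R * s k) `^ alpha = C * n%:R `^ alpha * (2 `^ alpha)^-1 ^+ k.
    rewrite powRM ?(ltW (s0 k))// -mulrA /s -powR_invn// powRAC powR_invn ?powR_ge0//.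
    by rewrite exprVn.
  under eq_fun do rewrite E.
  apply: cvgMr; apply: cvg_expr.
  rewrite ger0_norm ?invr_ge0 ?powR_ge0// invf_lt1 ?powR_gt0//.
  by have := @gt0_ltr_powR R alpha a0 1 2; rewrite powR1; apply; rewrite ?nnegrE// ltr1n.
move=> /cvgrPdist_le/(_ e e0); apply: filterS => k.
rewrite sub0r normrN ger0_norm ?mulr_ge0 ?powR_ge0//.
exact: le_trans (close k x).
Qed.

Lemma L1_affine (a : 'rV[R]_n) (b : R) (u : 'rV[R]_n -> R) : b != 0 ->
  L1 mu u -> L1 mu (fun x => u (a + b *: x)).
Proof.
move=> b0 uL; have mu_ := L1_measurable uL; apply/integrableP; split.
  apply/measurable_EFinP.
  have : mfun (u \o (fun x : 'rV[R]_n => a + b *: x)).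
    apply: (@measurableT_comp _ _ _ (lebesgueRn R n) (lebesgueRn R n) R u).
      exact: mu_.
    exact: measurable_affine.
  by [].
have mn : measurable_fun [set: lebesgueRn R n] (fun x => `|u x|%:E).
  by apply/measurable_EFinP; exact: L1_measurable (L1_norm_fun uL).
have := @integral_affine R n a b (fun x => `|u x|%:E) b0 mn.
rewrite /= => ->; last by move=> x; rewrite lee_fin.
have /integrableP[_ /= uoo] := uL.
by rewrite lte_mul_pinfty// lee_fin invr_ge0 exprn_ge0.
Qed.

Lemma I_affine (a : 'rV[R]_n) (b : R) (u : 'rV[R]_n -> R) : b != 0 ->
  L1 mu u -> I mu (fun x => u (a + b *: x)) = `|b| ^- n * I mu u.
Proof.
move=> b0 uL.
have pos v : L1 mu v -> (forall x, 0 <= v x) ->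
    I mu (fun x => v (a + b *: x)) = `|b| ^- n * I mu v.
  move=> vL v0; apply: EFin_inj; rewrite I_EFin; last exact: L1_affine.
  rewrite EFinM (I_EFin vL); apply: (@integral_affine R n a b (EFin \o v)).
  - exact: b0.
  - by apply/measurable_EFinP; exact: L1_measurable vL.
  - by move=> x; rewrite lee_fin.
have nL : L1 mu (fun x => `|u x|) by exact: L1_norm_fun.
(* A signed [u] is the difference of the nonnegative functions [u + |u|] and [|u|]. *)
have sL : L1 mu (fun x => u x + `|u x|) by exact: L1D.
rewrite (@eq_I _ (lebesgueRn R n) _ mu (fun x => u (a + b *: x))
  (fun x => (u (a + b *: x) + `|u (a + b *: x)|) - `|u (a + b *: x)|)); last first.
  by move=> x; rewrite addrK.
rewrite IB; [|exact: (L1_affine a b0 sL)|exact: (L1_affine a b0 nL)].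
rewrite (pos _ sL) ?(pos _ nL) => //; last first.
  by move=> x; rewrite -lerBlDr sub0r lerNl ler_normr lexx orbT.
by rewrite -mulrBr -IB//; congr (_ * _); apply: eq_I => x; rewrite addrK.
Qed.

End holder.

Section bumps.
Context (R : realType) (n : nat) (alpha : R).
Hypotheses (n_gt0 : (0 < n)%N) (alpha01 : 0 < alpha <= 1).
Notation mu := (@lebesgue_rV R n).
Notation mfun := (measurable_fun [set: lebesgueRn R n]).
Implicit Types (x y z : 'rV[R]_n) (phi : 'rV[R]_n -> R) (s : R).

(** A class attached to the dyadic rectangle alone: by [dilate_bump] it contains
    [z -> phi_t (y - z)] for all [(y, t)] in the rectangle, so one nearly extremal member controls
    them all. *)
Definition bump s m (h : 'rV[R]_n -> R) : Prop :=
  [/\ mfun h, forall x, ~ star s m x -> h x = 0, I mu h = 0 &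
    forall x y, `|h x - h y| <= s ^- n * (enorm (x - y) / s) `^ alpha].

Lemma bump0 s m : 0 < s -> bump s m (fun=> 0).
Proof.
move=> s0; split=> //; first exact: I0.
by move=> x y; rewrite subr0 normr0 mulr_ge0 ?expVn_ge0 ?powR_ge0.
Qed.

(** The Euclidean norm is at most [n] times the sup norm, and [n] to the power [alpha] is at most
    [n]: this is the factor [n] in [atom]. *)
Lemma bump_atom (sigma s : R) i m h : 0 < sigma -> s = sigma * 2 ^+ i ->
  bump s m h -> atom sigma (2 `^ alpha) i m h.
Proof.
have /andP[a0 a1] := alpha01.
move=> sigma0 -> [mh hs h0 hm]; split=> // i' x y xy.
apply: (le_trans (hm x y)); rewrite [n%:R * _]mulrC -mulrA.
rewrite ler_wpM2l ?expVn_ge0 ?mulr_gt0 ?exprn_gt0//.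
have n1 : (1 : R) <= n%:R by rewrite ler1n.
have e2 : enorm (x - y) <= n%:R * (sigma * 2 ^+ i').
  by apply: enorm_le => j; rewrite !mxE; exact: xy.
apply: (@le_trans _ _ ((n%:R * (2 ^+ i' / 2 ^+ i)) `^ alpha)).
  apply: ge0_ler_powR; rewrite ?nnegrE ?(ltW a0)//.
  - by rewrite divr_ge0 ?enorm_ge0// mulr_ge0 ?(ltW sigma0) ?exprn_ge0.
  - rewrite ler_pdivrMr ?mulr_gt0 ?exprn_gt0//.
    apply: (le_trans e2); rewrite le_eqVlt; apply/orP; left; apply/eqP; field.
    by rewrite expf_neq0.
rewrite powRM ?divr_ge0 ?exprn_ge0//; apply: ler_pM; rewrite ?powR_ge0//.
  exact: ler1_powR.
have pow2 k : (2 ^+ k : R) `^ alpha = (2 `^ alpha) ^+ k.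
  by rewrite -(powR_mulrn k (ler0n R 2)) -(powR_mulrn k (powR_ge0 2 alpha)) powRAC.
rewrite ler_pdivlMr ?exprn_gt0 ?powR_gt0// -!pow2 -powRM ?divr_ge0 ?exprn_ge0//.
by rewrite divfK ?expf_neq0.
Qed.

Lemma C_alpha_measurable phi : C_alpha alpha phi -> mfun phi.
Proof.
have /andP[a0 a1] := alpha01 => -[_ _ hm].
apply: (@measurable_holder R n 1 alpha) => // x y.
by rewrite mul1r; exact: hm.
Qed.

(** As for atoms, the value is compared with the one at a point 3 away in every coordinate, where
    [phi] vanishes. *)
Lemma C_alpha_bounded phi x : C_alpha alpha phi ->
  `|phi x| <= (3 * n)%:R `^ alpha * \1_(cube (0 : 'rV[R]_n) 1) x.
Proof.
have /andP[a0 a1] := alpha01 => -[hs _ hm]; rewrite indicE.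
case: (boolP (x \in _)) => [|]; last first.
  rewrite notin_setE => /existsNP[j /negP]; rewrite -ltNge mxE subr0 => xj.
  by rewrite hs ?normr0 ?mulr0//; exact: lt_le_trans xj (coord_le_enorm x j).
rewrite inE => x1; rewrite mulr1.
pose y : 'rV[R]_n := x + \row_j 3.
have y0 : phi y = 0.
  apply: hs; pose j0 := Ordinal n_gt0.
  apply: lt_le_trans (coord_le_enorm y j0).
  have := x1 j0; rewrite !mxE subr0 ler_norml => /andP[h1 h2].
  by rewrite lt_neqAle; rewrite ger0_norm; lra.
have := hm x y; rewrite y0 subr0 => /le_trans; apply.
apply: ge0_ler_powR; rewrite ?nnegrE ?enorm_ge0 ?(ltW a0)//.
rewrite mulnC natrM; apply: enorm_le => j.
by rewrite !mxE opprD addNKr normrN ger0_norm.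
Qed.

Lemma C_alpha_L1 phi : C_alpha alpha phi -> L1 mu phi.
Proof.
move=> hphi; apply: (@L1_le _ (lebesgueRn R n) R mu _
   (fun x => (3 * n)%:R `^ alpha * \1_(cube (0 : 'rV[R]_n) 1) x)).
- exact: C_alpha_measurable.
- by move=> x; exact: C_alpha_bounded.
- by apply: L1Z; exact: L1_cube.
Qed.

(** [s <= t] gives the modulus of continuity, [t < 2 * s] the support. *)
Lemma dilate_bump phi s t m y : 0 < s -> C_alpha alpha phi -> s <= t < 2 * s ->
  cell s m y -> bump s m (fun z => dilate phi t (y - z)).
Proof.
have /andP[a0 a1] := alpha01 => s0 hphi /andP[st ts] ym.
have t0 : 0 < t := lt_le_trans s0 st.
have phiL := C_alpha_L1 hphi; have [hs h0 hm] := hphi.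
have b0 : - t^-1 != 0 by rewrite oppr_eq0 invr_eq0 gt_eqF.
have E z : dilate phi t (y - z) = t ^- n * phi (t^-1 *: y + (- t^-1) *: z).
  by rewrite /dilate scalerBr scaleNr.
have EL : L1 mu (fun z => phi (t^-1 *: y + (- t^-1) *: z)) by exact: L1_affine.
split.
- under eq_fun do rewrite E.
  by apply: measurable_funM; [exact: measurable_cst|exact: L1_measurable EL].
- move=> z; rewrite starE => /existsNP[j /negP]; rewrite -ltNge => zj.
  rewrite /dilate hs ?mulr0// enormZ gtr0_norm ?invr_gt0//.
  rewrite mulrC ltr_pdivlMr// mul1r.
  apply: lt_le_trans (coord_le_enorm _ j); apply: (lt_le_trans ts).
  rewrite !mxE; move: zj; have /(_ j)/andP[] := (idxP y m s0).1 ym.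
  set c := (m ord0 j)%:~R => h1 h2 h3.
  have := ler_distD (y ord0 j) (z ord0 j) (s * c).
  rewrite [`|z ord0 j - y ord0 j|]distrC.
  have : `|y ord0 j - s * c| <= s by rewrite ler_norml; apply/andP; split; lra.
  by lra.
- rewrite (@eq_I _ (lebesgueRn R n) _ mu _
    (fun z => t ^- n * phi (t^-1 *: y + (- t^-1) *: z)))//.
  rewrite IZ// I_affine//.
  by rewrite /I /Rintegral h0 /= mulr0 mulr0.
- move=> z z'; rewrite /dilate -mulrBr normrM.
  rewrite ger0_norm ?expVn_ge0//; apply: ler_pM => //; first exact: expVn_ge0.
    by rewrite lef_pV2 ?posrE ?exprn_gt0// lerXn2r// nnegrE ltW.
  apply: (le_trans (hm _ _)); apply: ge0_ler_powR; rewrite ?nnegrE ?(ltW a0)//.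
  + exact: enorm_ge0.
  + by rewrite divr_ge0 ?enorm_ge0// ltW.
  rewrite -scalerBr enormZ gtr0_norm ?invr_gt0//.
  have -> : y - z - (y - z') = (-1) *: (z - z').
    by rewrite opprD opprK addrACA subrr add0r scaleN1r opprB addrC.
  rewrite enormZ normrN normr1 mul1r mulrC ler_wpM2l ?enorm_ge0//.
  by rewrite lef_pV2 ?posrE.
Qed.

End bumps.

Section discretization.
Context (R : realType) (n : nat) (alpha : R).
Hypotheses (n_gt0 : (0 < n)%N) (alpha01 : 0 < alpha <= 1).
Notation mu := (@lebesgue_rV R n).
Implicit Types (x y z : 'rV[R]_n) (f : 'rV[R]_n -> R) (s : R) (m : 'rV[int]_n).

Lemma compact_cube (c : 'rV[R]_n) r : compact (cube c r).
Proof.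
rewrite (_ : cube c r = [set v : 'rV[R]_n |
    forall j, `[c ord0 j - r, c ord0 j + r]%classic (v ord0 j)]).
  apply: (@rV_compact _ n (fun j => `[c ord0 j - r, c ord0 j + r]%classic)).
  by move=> j; exact: segment_compact.
by apply/seteqP; split=> x H j; have := H j; rewrite /= in_itv/= ler_distl.
Qed.

Lemma loc_L1 f (A : set 'rV[R]_n) c r : loc_integrable f ->
  measurable (A : set (lebesgueRn R n)) -> A `<=` cube c r ->
  L1 mu (fun x => \1_A x * f x).
Proof.
move=> [mf foo] mA Ac; apply/integrableP; split.
  by apply/measurable_EFinP; apply: measurable_funM => //; exact: measurable_indic.
apply: le_lt_trans (foo _ (@compact_cube c r)).
rewrite [leRHS]integral_mkcond; apply: ge0_le_integralT => // x.
rewrite /= patchE indicE; case: (boolP (x \in A)) => [|_].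
  by rewrite inE => /Ac xc; rewrite mem_set// mul1r.
by rewrite mul0r normr0; case: ifP => _; rewrite lee_fin.
Qed.

Lemma theta_alpha : 1 < (2 : R) `^ alpha <= 2.
Proof.
have /andP[a0 a1] := alpha01; apply/andP; split.
  by have := @gt0_ltr_powR R alpha a0 1 2; rewrite powR1; apply; rewrite ?nnegrE// ltr1n.
by apply: ler1_powR => //; rewrite ler1n.
Qed.

Lemma bump_bound_indic s m h x : 0 < s -> bump alpha s m h ->
  `|h x| <= (8 * n)%:R * s ^- n * \1_(star s m) x.
Proof.
move=> s0 hb; have ss : s = s * 2 ^+ 0 by rewrite expr0 mulr1.
have ha := bump_atom n_gt0 alpha01 s0 ss hb.
by have := atom_bound_indic n_gt0 s0 theta_alpha x ha; rewrite expr0 mulr1.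
Qed.

Lemma loc_L1_star f s m : 0 < s -> loc_integrable f ->
  L1 mu (fun x => \1_(star s m) x * f x).
Proof.
move=> s0 fl; exact: (@loc_L1 f (star s m) _ _ fl (measurable_cube _ _) (fun _ => id)).
Qed.

Lemma loc_L1_bump f s m h : 0 < s -> loc_integrable f -> bump alpha s m h ->
  L1 mu (fun x => h x * f x).
Proof.
move=> s0 fl hb; have [mh _ _ _] := hb; have [mf _] := fl.
apply: (@L1_le _ (lebesgueRn R n) R mu _
  (fun x => (8 * n)%:R * s ^- n * `|\1_(star s m) x * f x|)).
- exact: measurable_funM.
- move=> x; rewrite !normrM mulrA ler_wpM2r// [`|\1_ _ _|]ger0_norm//.
  exact: bump_bound_indic.
- by apply/L1Z/L1_norm_fun; exact: loc_L1_star.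
Qed.

Lemma I_bump_le f s m h : 0 < s -> loc_integrable f -> bump alpha s m h ->
  `|I mu (fun x => h x * f x)| <=
  (8 * n)%:R * s ^- n * I mu (fun x => `|\1_(star s m) x * f x|).
Proof.
move=> s0 fl hb.
have nL : L1 mu (fun x => `|\1_(star s m) x * f x|) by exact/L1_norm_fun/loc_L1_star.
rewrite -IZ//; apply: I_abs_le => [||x].
- exact: loc_L1_bump hb.
- exact: L1Z.
rewrite !normrM mulrA ler_wpM2r// [`|\1_ _ _|]ger0_norm//.
exact: bump_bound_indic.
Qed.

(** The supremum over bumps need not be attained, but some bump exceeds half of it when it is
    positive, and the zero bump serves when it is 0. The factor 2 spares a compactness argument. *)
Lemma extremal_bump f s m : 0 < s -> loc_integrable f ->
  exists h, bump alpha s m h /\ forall h', bump alpha s m h' ->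
    `|I mu (fun x => h' x * f x)| <= 2 * `|I mu (fun x => h x * f x)|.
Proof.
move=> s0 fl.
pose E := [set `|I mu (fun x => h x * f x)| | h in bump alpha s m].
pose B := (8 * n)%:R * s ^- n * I mu (fun x => `|\1_(star s m) x * f x|).
have E0 : E `|I mu (fun x => 0 * f x)|.
  by exists (fun=> 0) => //; exact: bump0.
have supE : has_sup E.
  split; first by eexists; exact: E0.
  by exists B => _ [h hb <-]; exact: I_bump_le.
have E_le h : bump alpha s m h -> `|I mu (fun x => h x * f x)| <= sup E.
  by move=> hb; apply: ub_le_sup; [exact: supE.2|exists h].
have sE0 : 0 <= sup E by exact: le_trans (normr_ge0 _) (E_le _ (bump0 alpha m s0)).
move: sE0; rewrite le_eqVlt => /predU1P[sE0|sE0].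
  exists (fun=> 0); split=> [|h' hb]; first exact: bump0.
  by apply: (le_trans (E_le _ hb)); rewrite -sE0 mulr_ge0.
have [_ [h hb <-] hE] := sup_adherent (divr_gt0 sE0 (ltr0n R 2)) supE.
exists h; split=> // h' hb'; apply: (le_trans (E_le _ hb')).
by move: hE; lra.
Qed.

Lemma A_alpha_le f s m h y t : 0 < s -> loc_integrable f ->
  (forall h', bump alpha s m h' ->
    `|I mu (fun x => h' x * f x)| <= 2 * `|I mu (fun x => h x * f x)|) ->
  cell s m y -> s <= t < 2 * s ->
  (A_alpha alpha f y t <= (2 * `|I mu (fun x => h x * f x)|)%:E)%E.
Proof.
move=> s0 fl hmax ym st; apply: ge_ereal_sup => _ [phi hphi <-].
have hb := dilate_bump n_gt0 alpha01 s0 hphi st ym.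
have hL := loc_L1_bump s0 fl hb.
by rewrite -(I_EFin hL) /= lee_fin hmax.
Qed.

Lemma A_alpha_ge0 f y t : (0 <= A_alpha alpha f y t)%E.
Proof.
have b0 : C_alpha alpha (fun _ : 'rV[R]_n => 0).
  split=> //; first exact: integral0.
  by move=> x x'; rewrite subr0 normr0 powR_ge0.
apply: le_trans (ereal_sup_ubound _); last by exists (fun=> 0).
exact: abse_ge0.
Qed.

Definition scale (k : int) : R := 2 `^ k%:~R.

Lemma scale_gt0 k : 0 < scale k.
Proof. exact: powR_gt0. Qed.

Lemma scaleD k (i : nat) : scale (k + i%:Z) = scale k * 2 ^+ i.
Proof. by rewrite /scale rmorphD/= powRD ?pnatr_eq0 ?implybT// powR_mulrn. Qed.

Lemma dyadic_scale (t : R) : 0 < t -> exists k, scale k <= t < 2 * scale k.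
Proof.
move=> t0; have l2 : 0 < ln (2 : R) by rewrite ln_gt0// ltr1n.
exists (Num.floor (ln t / ln 2)).
have /andP[h1 h2] := floor_itv (ln t / ln (2 : R)).
have two (v : R) : 2 * 2 `^ v = 2 `^ (v + 1) :> R.
  by rewrite powRD ?pnatr_eq0 ?implybT// powRr1// mulrC.
move: h2; rewrite rmorphD/= => h2.
have tE : t = 2 `^ (ln t / ln 2).
  by rewrite /powR pnatr_eq0/= divfK ?gt_eqF// lnK.
rewrite /scale two [X in _ <= X < _]tE; apply/andP; split.
  by apply: ler_powR => //; rewrite ler1n.
by rewrite /powR !pnatr_eq0/= ltr_expR ltr_pM2r.
Qed.

(* An enumeration with gaps of all pairs (exponent of the scale, position). *)
Definition code (p : nat) : option (int * 'rV[int]_n) := pickle_inv p.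

Variables (f : 'rV[R]_n -> R) (h : int -> 'rV[int]_n -> 'rV[R]_n -> R).
Hypothesis f_loc : loc_integrable f.
Hypothesis h_bump : forall k m, bump alpha (scale k) m (h k m).
Hypothesis h_max : forall k m h', bump alpha (scale k) m h' ->
    `|I mu (fun x => h' x * f x)| <= 2 * `|I mu (fun x => h k m x * f x)|.

Definition sq_term x (q : int * 'rV[int]_n) : R :=
  \1_(star (scale q.1) q.2) x * (2 * I mu (fun z => h q.1 q.2 z * f z)) ^+ 2.

Lemma sq_term_ge0 x q : 0 <= sq_term x q.
Proof. by rewrite mulr_ge0 ?sqr_ge0. Qed.

Let leb := @lebesgue_measure R.
Let nu := (mu \x leb)%E.

Let rect (q : int * 'rV[int]_n) : set (lebesgueRn R n * R) :=
  cell (scale q.1) q.2 `*` `[scale q.1, 2 * scale q.1[.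

Let measurable_rect q : measurable (rect q).
Proof.
by apply: measurableX; [exact: measurable_cell (scale_gt0 _)|exact: measurable_itv].
Qed.

Let nu_rect q : nu (rect q) = (scale q.1 ^+ n.+1)%:E.
Proof.
rewrite /nu /rect product_measure1E//; last exact: measurable_cell (scale_gt0 _).
rewrite [X in (X * _)%E](mu_cell q.2 (scale_gt0 q.1)).
rewrite [X in (_ * X)%E](@lebesgue_measure_itv R `[scale q.1, 2 * scale q.1[).
rewrite /= lte_fin ltr_pMl ?scale_gt0// ltr1n.
by rewrite -EFinB -EFinM exprSr; congr (_ * _)%:E; ring.
Qed.

Lemma sqr_poweR_half (u : \bar R) : (0 <= u -> (u `^ 2^-1) ^+ 2 = u)%E.
Proof.
case: u => [r| |]// u0.
  by rewrite poweR_EFin powR12_sqrt// expe2 -EFinM -expr2 sqr_sqrtr.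
by rewrite poweRyr ?invr_eq0 ?pnatr_eq0// expe2 mulyy.
Qed.

(** On the rectangle of scale [s] the weight is at most [s ^- n.+1], and the measure is [s ^+ n.+1];
    so a rectangle contributes at most one [sq_term]. The cone meets only rectangles whose star
    contains [x]. *)
Lemma S_alpha_sqr_le x :
  (S_alpha alpha f x ^+ 2 <= \sum_(p <oo) (oapp (sq_term x) 0 (code p))%:E)%E.
Proof.
rewrite /S_alpha sqr_poweR_half; last first.
  apply: integral_ge0 => -[y t] /= [t0 _].
  apply: mule_ge0; first by apply: (@expe_ge0 _ _ 2); exact: A_alpha_ge0.
  by rewrite lee_fin invr_ge0 exprn_ge0// ltW.
pose G p (u : lebesgueRn R n * R) : \bar R :=
  (oapp (fun q => sq_term x q * scale q.1 ^- n.+1 * \1_(rect q) u) 0 (code p))%:E.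
have c0 q : 0 <= sq_term x q * scale q.1 ^- n.+1.
  by rewrite mulr_ge0 ?sq_term_ge0 ?expVn_ge0 ?scale_gt0.
have G0 p u : (0 <= G p u)%E.
  by rewrite /G lee_fin; case: (code p) => //= q; rewrite mulr_ge0.
have -> : (\sum_(p <oo) (oapp (sq_term x) 0 (code p))%:E =
    \int[nu]_u \sum_(p <oo) G p u)%E.
  rewrite integral_nneseries//; last first.
    move=> p; apply/measurable_EFinP; rewrite /G; case: (code p) => [q|]//=.
    apply: measurable_funM; first exact: measurable_cst.
    by apply: measurable_indic; exact: measurable_rect.
  apply: eq_eseriesr => p _; rewrite /G; case: (code p) => [q|]/=; last first.
    by rewrite integral0.
  under eq_integral do rewrite EFinM.
  rewrite ge0_integralZl_EFin//; last first.
    by apply/measurable_EFinP/measurable_indic; exact: measurable_rect.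
  rewrite integral_indic//; last exact: measurable_rect.
  rewrite setIT [X in (_ * X)%E]nu_rect -EFinM divfK//.
  by rewrite expf_neq0// gt_eqF// scale_gt0.
rewrite integral_mkcond; apply: ge0_le_integralT.
  move=> [y t]; rewrite patchE; case: ifPn => // /set_mem/= [t0 _].
  apply: mule_ge0; first by apply: (@expe_ge0 _ _ 2); exact: A_alpha_ge0.
  by rewrite lee_fin invr_ge0 exprn_ge0// ltW.
move=> [y t]; rewrite patchE; case: ifPn => [|_]; last exact: nneseries_ge0.
rewrite inE => -[] /= t0 xyt.
have [k /andP[kt tk]] := dyadic_scale t0.
pose m := idx (scale k) y; pose s := scale k.
have s0 : 0 < s := scale_gt0 k.
pose p := pickle (k, m).
(* Of the series at [(y, t)], only the term of the rectangle containing that point is kept. *)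
apply: (@le_trans _ _ (G p (y, t))); last first.
  by rewrite (@nneseriesD1 _ _ p)// leeDl// nneseries_ge0.
rewrite /G /code pickleK_inv /= indicE mem_set; last first.
  by split => //=; rewrite in_itv/= kt.
rewrite mulr1 /sq_term /= indicE mem_set ?mul1r; last first.
  rewrite starE => j.
  have xy : `|x ord0 j - y ord0 j| <= enorm (x - y).
    by have := coord_le_enorm (x - y) j; rewrite !mxE.
  have /(_ j)/andP[] := (idxP y m s0).1 erefl.
  have aux (a b e u v : R) : `|a - b| <= e -> e < u -> u < 2 * s -> s * v < b ->
      b <= s * (v + 1) -> `|a - s * v| <= 3 * s.
    by rewrite !ler_norml => /andP[*]; apply/andP; split; lra.
  by move=> h6 h7; exact: aux xy xyt tk h6 h7.
rewrite EFinM; apply: lee_pmul.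
- by rewrite mule_ge0// A_alpha_ge0.
- by rewrite lee_fin invr_ge0 exprn_ge0// ltW.
- have := @A_alpha_le f s m (h k m) y t s0 f_loc (h_max (m := m)) erefl.
  rewrite kt tk => /(_ isT) AI.
  set u := I _ _ in AI *.
  have -> : (2 * u) ^+ 2 = (2 * `|u|) * (2 * `|u|).
    by rewrite -expr2 !exprMn real_normK ?num_real.
  by rewrite EFinM; apply: lee_pmul => //; exact: A_alpha_ge0.
- by rewrite lee_fin lef_pV2 ?posrE ?exprn_gt0// lerXn2r// nnegrE ltW.
Qed.

End discretization.

(** * Morrey norms *)

Section series.
Context (R : realType).

Lemma doubling_iter (Theta : R -> R) (D r : R) i : doubling Theta D -> 0 <= D ->
  0 < r -> Theta (2 ^+ i * r) <= D ^+ i * Theta r.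
Proof.
move=> dbl D0 r0; elim: i => [|i IH]; first by rewrite !expr0 !mul1r.
rewrite !exprS -!mulrA; apply: (le_trans (dbl _ _)); first by rewrite mulr_gt0.
by rewrite ler_wpM2l.
Qed.

Lemma nneseries_gt (b : nat -> \bar R) (L : \bar R) : (forall j, (0 <= b j)%E) ->
  (L < \sum_(j <oo) b j)%E -> exists J, (L < \sum_(0 <= j < J) b j)%E.
Proof.
move=> b0; apply: contraPP => /forallNP bL; apply/negP; rewrite -leNgt.
apply: lime_le; first by apply: is_cvg_nneseries => j _ _; exact: b0.
by apply: nearW => J; rewrite leNgt; apply/negP/bL.
Qed.

(** A strict lower bound survives truncation; one cutoff serves for both indices, to match
    [partial_sum]. *)
Lemma nneseries2_gt (a : nat -> nat -> R) (L : R) : (forall j p, 0 <= a j p) ->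
  (L%:E < \sum_(j <oo) \sum_(p <oo) (a j p)%:E)%E ->
  exists P, L < \sum_(p < P) \sum_(j < P) a j p.
Proof.
move=> a0 /nneseries_gt[|J]; first by move=> j; apply: nneseries_ge0 => p; rewrite lee_fin.
rewrite -nneseries_sum_nat; last by move=> *; rewrite lee_fin.
move=> /nneseries_gt[|P]; first by move=> p; apply: sume_ge0 => j _; rewrite lee_fin.
under eq_bigr do rewrite sumEFin; rewrite sumEFin lte_fin => LP.
exists (maxn P J); apply: (lt_le_trans LP).
rewrite -(big_mkord xpredT (fun p => \sum_(j < maxn P J) a j p)).
rewrite -[leLHS]addr0 [leRHS](@big_cat_nat _ _ _ P)/= ?leq_maxl//; apply: lerD.
  apply: ler_sum => p _; rewrite -(big_mkord xpredT (fun j => a j p)).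
  rewrite [leRHS](@big_cat_nat _ _ _ J)/= ?leq_maxr// lerDl.
  by apply: sumr_ge0 => j _.
by apply: sumr_ge0 => p _; apply: sumr_ge0.
Qed.

Lemma ler_sum_uniq (T : eqType) (s t : seq T) (F : T -> R) : uniq s -> uniq t ->
  {subset s <= t} -> (forall q, 0 <= F q) -> \sum_(q <- s) F q <= \sum_(q <- t) F q.
Proof.
move=> us ut st F0; rewrite [leRHS](bigID (mem s))/= -[leLHS]addr0; apply: lerD.
  rewrite -[leRHS]big_filter le_eqVlt; apply/orP; left; apply/eqP.
  apply: perm_big; apply: uniq_perm => //; first exact: filter_uniq.
  by move=> q; rewrite mem_filter; case: (boolP (q \in s)) => //= /st ->.
exact: sumr_ge0.
Qed.

Lemma sum_codes_le n (P : nat) (kb : int) : exists N (M : seq 'rV[int]_n), uniq M /\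
  forall F : int * 'rV[int]_n -> R, (forall q, 0 <= F q) ->
    (forall p q, (p < P)%N -> code n p = Some q -> q.1 < kb -> F q = 0) ->
    \sum_(p < P) oapp F 0 (code n p) <=
    \sum_(i < N) \sum_(m <- M) F (kb + i%:Z, m).
Proof.
pose s := pmap (@code n) (iota 0 P).
have us : uniq s.
  by apply: (@pmap_uniq _ _ _ pickle); [exact: pickle_invK|exact: iota_uniq].
pose M := undup [seq q.2 | q <- s].
pose N := (\max_(q <- s) `|q.1 - kb|%N).+1.
exists N, M; split; first exact: undup_uniq.
move=> F F0 Fkb.
have -> : \sum_(p < P) oapp F 0 (code n p) = \sum_(q <- s) F q.
  by rewrite /s big_pmap -(big_mkord xpredT (fun p => oapp F 0 (code n p))) /index_iota subn0.
pose t := [seq (kb + i%:Z, m) | i <- iota 0 N, m <- M].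
have ut : uniq t.
  apply: allpairs_uniq; [exact: iota_uniq|exact: undup_uniq|].
  by move=> [i m] [i' m'] _ _ /= [] /addrI [->] ->.
have -> : \sum_(i < N) \sum_(m <- M) F (kb + i%:Z, m) = \sum_(q <- t) F q.
  rewrite /t big_allpairs_dep/= -(big_mkord xpredT
    (fun i => \sum_(m <- M) F (kb + i%:Z, m))) /index_iota subn0.
  by [].
rewrite (bigID (fun q => kb <= q.1))/= [X in _ + X <= _]big_seq_cond.
rewrite [X in _ + X <= _]big1 ?addr0; last first.
  move=> q /andP[]; rewrite mem_pmap => /mapP[p]; rewrite mem_iota/= add0n => pP pq.
  by rewrite -ltNge; exact: Fkb pP (esym pq).
rewrite -big_filter; apply: ler_sum_uniq => //; first exact: filter_uniq.
move=> q; rewrite mem_filter => /andP[kq qs].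
apply/allpairsP; exists (`|q.1 - kb|%N, q.2); split => /=.
- rewrite -[_ :: _]/(iota 0 N) mem_iota leq0n add0n ltnS.
  exact: (@leq_bigmax_seq _ s xpredT (fun q => `|q.1 - kb|%N)).
- by rewrite mem_undup; exact: map_f.
- by case: q kq qs => k m /= kq qs; congr (_, _); rewrite gez0_abs ?subr_ge0// (addrC kb) subrK.
Qed.

End series.

Section l2_weights.
Context (T : Type) (R : realType) (J : nat).
Implicit Types f : 'I_J -> T -> R.

Lemma l2_indic f (A : set T) x : l2 (fun j y => \1_A y * f j y) x = \1_A x * l2 f x.
Proof.
apply/eqP; rewrite -(@eqrXn2 _ 2)// ?l2_ge0 ?mulr_ge0 ?l2_ge0//.
rewrite exprMn !sqr_l2 mulr_sumr.
by apply/eqP; apply: eq_bigr => j _; rewrite exprMn.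
Qed.

Lemma l2_norm_fun f x : l2 (fun j y => `|f j y|) x = l2 f x.
Proof. by congr Num.sqrt; apply: eq_bigr => j _; rewrite real_normK ?num_real. Qed.

End l2_weights.

Lemma l2_le_l2_norm (T : Type) (R : realType) (J : nat) (f : nat -> T -> R) x :
  ((l2 (fun j : 'I_J => f j) x)%:E <= `|l2_norm (fun j => (f j x)%:E)|)%E.
Proof.
have S0 : (0 <= \sum_(j <oo) `|(f j x)%:E| ^+ 2)%E.
  by apply: nneseries_ge0 => j _ _; apply: (@expe_ge0 _ _ 2).
rewrite gee0_abs ?poweR_ge0// -lee_sqr ?poweR_ge0 ?lee_fin ?l2_ge0//.
rewrite /l2_norm sqr_poweR_half// -EFin_expe sqr_l2 -sumEFin.
apply: le_trans (nneseries_lim_ge J _); last by move=> j _ _; apply: (@expe_ge0 _ _ 2).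
rewrite big_mkord; apply: lee_sum => j _.
by rewrite abse_EFin -EFin_expe real_normK ?num_real.
Qed.

Section morrey.
Context (R : realType) (n : nat) (alpha : R).
Hypotheses (n_gt0 : (0 < n)%N) (alpha01 : 0 < alpha <= 1).
Notation mu := (@lebesgue_rV R n).
Implicit Types (x y z : 'rV[R]_n) (s : R) (m : 'rV[int]_n).
Variables (Theta : R -> R) (D : R).
Hypotheses (hTheta : growth_function Theta) (hD : 1 <= D < 2 ^+ n).
Hypothesis hdbl : doubling Theta D.
Variables (f : nat -> 'rV[R]_n -> R) (Mn : R).
Hypothesis f_loc : forall j, loc_integrable (f j).
Hypothesis hMn : (L1_norm Theta (fun x => l2_norm (fun j => (f j x)%:E)) <= Mn%:E)%E.

Lemma eball_sub_cube (c : 'rV[R]_n) r : eball c r `<=` cube c r.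
Proof.
move=> x xc j; apply: le_trans (ltW xc).
by have := coord_le_enorm (x - c) j; rewrite !mxE.
Qed.

Lemma cube_sub_eball (c : 'rV[R]_n) r d : 0 < r -> n%:R * r < d -> cube c r `<=` eball c d.
Proof.
by move=> r0 rd x xc; apply: le_lt_trans rd; apply: enorm_le => j; rewrite !mxE.
Qed.

Lemma ball_bound J (A : set 'rV[R]_n) c r : 0 < r ->
  measurable (A : set (lebesgueRn R n)) -> A `<=` eball c r ->
  I mu (fun x => \1_A x * l2 (fun j : 'I_J => f j) x) <= Mn * Theta r.
Proof.
move=> r0 mA Ac; have Ac' := subset_trans Ac (@eball_sub_cube c r).
have fL (j : 'I_J) : L1 mu (fun x => \1_A x * f j x) by exact: loc_L1 (f_loc j) mA Ac'.
have lL : L1 mu (fun x => \1_A x * l2 (fun j : 'I_J => f j) x).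
  rewrite (_ : (fun x => _) = l2 (fun (j : 'I_J) x => \1_A x * f j x)).
    exact: L1_l2.
  by apply/funext => x; rewrite l2_indic.
have T0 : 0 < Theta r := hTheta.1 r r0.
rewrite -lee_fin (I_EFin lL) mulrC EFinM -lee_pdivrMl//.
apply: le_trans hMn; apply: le_trans (ereal_sup_ubound _); last by exists (c, r).
rewrite lee_pmul2l ?lte_fin ?invr_gt0// [leRHS]integral_mkcond.
apply: ge0_le_integralT => x; first by rewrite lee_fin mulr_ge0 ?l2_ge0.
rewrite patchE indicE; case: (boolP (x \in A)) => [|_].
  by rewrite inE => /Ac xc; rewrite mem_set// mul1r; exact: l2_le_l2_norm.
by rewrite mul0r; case: ifP => // _; exact: abse_ge0.
Qed.

(** Two points of the star differ by at most [6 * s] in each coordinate, so the star lies in the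
    ball of centre [x] and radius [8 * n * s], to which the Morrey norm is applied. *)
Lemma large_term J s m x (h : 'I_J -> 'rV[R]_n -> R) : 0 < s -> star s m x ->
  (forall j, bump alpha s m (h j)) ->
  \sum_(j < J) (2 * I mu (fun z => h j z * f j z)) ^+ 2 <=
  ((16 * n)%:R * s ^- n * (Mn * Theta (8 * n%:R * s))) ^+ 2.
Proof.
move=> s0 sx hb; have mS := measurable_cube (corner s m) (3 * s).
pose g (j : 'I_J) z := `|\1_(star s m) z * f j z|.
have gL j : L1 mu (g j) by exact/L1_norm_fun/loc_L1_star.
have n0 : (0 : R) < n%:R by rewrite ltr0n.
have ns : n%:R * (6 * s) < 8 * n%:R * s.
  by rewrite mulrA ltr_pM2r// mulrC ltr_pM2r// ltr_nat.
have Sx : star s m `<=` eball x (8 * n%:R * s).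
  apply: subset_trans (cube_sub_eball (mulr_gt0 (ltr0n R 6) s0) ns) => z zs j.
  have aux (a b c : R) : `|a - c| <= 3 * s -> `|b - c| <= 3 * s -> `|a - b| <= 6 * s.
    by rewrite !ler_norml => /andP[? ?] /andP[? ?]; apply/andP; split; lra.
  exact: aux (zs j) (sx j).
have c0 : 0 <= (16 * n)%:R * s ^- n by rewrite mulr_ge0 ?expVn_ge0.
have I0 j : 0 <= I mu (g j) by apply: I_ge0 => z; exact: normr_ge0.
have := @minkowski _ (lebesgueRn R n) R mu J g gL (fun=> 1) 1
  (measurable_cst _) (fun=> introT andP (conj ler01 (lexx _))).
rewrite [X in _ <= X ^+ 2](@eq_I _ (lebesgueRn R n) R mu _
  (fun z => \1_(star s m) z * l2 (fun j : 'I_J => f j) z)); last first.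
  by move=> z; rewrite mul1r /g l2_norm_fun l2_indic.
rewrite (eq_bigr (fun j => I mu (g j) ^+ 2)); last first.
  move=> j _; congr (_ ^+ 2); apply: (@eq_I _ (lebesgueRn R n) R mu) => z.
  by rewrite mul1r.
have bb := @ball_bound J _ _ _ (mulr_gt0 (mulr_gt0 (ltr0n R 8) n0) s0) mS Sx.
move=> mk; apply: (@le_trans _ _ (((16 * n)%:R * s ^- n) ^+ 2 *
    \sum_(j < J) I mu (g j) ^+ 2)).
  rewrite mulr_sumr; apply: ler_sum => j _; rewrite -exprMn.
  rewrite -[leLHS]real_normK ?num_real// ler_pXn2r ?nnegrE ?mulr_ge0 ?expVn_ge0//.
  have : `|I mu (fun z => h j z * f j z)| <= (8 * n)%:R * s ^- n * I mu (g j).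
    exact: I_bump_le (f_loc j) (hb j).
  rewrite normrM (natrM _ 16) (natrM _ 8) [`|2|]ger0_norm//.
  have aux (a b c N : R) : b <= 8 * N * c * a -> 2 * b <= 16 * N * c * a by lra.
  exact: aux.
rewrite (exprMn 2 _ (Mn * _)); apply: ler_wpM2l; first exact: sqr_ge0.
apply: (le_trans mk).
have J0 : 0 <= I mu (fun z => \1_(star s m) z * l2 (fun j : 'I_J => f j) z).
  by apply: I_ge0 => z; rewrite mulr_ge0 ?l2_ge0.
by rewrite ler_pXn2r// nnegrE// (le_trans J0).
Qed.

End morrey.

(** * Large scales *)

Section scales.
Context (R : realType) (n : nat) (alpha : R).
Hypotheses (n_gt0 : (0 < n)%N) (alpha01 : 0 < alpha <= 1).
Implicit Types (x y z : 'rV[R]_n) (s : R) (m : 'rV[int]_n).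
Variables (Theta : R -> R) (D : R).
Hypotheses (hTheta : growth_function Theta) (hD : 1 <= D < 2 ^+ n).
Hypothesis hdbl : doubling Theta D.
Variables (f : nat -> 'rV[R]_n -> R) (Mn : R).
Hypothesis f_loc : forall j, loc_integrable (f j).
Hypothesis hMn : (L1_norm Theta (fun x => l2_norm (fun j => (f j x)%:E)) <= Mn%:E)%E.
Hypothesis Mn0 : 0 <= Mn.
Variable h : nat -> int -> 'rV[int]_n -> 'rV[R]_n -> R.
Hypothesis h_bump : forall j k m, bump alpha (scale R k) m (h j k m).

Let D0 : 0 <= D. Proof. by have /andP[D1 _] := hD; rewrite (le_trans ler01). Qed.

Lemma growth_le k r rho : 0 < r -> 0 < rho -> rho <= 2 ^+ k * r ->
  Theta rho <= D ^+ k * Theta r.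
Proof.
by move=> r0 rho0 rk; apply: le_trans (hTheta.2 _ _ rho0 rk) (doubling_iter k hdbl D0 r0).
Qed.

(** [8 ^ n] bounds the overlap of the stars, [16 * n] comes from twice the size of a bump, [6 ^ n]
    from [s > r / 6] and [D ^+ (n + 2)] from [8 * n * s <= 2^(n + 2) * r], with [s] the smallest
    large scale; the quotient sums the geometric series. *)
Definition large_const : R :=
  (8 ^ n * (16 * n) * 6 ^ n)%:R * D ^+ (n + 2) / (1 - D / 2 ^+ n).

Let q01 : 0 <= D / 2 ^+ n < 1.
Proof.
have /andP[D1 D2] := hD.
by rewrite divr_ge0 ?exprn_ge0//= ltr_pdivrMr ?exprn_gt0// mul1r.
Qed.

Lemma large_const_ge0 : 0 <= large_const.
Proof.
have /andP[q0 q1] := q01.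
by rewrite divr_ge0 ?subr_ge0 ?(ltW q1)// mulr_ge0// exprn_ge0.
Qed.

Lemma large_level s r i : 0 < r -> r / 6 < s <= r / 3 ->
  (16 * n)%:R * (s * 2 ^+ i) ^- n * (Mn * Theta (8 * n%:R * (s * 2 ^+ i))) <=
  (16 * n * 6 ^ n)%:R * D ^+ (n + 2) * (r ^- n * (Theta r * Mn)) * (D / 2 ^+ n) ^+ i.
Proof.
move=> r0 /andP[rs sr]; have r60 : 0 < r / 6 by rewrite divr_gt0.
have s0 : 0 < s := lt_trans r60 rs.
have p0 k : (0 : R) < 2 ^+ k by rewrite exprn_gt0.
have n0 : (0 : R) < n%:R by rewrite ltr0n.
have n2 : (n%:R : R) <= 2 ^+ n by rewrite -natrX ler_nat ltnW// ltn_expl.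
have h1 : Theta (8 * n%:R * (s * 2 ^+ i)) <= D ^+ (i + (n + 2)) * Theta r.
  apply: growth_le => //; first by rewrite !mulr_gt0.
  have -> : 8 * n%:R * (s * 2 ^+ i) = 2 ^+ i * (n%:R * (8 * s)) by ring.
  have -> : 2 ^+ (i + (n + 2)) * r = 2 ^+ i * (2 ^+ n * (4 * r)) by rewrite !exprD; ring.
  rewrite ler_pM2l//; apply: ler_pM => //; rewrite ?mulr_ge0 ?(ltW s0)//.
  by move: sr r0; lra.
have h2 : (s * 2 ^+ i) ^- n <= 6 ^+ n * r ^- n * (2 ^+ n)^-1 ^+ i.
  have -> : 6 ^+ n * r ^- n * (2 ^+ n)^-1 ^+ i = (r / 6 * 2 ^+ i) ^- n.
    rewrite exprMn expr_div_n -!exprM mulnC exprVn -exprM mulnC; field.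
    by rewrite !expf_neq0 ?gt_eqF.
  rewrite lef_pV2 ?posrE ?exprn_gt0 ?mulr_gt0//.
  apply: lerXn2r; first by rewrite nnegrE ltW// mulr_gt0.
    by rewrite nnegrE ltW// mulr_gt0.
  by rewrite ler_pM2r// ltW.
have sn0 : 0 <= (s * 2 ^+ i) ^- n by rewrite expVn_ge0 ?mulr_gt0.
have T0 : 0 <= Theta (8 * n%:R * (s * 2 ^+ i)) by apply/ltW/hTheta.1; rewrite !mulr_gt0.
have h3 := ler_pM sn0 T0 h2 h1.
have c0 : 0 <= (16 * n)%:R * Mn :> R by rewrite mulr_ge0.
have := ler_wpM2l c0 h3.
rewrite (natrM _ (16 * n)) natrX expr_div_n exprD exprVn => h4.
apply: le_trans (le_trans h4 _); rewrite le_eqVlt; apply/orP; left; apply/eqP; ring.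
Qed.

Lemma large_sum J N (M : seq 'rV[int]_n) k r x : 0 < r -> uniq M ->
  r / 6 < scale R k <= r / 3 ->
  \sum_(i < N) \sum_(m <- M) \sum_(j < J) sq_term (f j) (h j) x (k + i%:Z, m) <=
  (large_const * (r ^- n * (Theta r * Mn))) ^+ 2.
Proof.
move=> r0 uM rk; set V := r ^- n * (Theta r * Mn).
have V0 : 0 <= V by rewrite !mulr_ge0 ?expVn_ge0// ltW// hTheta.1.
pose c i := (16 * n)%:R * scale R (k + i%:Z) ^- n *
  (Mn * Theta (8 * n%:R * scale R (k + i%:Z))).
have sc0 i : 0 < scale R i := scale_gt0 R i.
have c0 i : 0 <= c i.
  rewrite !mulr_ge0 ?expVn_ge0//; apply/ltW/hTheta.1.
  by rewrite !mulr_gt0// ltr0n.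
(* The overlap [8 ^ n] is put inside the square, at the price of a second such factor. *)
pose c8 i := (8 ^ n)%:R * c i.
have c80 i : 0 <= c8 i by rewrite mulr_ge0.
apply: (@le_trans _ _ (\sum_(i < N) c8 i ^+ 2)).
  apply: ler_sum => i _.
  apply: (@le_trans _ _ (\sum_(m <- M) \1_(star (scale R (k + i%:Z)) m) x * c i ^+ 2)).
    apply: ler_sum => m _; rewrite /sq_term /= -mulr_sumr indicE.
    case: (boolP (x \in _)) => [|_]; last by rewrite !mul0r.
    rewrite inE => xs; rewrite !mul1r.
    exact: (large_term n_gt0 alpha01 hTheta f_loc hMn).
  rewrite -mulr_suml /c8 [leRHS](exprMn 2 (8 ^ n)%:R (c i)); apply: ler_wpM2r; first exact: sqr_ge0.
  apply: le_trans (cubes_overlap 3 x (sc0 _) uM) _.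
  by rewrite expr2 -natrM ler_nat leq_pmulr// expn_gt0.
apply: (le_trans (sum_sqr_le_sqr_sum _ _)) => //.
rewrite ler_pXn2r ?nnegrE ?sumr_ge0 ?(mulr_ge0 large_const_ge0 V0)//.
apply: (@le_trans _ _ (\sum_(i < N) (8 ^ n * (16 * n) * 6 ^ n)%:R * D ^+ (n + 2) * V *
    (D / 2 ^+ n) ^+ i)).
  apply: ler_sum => i _; rewrite /c8 /c scaleD.
  have e0 : 0 <= (8 ^ n)%:R :> R by [].
  apply: (le_trans (ler_wpM2l e0 (large_level i r0 rk))).
  by rewrite -(mulnA (8 ^ n)%N) (natrM _ (8 ^ n)%N) /V !mulrA.
rewrite -mulr_sumr /large_const [leRHS]mulrAC.
apply: ler_wpM2l; last exact: sum_geometric_le.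
by rewrite mulr_ge0// mulr_ge0// exprn_ge0.
Qed.

End scales.

(** * Small scales *)

Section small_scales.
Context (R : realType) (n : nat) (alpha : R).
Hypotheses (n_gt0 : (0 < n)%N) (alpha01 : 0 < alpha <= 1).
Notation mu := (@lebesgue_rV R n).
Implicit Types (x y z : 'rV[R]_n) (s : R) (m : 'rV[int]_n).
Variables (Theta : R -> R) (D : R).
Hypotheses (hTheta : growth_function Theta) (hD : 1 <= D < 2 ^+ n).
Hypothesis hdbl : doubling Theta D.
Variables (f : nat -> 'rV[R]_n -> R) (Mn : R).
Hypothesis f_loc : forall j, loc_integrable (f j).
Hypothesis hMn : (L1_norm Theta (fun x => l2_norm (fun j => (f j x)%:E)) <= Mn%:E)%E.
Hypothesis Mn0 : 0 <= Mn.
Variable h : nat -> int -> 'rV[int]_n -> 'rV[R]_n -> R.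
Hypothesis h_bump : forall j k m, bump alpha (scale R k) m (h j k m).
Variables (x0 : 'rV[R]_n) (r : R).
Hypothesis r0 : 0 < r.

Definition small_f J (j : 'I_J) x := \1_(cube x0 (2 * r)) x * f j x.

(** Levels above [r / 6] are filled with the zero bump, so that the family still consists of atoms
    at every level. *)
Definition small_h (k : int) J (j : 'I_J) i m : 'rV[R]_n -> R :=
  if scale R (k + i%:Z) <= r / 6 then h j (k + i%:Z) m else fun=> 0.

Let r20 : 0 < 2 * r. Proof. by rewrite mulr_gt0. Qed.

(** For [s <= r / 6] a star through a point of the ball stays in the cube of half-side [2 * r], as
    [3 s + 3 s + r <= 2 r]; truncating [f] changes no coefficient. The 4 is the square of the factor
    2 in [sq_term]. *)
Lemma small_sum J N (M : seq 'rV[int]_n) k x : eball x0 r x ->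
  \sum_(i < N) \sum_(m <- M) (if scale R (k + i%:Z) <= r / 6 then
     \sum_(j < J) sq_term (f j) (h j) x (k + i%:Z, m) else 0) <=
  4 * sqfun (scale R k) (@small_h k J) N M (@small_f J) x.
Proof.
move=> xr; rewrite /sqfun mulr_sumr; apply: ler_sum => i _.
rewrite mulr_sumr; apply: ler_sum => m _; rewrite mulr_sumr.
rewrite -scaleD; set s := scale R (k + i%:Z).
case: ifPn => sr; last first.
  by apply: sumr_ge0 => j _; rewrite mulr_ge0// mulr_ge0// sqr_ge0.
apply: ler_sum => j _; rewrite /sq_term /= -/s indicE.
case: (boolP (x \in _)) => [|_]; last by rewrite !mul0r mulr0.
rewrite inE => xs; rewrite !mul1r exprMn -natrX; apply: ler_wpM2l => //.
rewrite le_eqVlt; apply/orP; left; apply/eqP; congr (_ ^+ 2).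
apply: (@eq_I _ (lebesgueRn R n) R mu) => z; rewrite /small_h sr /small_f indicE.
case: (boolP (z \in _)) => [_|]; first by rewrite mul1r.
rewrite mul0r mulr0 => zA; have [_ hs _ _] := h_bump j (k + i%:Z) m.
rewrite hs ?mul0r// => zs; move/negP: zA; apply; rewrite inE => l.
have aux (a b c e : R) : `|a - c| <= 3 * s -> `|b - c| <= 3 * s -> `|b - e| <= r ->
    `|a - e| <= 2 * r.
  move: sr; rewrite !ler_norml => ? /andP[? ?] /andP[? ?] /andP[? ?].
  by apply/andP; split; lra.
exact: aux (zs l) (xs l) (eball_sub_cube xr l).
Qed.

Lemma small_weak J N (M : seq 'rV[int]_n) k lam : 0 < lam -> uniq M ->
  (lam%:E * mu [set x | (lam ^+ 2 <
     sqfun (scale R k) (@small_h k J) N M (@small_f J) x)%R] <=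
   (weak_const n (2 `^ alpha) * (D ^+ (n + 2) * (Theta r * Mn)))%R%:E)%E.
Proof.
move=> lam0 uM; have n0 : (0 : R) < n%:R by rewrite ltr0n.
have mA := measurable_cube x0 (2 * r).
have fL (j : 'I_J) : L1 mu (small_f j).
  exact: (@loc_L1 R n (f j) (cube x0 (2 * r)) x0 (2 * r) (f_loc j) mA (fun _ => id)).
have hA (j : 'I_J) i m : atom (scale R k) (2 `^ alpha) i m (small_h k j i m).
  apply: (@bump_atom R n alpha n_gt0 alpha01 (scale R k) (scale R (k + i%:Z))).
  - exact: scale_gt0.
  - exact: scaleD.
  - by rewrite /small_h; case: ifP => _ //; apply: bump0; exact: scale_gt0.
apply: le_trans (weak_type_sqfun N n_gt0 (scale_gt0 R k) (theta_alpha alpha01) hA uM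
  fL lam0) _.
rewrite lee_fin; apply: ler_wpM2l; first exact/weak_const_ge0/theta_alpha.
rewrite (@eq_I _ (lebesgueRn R n) R mu _
  (fun x => \1_(cube x0 (2 * r)) x * l2 (fun j : 'I_J => f j) x)); last first.
  by move=> x; rewrite -l2_indic.
have d0 : 0 < 4 * n%:R * r by rewrite !mulr_gt0.
have nr : n%:R * (2 * r) < 4 * n%:R * r by nra.
apply: (le_trans (ball_bound hTheta f_loc hMn J d0 mA (cube_sub_eball r20 nr))).
rewrite [leRHS]mulrA [leRHS]mulrC; apply: ler_wpM2l => //.
apply: (growth_le hTheta hD hdbl r0 d0).
rewrite -[4 * _ * _]mulrA exprD; apply: (@le_trans _ _ (4 * (2 ^+ n * r))).
  apply: ler_wpM2l => //; apply: ler_wpM2r; first exact: ltW.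
  by rewrite -natrX ler_nat ltnW// ltn_expl.
by rewrite le_eqVlt; apply/orP; left; apply/eqP; ring.
Qed.

(** The 4 comes from testing the small scales at height [lam / 4], and [2 * 3 ^+ n] from the trivial
    bound by the measure of the ball when [lam] is small. *)
Definition morrey_const : R := 4 * weak_const n (2 `^ alpha) * D ^+ (n + 2) +
  2 * 3 ^+ n * large_const n D.

End small_scales.

(** * The estimate on one ball *)

Section ball_estimate.
Context (R : realType) (n : nat) (alpha : R).
Hypotheses (n_gt0 : (0 < n)%N) (alpha01 : 0 < alpha <= 1).
Notation mu := (@lebesgue_rV R n).
Notation mfun := (measurable_fun [set: lebesgueRn R n]).
Implicit Types (x y z : 'rV[R]_n) (s : R) (m : 'rV[int]_n).
Variables (Theta : R -> R) (D : R).
Hypotheses (hTheta : growth_function Theta) (hD : 1 <= D < 2 ^+ n).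
Hypothesis hdbl : doubling Theta D.
Variables (f : nat -> 'rV[R]_n -> R) (Mn : R).
Hypothesis f_loc : forall j, loc_integrable (f j).
Hypothesis hMn : (L1_norm Theta (fun x => l2_norm (fun j => (f j x)%:E)) <= Mn%:E)%E.
Hypothesis Mn0 : 0 <= Mn.
Variable h : nat -> int -> 'rV[int]_n -> 'rV[R]_n -> R.
Hypothesis h_bump : forall j k m, bump alpha (scale R k) m (h j k m).
Variables (x0 : 'rV[R]_n) (r : R).
Hypothesis r0 : 0 < r.

Definition partial_sum P x : R :=
  \sum_(p < P) \sum_(j < P) oapp (sq_term (f j) (h j) x) 0 (code n p).

Lemma partial_sum_le P : exists N (M : seq 'rV[int]_n) k, uniq M /\
  forall x, eball x0 r x -> partial_sum P x <=
    4 * sqfun (scale R k) (@small_h R n h r k P) N M (@small_f R n f x0 r P) x +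
    (large_const n D * (r ^- n * (Theta r * Mn))) ^+ 2.
Proof.
have r30 : 0 < r / 3 by rewrite divr_gt0.
(* [k1] is the lowest exponent whose scale exceeds [r / 6]. *)
have [k1 /andP[k1r rk1]] := dyadic_scale r30.
(* A crude lower bound for all exponents occurring among the codes below [P]. *)
pose kb : int := - (\sum_(p < P) oapp (fun q => `|q.1|%N) 0%N (code n p))%N%:Z.
have [N [M [uM NM]]] := @sum_codes_le R n P kb.
have [N1 [M1 [uM1 NM1]]] := @sum_codes_le R n P k1.
exists N, M, kb; split=> // x xr.
pose F q := \sum_(j < P) sq_term (f j) (h j) x q.
have F0 q : 0 <= F q by apply: sumr_ge0 => j _; exact: sq_term_ge0.
pose Fs q := if scale R q.1 <= r / 6 then F q else 0.
pose Fl q := if scale R q.1 <= r / 6 then 0 else F q.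
have Fs0 q : 0 <= Fs q by rewrite /Fs; case: ifP.
have Fl0 q : 0 <= Fl q by rewrite /Fl; case: ifP.
have -> : partial_sum P x = \sum_(p < P) oapp Fs 0 (code n p) +
    \sum_(p < P) oapp Fl 0 (code n p).
  rewrite -big_split/=; apply: eq_bigr => p _; case: (code n p) => [q|]/=.
    by rewrite /Fs /Fl; case: ifP => _; rewrite ?addr0 ?add0r.
  by rewrite addr0 big1.
apply: lerD.
  apply: le_trans (small_sum f h_bump P N M kb xr).
  apply: NM => // p q pP pq qk; exfalso; move: qk; apply/negP; rewrite -leNgt /kb.
  have : (`|q.1| <= \sum_(p < P) oapp (fun q => `|q.1|%N) 0%N (code n p))%N.
    by rewrite (bigD1 (Ordinal pP))//= pq /= leq_addr.
  by rewrite -lez_nat abszE => /ler_normlP[]; rewrite lerNl.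
apply: le_trans (NM1 Fl Fl0 _) _.
  move=> p q _ _ qk; rewrite /Fl ifT//.
  have : scale R (q.1 + 1%:Z) <= scale R k1.
    by apply: ler_powR; rewrite ?ler1n// ler_int lezD1.
  by rewrite scaleD expr1; move: k1r; lra.
apply: le_trans (large_sum n_gt0 alpha01 hTheta hD hdbl f_loc hMn Mn0 h_bump
  P N1 x r0 uM1 (k := k1) _).
  by apply: ler_sum => i _; apply: ler_sum => m _; rewrite /Fl; case: ifP => _ //; exact: F0.
by apply/andP; split=> //; move: rk1; lra.
Qed.

Lemma measurable_partial_sum P : mfun (partial_sum P).
Proof.
apply: measurable_sum => p; apply: measurable_sum => j.
case: (code n p) => [q|]; last exact: measurable_cst.
apply: measurable_funM; last exact: measurable_cst.
by apply: measurable_indic; exact: measurable_cube.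
Qed.

Lemma measurable_partial_level P lam :
  measurable (eball x0 r `&` [set x | lam < partial_sum P x] : set (lebesgueRn R n)).
Proof.
apply: measurableI; first exact: measurable_eball.
rewrite -[X in measurable X]setTI.
rewrite (_ : [set x | _] = partial_sum P @^-1` `]lam, +oo[); last first.
  by apply/seteqP; split=> x /=; rewrite in_itv/= andbT.
exact: measurable_partial_sum.
Qed.

(** If [lam < 2 * W], where [W ^+ 2] bounds the large scales, the measure of the ball is enough.
    Otherwise the large scales account for at most [lam ^+ 2 / 4], and the remaining three quarters
    force the truncated [sqfun] above [(lam / 4) ^+ 2]. *)
Lemma partial_sum_weak P lam : 0 < lam ->
  (lam%:E * mu (eball x0 r `&` [set x | (lam ^+ 2 < partial_sum P x)%R]) <=
   (morrey_const n alpha D * (Theta r * Mn))%R%:E)%E.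
Proof.
move=> lam0; have [N [M [k [uM NM]]]] := partial_sum_le P.
set L := large_const n D; set V := Theta r * Mn.
have L0 : 0 <= L by exact: large_const_ge0.
have V0 : 0 <= V by rewrite mulr_ge0// ltW// hTheta.1.
have w0 : 0 <= weak_const n (2 `^ alpha) by exact/weak_const_ge0/theta_alpha.
have D0 : 0 <= D by have /andP[D1 _] := hD; rewrite (le_trans ler01).
pose W := L * (r ^- n * V).
have W0 : 0 <= W by rewrite mulr_ge0// mulr_ge0// expVn_ge0.
have [lW|Wl] := ltP lam (2 * W).
  apply: (@le_trans _ _ (lam%:E * ((3 * r) ^+ n)%:E)%E).
    apply: lee_pmul => //; first by rewrite lee_fin ltW.
    apply: le_trans (mu_cube_le x0 r0); apply: le_lebesgue_outer => x [+ _].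
    exact: eball_sub_cube.
  rewrite -EFinM lee_fin; apply: (@le_trans _ _ (2 * W * (3 * r) ^+ n)).
    by apply: ler_wpM2r; [rewrite exprn_ge0// mulr_ge0// ltW|exact: ltW].
  rewrite /morrey_const -/L [leRHS]mulrDl -[leLHS]add0r; apply: lerD.
    by rewrite mulr_ge0// mulr_ge0 ?exprn_ge0// mulr_ge0.
  rewrite le_eqVlt; apply/orP; left; apply/eqP; rewrite /W exprMn; field.
  by rewrite expf_neq0// gt_eqF.
have l40 : 0 < lam / 4 by rewrite divr_gt0.
have sw := small_weak n_gt0 alpha01 hTheta hD hdbl f_loc hMn Mn0 h_bump x0 r0 P N k l40 uM.
apply: (@le_trans _ _ (4%:E * ((lam / 4)%:E * mu [set x | ((lam / 4) ^+ 2 <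
     sqfun (scale R k) (@small_h R n h r k P) N M (@small_f R n f x0 r P) x)%R]))%E).
  rewrite muleA -EFinM (_ : 4 * (lam / 4) = lam); last by field.
  apply: lee_pmul => //; first by rewrite lee_fin ltW.
  apply: le_lebesgue_outer => x [/= xr xl]; have := NM x xr; rewrite -/L -/V -/W => xW.
  have : W ^+ 2 <= (lam / 2) ^+ 2.
    by apply: lerXn2r; rewrite ?nnegrE ?divr_ge0 ?(ltW lam0)//; move: Wl; lra.
  have : 0 < lam ^+ 2 by rewrite exprn_gt0.
  rewrite (_ : (lam / 2) ^+ 2 = lam ^+ 2 / 4); last by field.
  rewrite (_ : (lam / 4) ^+ 2 = lam ^+ 2 / 16); last by field.
  by move: xl xW; lra.
apply: (@le_trans _ _ (4%:E * (weak_const n (2 `^ alpha) * (D ^+ (n + 2) * V))%:E)%E).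
  by apply: lee_pmul => //; rewrite mule_ge0// lee_fin ltW.
rewrite -EFinM lee_fin /morrey_const -/L [leRHS]mulrDl -[leLHS]addr0; apply: lerD.
  by rewrite !mulrA.
by rewrite mulr_ge0// mulr_ge0// mulr_ge0// exprn_ge0.
Qed.

End ball_estimate.

(** * From partial sums to the square function *)

Section weak_morrey.
Context (R : realType) (n : nat) (alpha : R).
Hypotheses (n_gt0 : (0 < n)%N) (alpha01 : 0 < alpha <= 1).
Notation mu := (@lebesgue_rV R n).
Variables (Theta : R -> R) (D : R).
Hypotheses (hTheta : growth_function Theta) (hD : 1 <= D < 2 ^+ n).
Hypothesis hdbl : doubling Theta D.
Variables (f : nat -> 'rV[R]_n -> R) (Mn : R).
Hypothesis f_loc : forall j, loc_integrable (f j).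
Hypothesis hMn : (L1_norm Theta (fun x => l2_norm (fun j => (f j x)%:E)) <= Mn%:E)%E.
Hypothesis Mn0 : 0 <= Mn.
Variable h : nat -> int -> 'rV[int]_n -> 'rV[R]_n -> R.
Hypothesis h_bump : forall j k m, bump alpha (scale R k) m (h j k m).
Hypothesis h_max : forall j k m h', bump alpha (scale R k) m h' ->
  `|I mu (fun x => h' x * f j x)| <= 2 * `|I mu (fun x => h j k m x * f j x)|.

Lemma square_function_partial_sum x lam : 0 < lam ->
  (lam%:E < `|l2_norm (fun j => S_alpha alpha (f j) x)|)%E ->
  exists P, lam ^+ 2 < partial_sum f h P x.
Proof.
move=> lam0.
have S0 : (0 <= \sum_(j <oo) `|S_alpha alpha (f j) x| ^+ 2)%E.
  by apply: nneseries_ge0 => j _ _; apply: (@expe_ge0 _ _ 2).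
rewrite gee0_abs ?poweR_ge0// -lte_sqr ?poweR_ge0 ?lee_fin ?(ltW lam0)//.
rewrite /l2_norm sqr_poweR_half// -EFin_expe => lS.
have [P LP] : exists P, lam ^+ 2 <
    \sum_(p < P) \sum_(j < P) oapp (sq_term (f j) (h j) x) 0 (code n p).
  apply: (@nneseries2_gt R (fun j p => oapp (sq_term (f j) (h j) x) 0 (code n p))).
    by move=> j p; case: (code n p) => //= q; exact: sq_term_ge0.
  apply: (lt_le_trans lS); apply: lee_nneseries => [j _ _|j _].
    by apply: (@expe_ge0 _ _ 2).
  rewrite gee0_abs ?poweR_ge0//.
  exact: (S_alpha_sqr_le n_gt0 alpha01 (f_loc j) (@h_max j)).
by exists P.
Qed.

Lemma nondecreasing_partial_sum x : nondecreasing_seq (fun P => partial_sum f h P x).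
Proof.
have a0 j p : 0 <= oapp (sq_term (f j) (h j) x) 0 (code n p).
  by case: (code n p) => //= q; exact: sq_term_ge0.
apply/nondecreasing_seqP => P; rewrite /partial_sum.
rewrite [leRHS]big_ord_recr/= -[leLHS]addr0; apply: lerD; last exact: sumr_ge0.
by apply: ler_sum => p _; rewrite big_ord_recr/= lerDl.
Qed.

(** The level set lies in the increasing union of the measurable sets [U P]. Their bound is uniform
    in [P], so continuity from below applies to the union and monotonicity of the outer measure
    gives the rest. *)
Lemma square_function_weak x0 r lam : 0 < r -> 0 < lam ->
  (lam%:E * mu (eball x0 r `&`
     [set x | (lam%:E < `|l2_norm (fun j => S_alpha alpha (f j) x)|)%E]) <=
   (morrey_const n alpha D * (Theta r * Mn))%R%:E)%E.
Proof.
move=> r0 lam0; pose U P : set (lebesgueRn R n) :=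
  eball x0 r `&` [set x | (lam ^+ 2 < partial_sum f h P x)%R].
have mU P : measurable (U P) by exact: measurable_partial_level.
have mUU : measurable (\bigcup_P U P) by exact: bigcupT_measurable.
have ndU : nondecreasing_seq U.
  move=> P Q PQ; apply/subsetPset => x [xr xP]; split=> //.
  exact: lt_le_trans xP (nondecreasing_partial_sum x PQ).
rewrite -lee_pdivlMl// -EFinM.
apply: (@le_trans _ _ (mu (\bigcup_P U P))).
  apply: le_lebesgue_outer => x [xr /(square_function_partial_sum lam0)[P xP]].
  by exists P.
rewrite -(cvg_lim _ (nondecreasing_cvg_mu mU mUU ndU))//.
apply: lime_le.
  by apply/cvg_ex; eexists; exact: (nondecreasing_cvg_mu mU mUU ndU).
apply: nearW => P; rewrite /= EFinM lee_pdivlMl//.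
exact: (partial_sum_weak n_gt0 alpha01 hTheta hD hdbl f_loc hMn Mn0 h_bump x0 r0 P lam0).
Qed.

End weak_morrey.

Lemma morrey_const_ge0 (R : realType) (n : nat) (alpha D : R) : (0 < n)%N ->
  0 < alpha <= 1 -> 1 <= D < 2 ^+ n -> 0 <= morrey_const n alpha D.
Proof.
move=> n0 alpha01 hD; have /andP[D1 _] := hD.
have D0 : 0 <= D ^+ (n + 2) by rewrite exprn_ge0// (le_trans ler01).
rewrite /morrey_const; move: (weak_const_ge0 n0 (theta_alpha alpha01)).
move: (large_const_ge0 hD) D0; move: (large_const _ _) (D ^+ _) (weak_const _ _).
by move=> a b c a0 b0 c0; rewrite addr_ge0// !mulr_ge0// exprn_ge0.
Qed.

Lemma L1_norm_ge0 (R : realType) (n : nat) (Theta : R -> R) (g : 'rV[R]_n -> \bar R) :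
  growth_function Theta -> (0 <= L1_norm Theta g)%E.
Proof.
move=> hT; apply: le_trans (ereal_sup_ubound _); last by exists (0, 1) => /=.
apply: mule_ge0; first by rewrite lee_fin invr_ge0 ltW// hT.1.
by apply: integral_ge0 => x _; exact: abse_ge0.
Qed.

Theorem corollary2p15 (R : realType) (n : nat) (alpha : R)
    (halpha : 0 < alpha <= 1) (Theta : R -> R) (D : R)
    (hTheta : growth_function Theta) (hD : 1 <= D < 2 ^+ n)
    (hdoubling : doubling Theta D) :
  exists C : R, 0 < C /\
    forall f : nat -> 'rV[R]_n -> R, (forall j, loc_integrable (f j)) ->
      (WL1_norm Theta (fun x => l2_norm (fun j => S_alpha alpha (f j) x)) <=
       C%:E * L1_norm Theta (fun x => l2_norm (fun j => (f j x)%:E)))%E.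
Proof.
(* In dimension 0 the condition [1 <= D < 2 ^+ n] is contradictory. *)
have n0 : (0 < n)%N.
  rewrite lt0n; apply/eqP => n0; move: hD; rewrite n0 expr0 => /andP[D1].
  by rewrite ltNge D1.
have c0 := morrey_const_ge0 n0 halpha hD.
(* The added 1 secures a positive constant, as [morrey_const] is only shown to be nonnegative. *)
have C0 : 0 < morrey_const n alpha D + 1 by rewrite ltr_wpDl.
exists (morrey_const n alpha D + 1); split=> // f fl.
set N := L1_norm _ _; have N0 : (0 <= N)%E by exact: L1_norm_ge0.
have [hN|] := boolP (N == +oo%E); first by rewrite (eqP hN) gt0_muley ?lte_fin ?leey.
rewrite -ltey -ge0_fin_numE// => Nfin.
(* The bumps are frozen here, for all components, scales and positions at once; they depend on [f],
   while the constant was fixed before. *)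
have [h hh] := choice (fun q : nat * int * 'rV[int]_n =>
  extremal_bump n0 halpha q.2 (scale_gt0 R q.1.2) (fl q.1.1)).
pose M := fine N; have M0 : 0 <= M by exact: fine_ge0.
have NM : N = M%:E by rewrite /M fineK.
apply: ge_ereal_sup => _ [[x0 r] /= r0 <-].
apply: ge_ereal_sup => _ [lam /= lam0 <-].
have T0 := hTheta.1 r r0.
rewrite lee_pdivrMl//.
have NM' : (N <= M%:E)%E by rewrite NM.
have := @square_function_weak R n alpha n0 halpha Theta D hTheta hD hdoubling f M
  fl NM' M0 (fun j k m => h (j, k, m)) (fun j k m => (hh (j, k, m)).1)
  (fun j k m => (hh (j, k, m)).2) x0 r lam r0 lam0.
move/le_trans; apply; rewrite NM -!EFinM lee_fin mulrCA.
apply: ler_wpM2l; first exact: ltW.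
by apply: ler_wpM2r => //; rewrite lerDl.
Qed.
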